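(* There exists a compact set $X \subset \mathbb{C}^3$ such that $\widehat{X} \setminus X$ is nonempty, but every point of $\widehat{X}$ is a one-point Gleason part for $P(X)$ (that is, for every $x \in \widehat X$ the Gleason part of $P(X)$ containing $x$ is $\{x\}$), and there are no nonzero bounded point derivations on $P(X)$ (at any point of $\widehat{X}$).
   Context: For a compact set $X \subset \mathbb{C}^n$, $C(X)$ is the algebra of continuous complex-valued functions on $X$ with the supremum norm, and $P(X) \subset C(X)$ is the uniform closure on $X$ of the polynomials in the complex coordinate functions $z_1, \ldots, z_n$. The polynomially convex hull of $X$ is $\widehat{X} = \{z \in \mathbb{C}^n : |p(z)| \le \max_{x \in X} |p(x)| \text{ for all polynomials } p\}$. The maximal ideal space of $P(X)$ (the set of its nonzero multiplicative linear functionals) is identified with $\widehat{X}$, a point $x\in\widehat X$ corresponding to the functional that extends evaluation of polynomials at $x$. A uniform algebra on a compact Hausdorff space $X$ is a closed subalgebra of $C(X)$ that contains the constant functions and separates the points of $X$. The Gleason parts for a uniform algebra $A$ are the equivalence classes in the maximal ideal space of $A$ under the equivalence relation $\varphi \sim \psi$ if $\|\varphi - \psi\| < 2$, where the norm is that of the dual space $A^*$. For a multiplicative linear functional $\phi$ on $A$, a point derivation on $A$ at $\phi$ is a linear functional $\psi$ on $A$ satisfying $\psi(fg) = \psi(f)\phi(g) + \phi(f)\psi(g)$ for all $f, g \in A$; it is bounded if it is bounded (continuous) as a linear functional. *)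

(* Defs.v *)
From HB Require Import structures.
From mathcomp Require Import all_boot all_order all_algebra.
From mathcomp Require Import all_classical all_reals all_analysis.
From mathcomp Require Import complex.
From mathcomp Require mpoly.
From mathcomp Require Import ring lra.
Import Order.TTheory GRing.Theory Num.Theory.
Import numFieldNormedType.Exports.
Local Open Scope classical_set_scope.
Local Open Scope ring_scope.
Local Open Scope complex_scope.

(* The topology (and norm) that every numFieldType carries, made available on
   the concrete type of complex numbers. *)
HB.instance Definition _ (R : realType) := NormedModule.copy R[i] R[i]^o.

(* The real-valued modulus: `|z| itself lives in R[i]. *)
Notation cmod := Normc.normc.

Section UniformAlgebras.
Context {R : realType} {T : topologicalType}.

(* 0 when T is empty; finite and equal to the maximum when f is continuous and
   T is nonempty and compact. *)
Definition supnorm (f : T -> R[i]) : R := sup (range (fun x => cmod (f x))).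

Definition uniform_algebra (A : set (T -> R[i])) : Prop :=
  [/\ A `<=` [set f | continuous f],
      closed (A : set {uniform T -> R[i]}),
      (forall c : R[i], A (cst c)),
      (forall f g, A f -> A g -> A (f + g) /\ A (f * g)) &
      (forall x y, x <> y -> exists2 f, A f & f x <> f y)].

(* A linear functional on A is a function on the subtype of elements of A.
   "h = c f + g" and "h = f g" are stated between elements of A, so that A
   itself need not be packaged as an algebra type. *)
Context {A : set (T -> R[i])}.

Definition linear_functional (L : A -> R[i]) : Prop :=
  forall (c : R[i]) (f g h : A),
    \val h = c *: \val f + \val g -> L h = c * L f + L g.

Definition multiplicative_functional (L : A -> R[i]) : Prop :=
  forall f g h : A, \val h = \val f * \val g -> L h = L f * L g.

Definition maximal_ideal_space : set (A -> R[i]) :=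
  [set L | [/\ linear_functional L, multiplicative_functional L &
               exists f, L f <> 0]].

Definition dual_norm (L : A -> R[i]) : \bar R :=
  ereal_sup [set (cmod (L f))%:E | f in [set f : A | supnorm (\val f) <= 1]].

Definition bounded_functional (L : A -> R[i]) : Prop :=
  exists M : R, forall f : A, cmod (L f) <= M * supnorm (\val f).

Definition gleason_part (phi : A -> R[i]) : set (A -> R[i]) :=
  [set psi | maximal_ideal_space psi /\
             (dual_norm (fun f => (phi f - psi f)%R) < 2%:E)%E].

Definition point_derivation (phi psi : A -> R[i]) : Prop :=
  linear_functional psi /\
  forall f g h : A, \val h = \val f * \val g ->
    psi h = psi f * phi g + phi f * psi g.

End UniformAlgebras.

Section PolynomialAlgebra.
Context {R : realType} {n : nat}.

Definition peval (p : mpoly.mpoly n R[i]) (x : 'rV[R[i]]_n) : R[i] :=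
  mpoly.meval (fun i => x ord0 i) p.

Definition polyfun (X : set 'rV[R[i]]_n) (p : mpoly.mpoly n R[i]) : X -> R[i] :=
  fun u => peval p (\val u).

Definition polyalg (X : set 'rV[R[i]]_n) : set (X -> R[i]) :=
  closure (range (polyfun X) : set {uniform X -> R[i]}).

Definition polyhull (X : set 'rV[R[i]]_n) : set 'rV[R[i]]_n :=
  [set z | forall p, cmod (peval p z) <= supnorm (polyfun X p)].

Definition extends_evaluation {X : set 'rV[R[i]]_n} (x : 'rV[R[i]]_n)
    (phi : polyalg X -> R[i]) : Prop :=
  forall p (f : polyalg X), \val f = polyfun X p -> phi f = peval p x.

(* For X compact and x in the hull, such a phi exists and is unique
   (point_functionalP, point_functional_uniq), so the default value 0 is not
   used, and x |-> point_functional X x is a bijection from the hull onto the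
   maximal ideal space (maximal_ideal_space_polyalg). *)
Definition point_functional (X : set 'rV[R[i]]_n) (x : 'rV[R[i]]_n) : polyalg X -> R[i] :=
  xget (fun=> 0) [set phi | maximal_ideal_space phi /\ extends_evaluation x phi].

End PolynomialAlgebra.

Section Facts.
Context {R : realType}.
Implicit Types z w : R[i].

Lemma cmodE z : `|z| = (cmod z)%:C.
Proof. by case: z. Qed.

Lemma cmod_ge0 z : 0 <= cmod z.
Proof. by rewrite -lecR -cmodE normr_ge0. Qed.

Lemma cmod_distC z w : cmod (z - w) = cmod (w - z).
Proof. by apply: (@complexI R); rewrite -!cmodE distrC. Qed.

Lemma cmodB_le z w : cmod (z - w) <= cmod z + cmod w.
Proof. by rewrite -lecR rmorphD /= -!cmodE ler_normB. Qed.

Lemma cmodD_le z w : cmod (z + w) <= cmod z + cmod w.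
Proof. by rewrite -lecR rmorphD /= -!cmodE ler_normD. Qed.

Lemma cmodM z w : cmod (z * w) = cmod z * cmod w.
Proof. exact: Normc.normcM. Qed.

Lemma cmod_eq z w : (forall e : R, 0 < e -> cmod (z - w) < e) -> z = w.
Proof.
move=> h; apply/eqP; rewrite -subr_eq0 -normr_eq0 cmodE eq_complex /= eqxx andbT.
rewrite eq_le cmod_ge0 andbT leNgt; apply/negP => /h.
by rewrite ltxx.
Qed.

Lemma posC_cmod (e : R[i]) : 0 < e -> 0 < complex.Re e /\ e = (complex.Re e)%:C.
Proof.
case: e => a b; rewrite ltcE /= => /andP[/eqP -> a0]; split => //.
Qed.

Lemma cmod_continuous : continuous (fun z : R[i] => cmod z).
Proof.
move=> z; apply/(@cvgrPdist_lt R R _ (nbhs (z : R[i]))) => e e0.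
have eC : 0 < e%:C :> R[i] by rewrite ltcR.
near=> w.
have : `|z - w| < e%:C by near: w; exact: cvgr_dist_lt.
rewrite cmodE ltcR; apply: le_lt_trans.
have h1 := cmodD_le (w - z) z; have h2 := cmodD_le (z - w) w.
rewrite !subrK (cmod_distC w) in h1 h2.
by rewrite ler_norml; apply/andP; split; lra.
Unshelve. all: by end_near. Qed.

Lemma continuousCD {T : topologicalType} (f g : T -> R[i]) :
  continuous f -> continuous g -> continuous (fun x => f x + g x).
Proof. by move=> cf cg z; apply: cvgD; [exact: cf|exact: cg]. Qed.

Lemma continuousCM {T : topologicalType} (f g : T -> R[i]) :
  continuous f -> continuous g -> continuous (fun x => f x * g x).
Proof. by move=> cf cg z; apply: cvgM; [exact: cf|exact: cg]. Qed.

Lemma uniform_approx_continuous {T : topologicalType} (f : T -> R[i]) :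
  (forall e : R, 0 < e ->
    exists2 g, continuous g & forall u, cmod (f u - g u) < e) ->
  continuous f.
Proof.
move=> h u; apply/cvgrPdist_lt => e e0.
have [r0 er] := posC_cmod _ e0; set r := complex.Re e in r0 er.
have r30 : 0 < r / 3 by rewrite divr_gt0.
have [g cg hg] := h _ r30.
have r3C : 0 < (r / 3)%:C :> R[i] by rewrite ltcR.
near=> v.
have : `|g u - g v| < (r / 3)%:C.
  by near: v; apply: cvgr_dist_lt => //; exact: cg.
rewrite er !cmodE !ltcR => h1.
rewrite (_ : f u - f v = (f u - g u) + ((g u - g v) - (f v - g v))); last by ring.
apply: le_lt_trans (cmodD_le _ _) _.
have := cmodB_le (g u - g v) (f v - g v); have := hg u; have := hg v.
by lra.
Unshelve. all: by end_near. Qed.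

Lemma supnorm_ge0 {T : topologicalType} (f : T -> R[i]) : 0 <= supnorm f.
Proof.
rewrite /supnorm; set E := (X in sup X).
have [hE|/sup_out ->//] := pselect (has_sup E).
have [_ [x _ _]] := hE.1.
apply: le_trans (cmod_ge0 (f x)) _; apply: ub_le_sup; first exact: hE.2.
by exists x.
Qed.

Lemma supnorm_le {T : topologicalType} (f : T -> R[i]) (M : R) : 0 <= M ->
  (forall x, cmod (f x) <= M) -> supnorm f <= M.
Proof.
move=> M0 h; rewrite /supnorm.
have [->|/set0P ne] := eqVneq (range (fun x => cmod (f x))) set0.
  by rewrite sup0.
by apply: ge_sup => // _ [y _ <-].
Qed.

End Facts.

Section PolyalgFacts.
Context {R : realType} {n : nat}.
Implicit Types X : set 'rV[R[i]]_n.

Lemma polyalgP X (f : X -> R[i]) : polyalg X f <->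
  forall e : R, 0 < e -> exists p, forall u, cmod (f u - polyfun X p u) < e.
Proof.
split=> [cf e e0|h B].
  have eC : 0 < e%:C :> R[i] by rewrite ltcR.
  have [|_ [[p _ <-] hp]] := cf [set h | forall u, cmod (f u - h u) < e].
    apply/uniform_nbhs; exists [set xy | ball xy.1 (e%:C) xy.2]; split.
      exact: (entourage_ball _ (PosNum eC)).
    move=> h /= hh u; have := hh u I.
    by rewrite -ball_normE /= cmodE ltcR.
  by exists p.
move=> /uniform_nbhs [E [entE sE]].
move: entE; rewrite -entourage_ballE => -[e /= e0 se].
have [r0 er] := posC_cmod _ e0.
have [p hp] := h _ r0; exists (polyfun X p); split; first by exists p.
apply: sE => u _; apply: se => /=.
by rewrite -ball_normE /= er cmodE ltcR.
Qed.

Lemma polyalg_polyfun X p : polyalg X (polyfun X p).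
Proof.
move=> B Bp; exists (polyfun X p); split; first by exists p.
exact: (@nbhs_singleton {uniform X -> R[i]}).
Qed.

Lemma peval_continuous (p : mpoly.mpoly n R[i]) : continuous (peval p).
Proof.
elim/mpoly.mpolyind: p => [|c m p _ _ ih].
  rewrite (_ : peval _ = cst 0); first exact: cst_continuous.
  by apply/funext => x; rewrite /peval mpoly.meval0.
pose mon (s : seq 'I_n) (x : 'rV[R[i]]_n) : R[i] :=
  \prod_(j <- s) x ord0 j ^+ mpoly.fun_of_multinom m j.
have ccoord j : continuous (fun x : 'rV[R[i]]_n => x ord0 j).
  exact: (@coord_continuous R[i] 1 n).
have cpow j k : continuous (fun x : 'rV[R[i]]_n => x ord0 j ^+ k : R[i]).
  elim: k => [|k ihk]; first exact: cst_continuous.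
  rewrite (_ : (fun=> _) = (fun x : 'rV[R[i]]_n => x ord0 j * x ord0 j ^+ k)).
    apply: (@continuousCM _ _ (fun x : 'rV[R[i]]_n => x ord0 j)
                            (fun x : 'rV[R[i]]_n => x ord0 j ^+ k));
      [exact: ccoord|exact: ihk].
  by apply/funext => x; rewrite exprS.
have cmon s : continuous (mon s).
  elim: s => [|j s ihs].
    rewrite (_ : mon _ = cst 1); first exact: cst_continuous.
    by apply/funext => x; rewrite /mon big_nil.
  rewrite (_ : mon _ =
      (fun x => x ord0 j ^+ mpoly.fun_of_multinom m j * mon s x)).
    apply: (@continuousCM _ _ (fun x : 'rV[R[i]]_n => x ord0 j ^+ _) (mon s));
      [exact: cpow|exact: ihs].
  by apply/funext => x; rewrite /mon big_cons.
rewrite (_ : peval _ = (fun x => c * mon (index_enum _) x + peval p x)).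
  apply: (@continuousCD _ _ (fun x => c * mon (index_enum _) x) (peval p));
    last exact: ih.
  apply: (@continuousCM _ _ (cst c) (mon _));
    [exact: cst_continuous|exact: cmon].
by apply/funext => x; rewrite /peval mpoly.mevalD mpoly.mevalZ mpoly.mevalX.
Qed.

(* The ring structure of polynomials is named explicitly below because
   importing mpoly clashes with the notations of analysis. *)
Lemma peval_add p q : exists r : mpoly.mpoly n R[i],
  forall x, peval r x = peval p x + peval q x.
Proof.
exists (@GRing.add (mpoly.mpoly_mpoly__canonical__Algebra_Zmodule n R[i]) p q).
by move=> x; rewrite /peval mpoly.mevalD.
Qed.

Lemma peval_opp p : exists r : mpoly.mpoly n R[i],
  forall x, peval r x = - peval p x.
Proof.
exists (@GRing.opp (mpoly.mpoly_mpoly__canonical__Algebra_Zmodule n R[i]) p).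
by move=> x; rewrite /peval mpoly.mevalN.
Qed.

Lemma peval_mul p q : exists r : mpoly.mpoly n R[i],
  forall x, peval r x = peval p x * peval q x.
Proof.
exists (@GRing.mul (mpoly.mpoly_mpoly__canonical__GRing_PzRing n R[i]) p q).
by move=> x; rewrite /peval mpoly.mevalM.
Qed.

Lemma polyfun_continuous X p : continuous (polyfun X p).
Proof.
move=> u; apply: (@continuous_comp _ _ _ (set_val : X -> _) (peval p)).
  exact: initial_continuous.
exact: peval_continuous.
Qed.

Lemma polyalg_continuous X f : polyalg X f -> continuous f.
Proof.
move=> /polyalgP h; apply: uniform_approx_continuous => e /h[p hp].
by exists (polyfun X p) => //; exact: polyfun_continuous.
Qed.

Lemma polyalg_uapprox X (f : X -> R[i]) :
  (forall e : R, 0 < e ->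
    exists2 g, polyalg X g & forall u, cmod (f u - g u) < e) ->
  polyalg X f.
Proof.
move=> h; apply/polyalgP => e e0.
have e2 : 0 < e / 2 by rewrite divr_gt0.
have [g /polyalgP/(_ _ e2)[p hp] hg] := h _ e2; exists p => u.
rewrite (_ : f u - _ = (f u - g u) + (g u - polyfun X p u)); last by ring.
apply: le_lt_trans (cmodD_le _ _) _.
by have := hg u; have := hp u; lra.
Qed.

Lemma polyalg_cst X c : polyalg X (cst c).
Proof.
rewrite (_ : cst c = polyfun X (mpoly.mpolyC n c)); first exact: polyalg_polyfun.
by apply/funext => u; rewrite /polyfun /peval mpoly.mevalC.
Qed.

Lemma polyalgD X f g : polyalg X f -> polyalg X g ->
  polyalg X (fun u => f u + g u).
Proof.
move=> /polyalgP hf /polyalgP hg; apply/polyalgP => e e0.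
have e2 : 0 < e / 2 by rewrite divr_gt0.
have [p hp] := hf _ e2; have [q hq] := hg _ e2; have [r hr] := peval_add p q.
exists r => u.
rewrite (_ : _ - _ = (f u - polyfun X p u) + (g u - polyfun X q u)); last first.
  by rewrite /polyfun hr; ring.
apply: le_lt_trans (cmodD_le _ _) _.
by have := hp u; have := hq u; lra.
Qed.

Lemma polyfun_bounded X p : compact X ->
  exists M : R, forall u, cmod (polyfun X p u) <= M.
Proof.
move=> cX.
have /compact_bounded [M [_ hM]] : compact ((fun z => cmod (peval p z)) @` X).
  apply: continuous_compact => //; apply: continuous_subspaceT => z.
  apply: (@continuous_comp _ _ _ (peval p) (fun z => cmod z)).
    exact: peval_continuous.
  exact: cmod_continuous.
have M1 : M < M + 1 by rewrite ltrDl.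
exists (M + 1) => u.
have /= := hM _ M1 (cmod (polyfun X p u)) (ex_intro2 _ _ (\val u) (set_valP u) erefl).
by rewrite ger0_norm ?cmod_ge0.
Qed.

Lemma polyalg_bounded X f : compact X -> polyalg X f ->
  exists2 M : R, 0 < M & forall u, cmod (f u) <= M.
Proof.
move=> cX /polyalgP/(_ _ ltr01)[p hp]; have [M hM] := polyfun_bounded X p cX.
exists (Num.max 0 M + 1) => [|u].
  by apply: ltr_pwDr => //; rewrite le_max lexx.
rewrite -[f u](subrK (polyfun X p u)); apply: le_trans (cmodD_le _ _) _.
rewrite addrC lerD ?(ltW (hp u))//.
by rewrite le_max hM orbT.
Qed.

Lemma polyalg_le_supnorm X f u : compact X -> polyalg X f ->
  cmod (f u) <= supnorm f.
Proof.
move=> cX /(polyalg_bounded _ _ cX)[M _ hM]; apply: ub_le_sup; last by exists u.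
by exists M => _ [v _ <-].
Qed.

Lemma cmod_subM (a b c d : R[i]) :
  cmod (a * b - c * d) <= cmod a * cmod (b - d) + cmod (a - c) * cmod d.
Proof.
rewrite -!cmodM; apply: le_trans (cmodD_le _ _).
by rewrite (_ : _ - _ = a * (b - d) + (a - c) * d) //; ring.
Qed.

Lemma polyalgM X f g : compact X -> polyalg X f -> polyalg X g ->
  polyalg X (fun u => f u * g u).
Proof.
move=> cX pf pg; have [Mf Mf0 hMf] := polyalg_bounded _ _ cX pf.
have [Mg Mg0 hMg] := polyalg_bounded _ _ cX pg.
move/polyalgP : pf => hf; move/polyalgP : pg => hg; apply/polyalgP => e e0.
have K0 : 0 < Mf + Mg + 1 by lra.
pose d := Num.min 1 (e / (Mf + Mg + 1) / 2).
have d0 : 0 < d by rewrite lt_min ltr01 /= !divr_gt0.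
have d1 : d <= 1 by rewrite ge_min lexx.
have de : (Mf + Mg + 1) * d < e.
  apply: (@le_lt_trans _ _ (e / 2)); last by lra.
  rewrite mulrC -ler_pdivlMr // mulrAC ge_min; apply/orP; right.
  by rewrite mulrAC.
have [p hp] := hf _ d0; have [q hq] := hg _ d0; have [r hr] := peval_mul p q.
exists r => u.
rewrite [polyfun X _ u](_ : _ = polyfun X p u * polyfun X q u); last first.
  by rewrite /polyfun hr.
apply: le_lt_trans (cmod_subM _ _ _ _) _; apply: le_lt_trans de.
have hqM : cmod (polyfun X q u) <= Mg + 1.
  rewrite -[polyfun X q u](subrK (g u)); apply: le_trans (cmodD_le _ _) _.
  by rewrite cmod_distC; have := hq u; have := hMg u; lra.
have h1 : cmod (f u) * cmod (g u - polyfun X q u) <= Mf * d.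
  by apply: ler_pM; rewrite ?cmod_ge0 ?hMf ?(ltW (hq u)).
have h2 : cmod (f u - polyfun X p u) * cmod (polyfun X q u) <= d * (Mg + 1).
  by apply: ler_pM; rewrite ?cmod_ge0 ?(ltW (hp u)).
by lra.
Qed.

Lemma polyalg_uniform_algebra X : compact X -> uniform_algebra (polyalg X).
Proof.
move=> cX; split.
- by move=> f /polyalg_continuous.
- exact: closed_closure.
- exact: polyalg_cst.
- by move=> f g pf pg; split; [exact: polyalgD|exact: polyalgM].
- move=> u v uv; have [i hi] : exists i, \val u ord0 i <> \val v ord0 i.
    apply: contrapT => /forallNP h; apply: uv; apply/val_inj/matrixP => a i.
    by rewrite (ord1 a); exact: contrapT.
  exists (polyfun X (mpoly.mpolyX _ (mpoly.mnm1 i))); first exact: polyalg_polyfun.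
  by rewrite /polyfun /peval !mpoly.mevalXU.
Qed.

Section Characters.
Context {X : set 'rV[R[i]]_n}.
Context (cX : compact X).
Implicit Types (phi : polyalg X -> R[i]).

Let mk f (pf : polyalg X f) : polyalg X := SigSub (mem_set pf).
Let polyval (f : polyalg X) : polyalg X (\val f) := set_valP f.

Lemma character_one phi (f : polyalg X) : maximal_ideal_space phi ->
  \val f = cst 1 -> phi f = 1.
Proof.
move=> [_ mphi [g /eqP g0]] f1.
have e : phi g = phi g * phi f.
  by apply: mphi; rewrite f1; apply/funext => u; rewrite /GRing.mul /= mulr1.
by apply: (mulfI g0); rewrite mulr1 -e.
Qed.

Lemma linear_functionalE phi c (f g h : polyalg X) : linear_functional phi ->
  (forall u, \val h u = c * \val f u + \val g u) ->
  phi h = c * phi f + phi g.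
Proof. by move=> lphi hE; apply: lphi; apply/funext => u; exact: hE. Qed.

Lemma linear_functional_scale phi c (f h : polyalg X) : linear_functional phi ->
  (forall u, \val h u = c * \val f u) -> phi h = c * phi f.
Proof.
move=> lphi hE; pose z := mk _ (polyalg_cst X 0).
have z0 : phi z = 0.
  rewrite (linear_functionalE phi (-1) z z z)// ?mulN1r ?addNr// => u /=.
  by rewrite mulr0 addr0.
rewrite (linear_functionalE phi c f z h)// ?z0 ?addr0// => u.
by rewrite hE addr0.
Qed.

Lemma linear_functional_sub phi (f g h : polyalg X) : linear_functional phi ->
  (forall u, \val h u = \val f u - \val g u) -> phi h = phi f - phi g.
Proof.
move=> lphi hE; rewrite (linear_functionalE phi (-1) g f h)//.
  by rewrite mulN1r addrC.
by move=> u; rewrite hE mulN1r addrC.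
Qed.

Lemma cmodX (z : R[i]) k : cmod (z ^+ k) = cmod z ^+ k.
Proof.
by elim: k => [|k ih]; rewrite ?expr0 ?Normc.normc1// !exprS cmodM ih.
Qed.

Lemma polyalg_geom f (r : R) : 0 <= r -> r < 1 -> polyalg X f ->
  (forall u, cmod (f u) <= r) -> polyalg X (fun u => (1 - f u)^-1).
Proof.
move=> r0 r1 pf hf; apply: polyalg_uapprox => e e0.
have pS N : polyalg X (fun u => \sum_(k < N) f u ^+ k).
  elim: N => [|N ih].
    rewrite (_ : (fun=> _) = cst 0); first exact: polyalg_cst.
    by apply/funext => u; rewrite big_ord0.
  rewrite (_ : (fun=> _) = (fun u => 1 + f u * \sum_(k < N) f u ^+ k)).
    by apply: (polyalgD _ (cst 1)); [exact: polyalg_cst|exact: polyalgM].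
  apply/funext => u; rewrite big_ord_recl expr0 mulr_sumr; congr (_ + _).
  by apply: eq_bigr => k _; rewrite -exprS.
have d0 : 0 < 1 - r by rewrite subr_gt0.
have [N hN] : exists N, r ^+ N < e * (1 - r).
  have /cvgrPdist_lt/(_ _ (mulr_gt0 e0 d0)) : r ^+ N @[N --> \oo] --> (0 : R).
    by apply: cvg_expr; rewrite ger0_norm.
  move=> [N _ /(_ N (leqnn N))] /=; rewrite sub0r normrN ger0_norm ?exprn_ge0//.
  by exists N.
exists (fun u => \sum_(k < N) f u ^+ k) => // u.
have h1 : 1 - r <= cmod (1 - f u).
  have := cmodD_le (1 - f u) (f u); rewrite subrK Normc.normc1.
  by have := hf u; lra.
have n0 : 1 - f u != 0.
  apply: contraTneq (lt_le_trans d0 h1) => ->.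
  by rewrite Normc.normc0 ltxx.
have -> : (1 - f u)^-1 - \sum_(k < N) f u ^+ k = f u ^+ N / (1 - f u).
  apply: (mulfI n0); rewrite mulrBr divff// mulrCA divff// mulr1.
  by rewrite -(opprB (f u) 1) mulNr opprK -subrX1 addrC subrK.
rewrite cmodM Normc.normcV cmodX.
rewrite ltr_pdivrMr ?(lt_le_trans d0 h1)//.
apply: (@le_lt_trans _ _ (r ^+ N)); first by rewrite lerXn2r ?nnegrE ?cmod_ge0.
by apply: lt_le_trans hN _; rewrite ler_pM2l.
Qed.

Lemma character_contractive phi (f : polyalg X) : maximal_ideal_space phi ->
  cmod (phi f) <= supnorm (\val f).
Proof.
move=> mphi; have [lphi hphi _] := mphi.
rewrite leNgt; apply/negP => lt.
have s0 : 0 <= supnorm (\val f) by exact: supnorm_ge0.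
have p0 : 0 < cmod (phi f) := le_lt_trans s0 lt.
have n0 : phi f != 0.
  by apply: contraTneq p0 => ->; rewrite Normc.normc0 ltxx.
pose g := mk _ (polyalgM _ _ _ cX (polyalg_cst X (phi f)^-1) (polyval f)).
have pg : phi g = 1.
  by rewrite (linear_functional_scale phi (phi f)^-1 f) ?mulVf.
pose r := supnorm (\val f) / cmod (phi f).
have r0 : 0 <= r by rewrite divr_ge0 ?cmod_ge0.
have r1 : r < 1 by rewrite ltr_pdivrMr ?mul1r.
have hg u : cmod (\val g u) <= r.
  rewrite /= cmodM Normc.normcV mulrC ler_pM2r ?invr_gt0//.
  by apply: polyalg_le_supnorm => //; exact: polyval.
pose h := mk _ (polyalg_geom _ _ r0 r1 (polyval g) hg).
pose one := mk _ (polyalg_cst X 1).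
pose k := mk _ (polyalgD _ _ _ (polyval one)
  (polyalgM _ _ _ cX (polyalg_cst X (-1)) (polyval g))).
have pk : phi k = 0.
  rewrite (linear_functional_sub phi one g) ?pg ?(character_one phi one)//.
    by rewrite subrr.
  by move=> u /=; rewrite mulN1r.
have : phi one = phi h * phi k.
  apply: hphi; apply/funext => u; rewrite /GRing.mul /= mulN1r mulVf //.
  have := hg u; apply: contraTneq => /eqP; rewrite subr_eq0 => /eqP e.
  by rewrite -ltNge /= -e Normc.normc1.
by rewrite pk mulr0 (character_one phi one)// => /eqP; rewrite oner_eq0.
Qed.

Lemma character_uniq x phi psi :
  maximal_ideal_space phi -> extends_evaluation x phi ->
  maximal_ideal_space psi -> extends_evaluation x psi -> phi = psi.
Proof.
move=> mphi ephi mpsi epsi; apply/funext => f; apply: cmod_eq => e e0.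
have e3 : 0 < e / 3 by rewrite divr_gt0.
have [p hp] := (polyalgP X _).1 (polyval f) _ e3.
pose g := mk _ (polyalg_polyfun X p).
pose d := mk _ (polyalgD _ _ _ (polyval f)
  (polyalgM _ _ _ cX (polyalg_cst X (-1)) (polyval g))).
have dE chi : maximal_ideal_space chi -> cmod (chi f - chi g) <= e / 3.
  move=> mchi; have [lchi _ _] := mchi.
  rewrite -(linear_functional_sub chi f g d)//; last first.
    by move=> u /=; rewrite mulN1r.
  apply: le_trans (character_contractive _ _ mchi) _.
  apply: supnorm_le; first exact: ltW.
  by move=> u /=; rewrite mulN1r; exact/ltW/hp.
have gE : phi g = psi g by rewrite (ephi p g)// (epsi p g).
rewrite (_ : _ - _ = (phi f - phi g) - (psi f - psi g)); last by rewrite gE; ring.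
apply: le_lt_trans (cmodB_le _ _) _.
by have := dE _ mphi; have := dE _ mpsi; lra.
Qed.

Lemma character_is_point phi : maximal_ideal_space phi ->
  exists2 x, polyhull X x & extends_evaluation x phi.
Proof.
move=> mphi; have [lphi hphi _] := mphi.
pose P p := mk _ (polyalg_polyfun X p).
pose x : 'rV[R[i]]_n := \row_j phi (P (mpoly.mpolyX _ (mpoly.mnm1 j))).
have phiP p : phi (P p) = peval p x.
  have phiM g h k : (forall u, \val k u = \val g u * \val h u) ->
    phi k = phi g * phi h.
    by move=> e; apply: hphi; apply/funext => u; exact: e.
  pose one := mk _ (polyalg_cst X 1); pose zero := mk _ (polyalg_cst X 0).
  have one1 : phi one = 1 by rewrite (character_one phi one).
  have zero0 : phi zero = 0.
    by rewrite (linear_functional_sub phi zero zero zero)// ?subrr// => u; rewrite subrr.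
  have phi_pow j k (g : polyalg X) : (forall u, \val g u = (\val u) ord0 j ^+ k) ->
      phi g = x ord0 j ^+ k.
    elim: k g => [|k ih] g hg.
      rewrite (phiM one one g) ?one1 ?mulr1// => u.
      by rewrite hg /= mulr1.
    pose g' := mk _ (polyalg_polyfun X (mpoly.mpolyX _ (mpoly.mnm1 j))).
    have pk : polyalg X (fun u => \val u ord0 j ^+ k).
      elim: (k) => [|l ihl]; first exact: (polyalg_cst X 1).
      rewrite (_ : (fun=> _) = (fun u => \val g' u * (\val u ord0 j ^+ l))).
        by apply: polyalgM => //; exact: polyval.
      by apply/funext => u; rewrite exprS /= /polyfun /peval mpoly.mevalXU.
    rewrite (phiM g' (mk _ pk) g); last first.
      by move=> u; rewrite hg exprS /= /polyfun /peval mpoly.mevalXU.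
    by rewrite (ih (mk _ pk))// exprS; congr (_ * _); rewrite /x mxE.
  have phi_mon (s : seq 'I_n) m (g : polyalg X) :
      (forall u, \val g u = \prod_(j <- s) (\val u) ord0 j ^+ mpoly.fun_of_multinom m j) ->
      phi g = \prod_(j <- s) x ord0 j ^+ mpoly.fun_of_multinom m j.
    have ppow j k : polyalg X (fun u => \val u ord0 j ^+ k).
      elim: k => [|l ihl]; first exact: (polyalg_cst X 1).
      rewrite (_ : (fun=> _) =
        (fun u => \val (P (mpoly.mpolyX _ (mpoly.mnm1 j))) u * (\val u ord0 j ^+ l))).
        by apply: polyalgM => //; exact: polyval.
      by apply/funext => u; rewrite exprS /= /polyfun /peval mpoly.mevalXU.
    elim: s g => [|j s ih] g hg.
      rewrite (phiM one one g) ?one1 ?mulr1 ?big_nil// => u.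
      by rewrite hg big_nil /= mulr1.
    have ps : polyalg X
        (fun u => \prod_(j <- s) (\val u) ord0 j ^+ mpoly.fun_of_multinom m j).
      elim: (s) => [|l t iht].
        rewrite (_ : (fun=> _) = cst 1); first exact: polyalg_cst.
        by apply/funext => u; rewrite big_nil.
      rewrite (_ : (fun=> _) = (fun u : X => \val u ord0 l ^+ mpoly.fun_of_multinom m l *
        \prod_(j <- t) (\val u) ord0 j ^+ mpoly.fun_of_multinom m j)).
        by apply: polyalgM.
      by apply/funext => u; rewrite big_cons.
    rewrite (phiM (mk _ (ppow j (mpoly.fun_of_multinom m j))) (mk _ ps) g); last first.
      by move=> u; rewrite hg big_cons.
    by rewrite big_cons (ih (mk _ ps))// (phi_pow j (mpoly.fun_of_multinom m j)).
  elim/mpoly.mpolyind: p => [|c m p _ _ ih].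
    rewrite /peval mpoly.meval0 -zero0; congr (phi _); apply/val_inj/funext => u.
    by rewrite /= /polyfun /peval mpoly.meval0.
  rewrite (linear_functionalE phi c (P (mpoly.mpolyX _ m)) (P p))//; last first.
    by move=> u; rewrite /= /polyfun /peval mpoly.mevalD mpoly.mevalZ.
  rewrite ih /peval mpoly.mevalD mpoly.mevalZ mpoly.mevalX; congr (_ * _ + _).
  by apply: phi_mon => u; rewrite /= /polyfun /peval mpoly.mevalX.
exists x.
  by move=> p; rewrite -phiP; exact: (character_contractive phi (P p) mphi).
by move=> p f fE; rewrite -phiP; congr (phi _); exact: val_inj.
Qed.

(* The value at f is the limit of p(x) as p tends to f uniformly on X; its
   real and imaginary parts are obtained as suprema of lower approximations. *)
Lemma hull_character x : polyhull X x ->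
  exists2 phi : polyalg X -> R[i], maximal_ideal_space phi & extends_evaluation x phi.
Proof.
move=> hx.
have hpq p q (e : R) : 0 <= e ->
    (forall u, cmod (polyfun X p u - polyfun X q u) <= e) ->
    cmod (peval p x - peval q x) <= e.
  move=> e0 h; have [q' hq'] := peval_opp q; have [r hr] := peval_add p q'.
  rewrite -hq' -hr; apply: le_trans (hx r) _; apply: supnorm_le => // u.
  by rewrite /polyfun hr hq'; exact: h.
have real_val (part : R[i] -> R) (f : polyalg X) :
    (forall z w, part z - part w <= cmod (z - w)) ->
    exists v : R, forall p e, (forall u, cmod (\val f u - polyfun X p u) <= e) ->
      0 <= e -> `|v - part (peval p x)| <= e.
  move=> hpart.
  pose S := [set t : R | exists p e, [/\ 0 <= e,
    forall u, cmod (\val f u - polyfun X p u) <= e & t = part (peval p x) - e]].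
  have ub p e : (forall u, cmod (\val f u - polyfun X p u) <= e) -> 0 <= e ->
      ubound S (part (peval p x) + e).
    move=> hp e0 _ [q [d [d0 hq ->]]].
    suff : part (peval q x) - part (peval p x) <= d + e by lra.
    apply: le_trans (hpart _ _) _; apply: hpq; first by rewrite addr_ge0.
    move=> u; rewrite (_ : _ - _ = (\val f u - polyfun X p u) -
      (\val f u - polyfun X q u)); last by ring.
    apply: le_trans (cmodB_le _ _) _.
    by have := hp u; have := hq u; lra.
  exists (sup S) => p e hp e0.
  have Sp : S (part (peval p x) - e) by exists p, e.
  have h1 : sup S <= part (peval p x) + e.
    by apply: ge_sup; [eexists; exact: Sp|exact: ub].
  have h2 : part (peval p x) - e <= sup S.
    by apply: ub_le_sup => //; exists (part (peval p x) + e); exact: ub.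
  by rewrite ler_norml; apply/andP; split; lra.
have cmod_Re (z : R[i]) : complex.Re z <= cmod z.
  rewrite -lecR -cmodE; apply: le_trans (normc_ge_Re z).
  by rewrite lecR ler_norm.
have val_ex (f : polyalg X) : exists v : R[i], forall p e,
    (forall u, cmod (\val f u - polyfun X p u) <= e) -> 0 <= e ->
    cmod (v - peval p x) <= 2 * e.
  have [|a ha] := real_val (@complex.Re R) f.
    by move=> [a b] [c d]; exact: (cmod_Re ((a +i* b) - (c +i* d))).
  have [|b hb] := real_val (fun z => complex.Re (- 'i * z)) f.
    move=> z w; have := cmod_Re (- 'i * (z - w)).
    rewrite cmodM (_ : cmod (- 'i) = 1) ?mul1r.
      by apply: le_trans; case: z => ? ?; case: w => ? ? /=; simpc => /=; lra.
    by rewrite /= oppr0 expr0n /= add0r sqrrN expr1n sqrtr1.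
  exists (a +i* b) => p e hp e0; have := hb _ _ hp e0; have := ha _ _ hp e0.
  case: (peval p x) => c d.
  have -> : complex.Re (- 'i * (c +i* d)) = d by rewrite /=; ring.
  move=> h1 h2; rewrite /= in h1.
  have -> : (a +i* b) - (c +i* d) = (a - c)%:C + (0 +i* (b - d)).
    by apply/eqP; rewrite eq_complex /= addr0 add0r !eqxx.
  apply: le_trans (cmodD_le _ _) _.
  rewrite /= expr0n /= addr0 add0r !sqrtr_sqr.
  have -> : 2 * e = e + e by ring.
  exact: lerD.
have /choice[phi hphi] := val_ex.
exists phi; last first.
  move=> p f fE; apply: cmod_eq => e e0; apply: le_lt_trans e0.
  have /hphi/(_ (lexx 0)) : forall u, cmod (\val f u - polyfun X p u) <= 0.
    by move=> u; rewrite fE subrr Normc.normc0.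
  by rewrite mulr0.
have approx (f : polyalg X) e : 0 < e -> exists p,
    (forall u, cmod (\val f u - polyfun X p u) <= e) /\
    cmod (phi f - peval p x) <= 2 * e.
  move=> e0; have [p hp] := (polyalgP X _).1 (polyval f) _ e0.
  have hp' u : cmod (\val f u - polyfun X p u) <= e by exact: ltW.
  by exists p; split => //; exact: hphi hp' (ltW e0).
have small (z w : R[i]) (K : R) : 0 < K ->
    (forall e : R, 0 < e -> e <= 1 -> cmod (z - w) <= K * e) -> z = w.
  move=> K0 h; apply: cmod_eq => e e0.
  pose d := Num.min 1 (e / K / 2).
  have d0 : 0 < d by rewrite lt_min ltr01 /= !divr_gt0.
  have d1 : d <= 1 by rewrite ge_min lexx.
  apply: le_lt_trans (h _ d0 d1) _.
  apply: (@le_lt_trans _ _ (e / 2)); last by lra.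
  rewrite mulrC -ler_pdivlMr // mulrAC ge_min; apply/orP; right.
  by rewrite mulrAC.
split.
- move=> c f g h hE.
  apply: (small _ _ (4 * (cmod c + 1))) => [|e e0 e1].
    by rewrite mulr_gt0// ltr_wpDl ?cmod_ge0.
  have [p [hp vp]] := approx f _ e0; have [q [hq vq]] := approx g _ e0.
  have [r hr] := peval_mul (mpoly.mpolyC n c) p; have [s hs] := peval_add r q.
  have sE y : peval s y = c * peval p y + peval q y.
    by rewrite hs hr /peval mpoly.mevalC.
  have hs' u : cmod (\val h u - polyfun X s u) <= (cmod c + 1) * e.
    have -> : \val h u = c * \val f u + \val g u by rewrite hE.
    rewrite [polyfun X s u]sE.
    rewrite (_ : _ - _ = c * (\val f u - polyfun X p u) + (\val g u - polyfun X q u)).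
      apply: le_trans (cmodD_le _ _) _; rewrite mulrDl mul1r cmodM lerD ?hq//.
      by rewrite ler_wpM2l ?cmod_ge0.
    by rewrite /polyfun; ring.
  have vh := hphi _ _ _ hs' (mulr_ge0 (addr_ge0 (cmod_ge0 c) ler01) (ltW e0)).
  rewrite (_ : phi h - _ = (phi h - peval s x) -
    (c * (phi f - peval p x) + (phi g - peval q x))); last by rewrite sE; ring.
  apply: le_trans (cmodB_le _ _) _.
  have := cmodD_le (c * (phi f - peval p x)) (phi g - peval q x).
  have : cmod (c * (phi f - peval p x)) <= cmod c * (2 * e).
    by rewrite cmodM ler_wpM2l ?cmod_ge0.
  by lra.
- move=> f g h hE.
  have [Mf Mf0 hMf] := polyalg_bounded _ _ cX (polyval f).
  have [Mg Mg0 hMg] := polyalg_bounded _ _ cX (polyval g).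
  have := cmod_ge0 (phi f); have := cmod_ge0 (phi g) => vg0 vf0.
  apply: (small _ _ (2 * (Mf + Mg + 1) + 2 * cmod (phi f) + 2 * (cmod (phi g) + 2)))
    => [|e e0 e1]; first by lra.
  have [p [hp vp]] := approx f _ e0; have [q [hq vq]] := approx g _ e0.
  have [r hr] := peval_mul p q.
  have hr' u : cmod (\val h u - polyfun X r u) <= (Mf + Mg + 1) * e.
    have -> : \val h u = \val f u * \val g u by rewrite hE.
    rewrite [polyfun X r u]hr; apply: le_trans (cmod_subM _ _ _ _) _.
    have hqM : cmod (polyfun X q u) <= Mg + 1.
      rewrite -[polyfun X q u](subrK (\val g u)); apply: le_trans (cmodD_le _ _) _.
      by rewrite cmod_distC; have := hq u; have := hMg u; lra.
    have h1 : cmod (\val f u) * cmod (\val g u - polyfun X q u) <= Mf * e.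
      by apply: ler_pM; rewrite ?cmod_ge0 ?hMf ?hq.
    have h2 : cmod (\val f u - polyfun X p u) * cmod (polyfun X q u) <= e * (Mg + 1).
      by apply: ler_pM; rewrite ?cmod_ge0 ?hp.
    by rewrite /polyfun in h1 h2 *; lra.
  have K0 : 0 <= (Mf + Mg + 1) * e by rewrite mulr_ge0// ?(ltW e0)//; lra.
  have vh := hphi _ _ _ hr' K0.
  rewrite (_ : phi h - _ = (phi h - peval r x) -
    (phi f * phi g - peval p x * peval q x)); last by rewrite hr; ring.
  apply: le_trans (cmodB_le _ _) _.
  have := cmod_subM (phi f) (phi g) (peval p x) (peval q x).
  have h1 : cmod (phi f) * cmod (phi g - peval q x) <= cmod (phi f) * (2 * e).
    by rewrite ler_wpM2l.
  have hq2 : cmod (peval q x) <= cmod (phi g) + 2.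
    rewrite -[peval q x](subrK (phi g)); apply: le_trans (cmodD_le _ _) _.
    by rewrite cmod_distC; lra.
  have h2 : cmod (phi f - peval p x) * cmod (peval q x) <=
      2 * e * (cmod (phi g) + 2).
    by apply: ler_pM; rewrite ?cmod_ge0.
  by lra.
- pose one := mk _ (polyalg_cst X 1); exists one.
  have h0 u : cmod (\val one u - polyfun X (mpoly.mpolyC n 1) u) <= 0.
    by rewrite /polyfun /peval mpoly.mevalC subrr Normc.normc0.
  have := hphi _ _ _ h0 (lexx 0); rewrite mulr0 /peval mpoly.mevalC => + e1.
  by rewrite e1 cmod_distC subr0 Normc.normc1 ler10.
Qed.

Lemma point_functionalP x : polyhull X x ->
  maximal_ideal_space (point_functional X x) /\
  extends_evaluation x (point_functional X x).
Proof.
move=> /hull_character[phi mphi ephi].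
by apply: (@xgetPex _ (fun=> 0) [set psi | maximal_ideal_space psi /\ extends_evaluation x psi]); exists phi.
Qed.

Lemma point_functional_uniq x phi : polyhull X x ->
  maximal_ideal_space phi -> extends_evaluation x phi ->
  phi = point_functional X x.
Proof.
by move=> /point_functionalP[m e] mphi ephi; exact: character_uniq m e.
Qed.

Lemma maximal_ideal_space_polyalg :
  set_bij (polyhull X) (@maximal_ideal_space R X (polyalg X)) (point_functional X).
Proof.
split.
- by move=> x /point_functionalP[].
- move=> x y /set_mem/point_functionalP[_ ex] /set_mem/point_functionalP[_ ey] xy.
  apply/matrixP => a i; rewrite (ord1 a).
  pose p := mpoly.mpolyX R[i] (mpoly.mnm1 i).
  pose f := mk _ (polyalg_polyfun X p).
  have := ey p f erefl; rewrite -xy (ex p f erefl).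
  by rewrite /peval !mpoly.mevalXU.
- move=> phi mphi; have [x hx ex] := character_is_point phi mphi.
  by exists x => //; exact/esym/point_functional_uniq.
Qed.

End Characters.

End PolyalgFacts.

(* Main.v *)
Require Import Defs.
From mathcomp Require Import all_boot all_order all_algebra.
From mathcomp Require Import all_classical all_reals all_analysis.
From mathcomp Require Import complex.
From mathcomp Require mpoly.
From mathcomp Require Import ring lra.
Import Order.TTheory GRing.Theory Num.Theory.
Import numFieldNormedType.Exports.
Local Open Scope classical_set_scope.
Local Open Scope ring_scope.
Local Open Scope complex_scope.

(** Two facts reduce the theorem to a construction.  Suppose that every polynomial
    is, uniformly on X, a limit of squares of polynomials (dense_squares).

    If p vanishes at x and p is close to z^2, then z(x) is small, and a bounded
    point derivation psi at x gives psi(p), nearly 2 z(x) psi(z), arbitrarily small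
    values; so psi vanishes (no_point_derivation).  If moreover p is bounded by 1 on
    X and p(y) <> 0, then repeated approximate square roots raise |p(y)| to
    nearly 1 while the value at x stays nearly 0.  A disc automorphism separates
    these two values to nearly -1 and 1, so the functionals at x and y have distance
    2 and the Gleason parts are points (trivial_gleason_part).

    It remains to find such an X in C^3 that is not polynomially convex.  Following
    Cole, adjoin square roots to the disc algebra: over the closed unit disc of the
    coordinate z0 consider the tower z_k^2 = q_k(z0, ..., z_(k-1)), where q_k is the
    k-th term of a dense sequence of polynomials up to a small constant.  In the
    limit every polynomial is a limit of the squares z_k^2.  The sums over the two
    sheets of the powers of a function live one level below, so a function on the
    tower is bounded above z0 = 0 by its supremum above |z0| = 1 (center_le_step):
    the points above 0 lie in the hull of the part above the circle, but not in it.

    The point is to realize this tower in C^3 by z0 and two functions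
    w = sum_k c_k z_k and v = sum_k c_k th_k z_k in such a way that every z_k is a
    uniform limit of polynomials in (z0, w, v).  By induction on the level one keeps
    the curve immersed with no tangent in the next direction (0, 1, th).  In
    algebraic terms, the differentials relative to z0 are generated by d(v - th w)
    (cyclicD_step); this needs some functions to be invertible modulo the
    ramification, which holds for generic constants (generic_unit).  The immersion
    provides a polynomial that nearly vanishes on the curve and has slope nearly 1
    in the direction (0, 1, th) (transversal_normal).  After the small displacement
    of the curve by c z_k (0, 1, th) its value is nearly c z_k, and Newton's
    iteration recovers z_k from it (decodable_step).  Since the later constants c_k
    are as small as desired, all this persists in the limit (square_approx). *)

(** * Polynomial expressions in countably many variables *)

Section Expressions.
Context {R : realType}.
Local Notation C := R[i].

(** Syntax rather than functions, so that formal partial derivatives, substitution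
    and the set of occurring variables are available. *)
Inductive pexp : Type :=
  Cst of C | Var of nat | Add of pexp & pexp | Mul of pexp & pexp.

Fixpoint ev (u : nat -> C) (e : pexp) : C :=
  match e with
  | Cst c => c
  | Var i => u i
  | Add a b => ev u a + ev u b
  | Mul a b => ev u a * ev u b
  end.

Fixpoint der (i : nat) (e : pexp) : pexp :=
  match e with
  | Cst _ => Cst 0
  | Var j => Cst (j == i)%:R
  | Add a b => Add (der i a) (der i b)
  | Mul a b => Add (Mul (der i a) b) (Mul a (der i b))
  end.

Fixpoint vars_in (P : pred nat) (e : pexp) : bool :=
  match e with
  | Cst _ => true
  | Var i => P i
  | Add a b | Mul a b => vars_in P a && vars_in P b
  end.

Fixpoint psubst (s : nat -> pexp) (e : pexp) : pexp :=
  match e with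
  | Cst c => Cst c
  | Var i => s i
  | Add a b => Add (psubst s a) (psubst s b)
  | Mul a b => Mul (psubst s a) (psubst s b)
  end.

Lemma ev_ext (P : pred nat) e u v : vars_in P e -> (forall i, P i -> u i = v i) ->
  ev u e = ev v e.
Proof.
by move=> + h; elim: e => /= [//|i|a iha b ihb /andP[/iha -> /ihb ->]|a iha b ihb /andP[/iha -> /ihb ->]] //; exact: h.
Qed.

Lemma vars_in_sub (P Q : pred nat) e : (forall i, P i -> Q i) -> vars_in P e -> vars_in Q e.
Proof.
by move=> h; elim: e => /= [//|i|a iha b ihb /andP[/iha -> /ihb ->]|a iha b ihb /andP[/iha -> /ihb ->]] //; exact: h.
Qed.

Lemma vars_in_der P i e : vars_in P e -> vars_in P (der i e).
Proof.
by elim: e => //= a iha b ihb /andP[ha hb]; rewrite iha ?ihb ?ha ?hb.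
Qed.

Lemma ev_der_notin (P : pred nat) i e u : vars_in P e -> ~~ P i -> ev u (der i e) = 0.
Proof.
move=> + nP; elim: e => //= [j Pj|a iha b ihb /andP[/iha -> /ihb ->]|a iha b ihb /andP[/iha -> /ihb ->]].
- by case: eqP nP Pj => //= -> /negP.
- by rewrite addr0.
- by rewrite mul0r mulr0 addr0.
Qed.

Lemma ev_psubst s e u : ev u (psubst s e) = ev (fun i => ev u (s i)) e.
Proof. by elim: e => //= a -> b ->. Qed.

Lemma vars_in_psubst (P Q : pred nat) s e :
  vars_in P e -> (forall i, P i -> vars_in Q (s i)) -> vars_in Q (psubst s e).
Proof.
by move=> + h; elim: e => /= [//|i|a iha b ihb /andP[/iha -> /ihb ->]|a iha b ihb /andP[/iha -> /ihb ->]] //; exact: h.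
Qed.

Lemma ev_bound (P : pred nat) e (B : R) : vars_in P e -> exists2 M, 0 < M &
  forall u, (forall i, P i -> cmod (u i) <= B) -> cmod (ev u e) <= M.
Proof.
elim: e => /= [c _|i Pi|a iha b ihb /andP[/iha[M M0 hM] /ihb[N N0 hN]]|
    a iha b ihb /andP[/iha[M M0 hM] /ihb[N N0 hN]]].
- exists (cmod c + 1) => [|u _]; first by rewrite ltr_wpDl ?cmod_ge0.
  by rewrite lerDl.
- exists (`|B| + 1) => [|u hu]; first by rewrite ltr_wpDl.
  apply: le_trans (hu _ Pi) _; apply: le_trans (ler_norm _) _.
  by rewrite lerDl.
- exists (M + N) => [|u hu]; first exact: addr_gt0.
  by apply: le_trans (cmodD_le _ _) _; rewrite lerD ?hM ?hN.
- exists (M * N) => [|u hu]; first exact: mulr_gt0.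
  by rewrite cmodM ler_pM ?cmod_ge0 ?hM ?hN.
Qed.

Definition coord_dist m (u v : nat -> C) : R := \sum_(i < m) cmod (u i - v i).

Lemma dst_ge0 m u v : 0 <= coord_dist m u v.
Proof. by apply: sumr_ge0 => i _; exact: cmod_ge0. Qed.

Lemma dst_coord m u v i : (i < m)%N -> cmod (u i - v i) <= coord_dist m u v.
Proof.
move=> im; rewrite /coord_dist (bigD1 (Ordinal im))//= lerDl.
by apply: sumr_ge0 => j _; exact: cmod_ge0.
Qed.

Definition coords_le m (B : R) (u : nat -> C) := forall i, (i < m)%N -> cmod (u i) <= B.

Lemma ev_lip m e (B : R) : vars_in (fun i => (i < m)%N) e -> exists2 L, 0 < L &
  forall u v, coords_le m B u -> coords_le m B v -> cmod (ev u e - ev v e) <= L * coord_dist m u v.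
Proof.
elim: e => /= [c _|i im|a iha b ihb /andP[/iha[L L0 hL] /ihb[N N0 hN]]|a iha b ihb].
- exists 1 => // u v _ _; rewrite subrr Normc.normc0 mul1r; exact: dst_ge0.
- by exists 1 => // u v _ _; rewrite mul1r; exact: dst_coord.
- exists (L + N) => [|u v hu hv]; first exact: addr_gt0.
  rewrite opprD addrACA mulrDl; apply: le_trans (cmodD_le _ _) _.
  by rewrite lerD ?hL ?hN.
- move=> /andP[oka okb]; have [L L0 hL] := iha oka; have [N N0 hN] := ihb okb.
  have [M M0 hM] := ev_bound _ _ B oka; have [K K0 hK] := ev_bound _ _ B okb.
  exists (M * N + L * K) => [|u v hu hv]; first by rewrite addr_gt0 ?mulr_gt0.
  apply: le_trans (cmod_subM _ _ _ _) _; rewrite mulrDl -!mulrA lerD//.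
    by rewrite ler_pM ?cmod_ge0 ?hM ?hN.
  by rewrite (mulrC K) mulrA ler_pM ?cmod_ge0 ?hL ?hK.
Qed.

(** The linear part is evaluated at a third point x: in the application x lies on
    a curve, where the derivative can be computed from the equations, while u and
    v are only close to x. *)
Lemma ev_taylor m e (B : R) : vars_in (fun i => (i < m)%N) e -> exists2 L, 0 < L &
  forall x u v, coords_le m B x -> coords_le m B u -> coords_le m B v ->
  cmod (ev u e - ev v e - \sum_(i < m) ev x (der i e) * (u i - v i))
    <= L * (coord_dist m u x + coord_dist m v x) * coord_dist m u v.
Proof.
have T0 (L : R) x u v : 0 <= L -> 0 <= L * (coord_dist m u x + coord_dist m v x) * coord_dist m u v.
  by move=> L0; rewrite !mulr_ge0 ?addr_ge0 ?dst_ge0.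
elim: e => /= [c _|i im|a iha b ihb /andP[/iha[L L0 hL] /ihb[N N0 hN]]|a iha b ihb].
- exists 1 => // x u v _ _ _; rewrite big1 ?subrr ?subr0 ?Normc.normc0.
    exact: T0.
  by move=> i _; rewrite mul0r.
- exists 1 => // x u v _ _ _; rewrite (bigD1 (Ordinal im))//= eqxx mul1r big1.
    by rewrite addr0 subrr Normc.normc0 T0.
  by move=> j /negP ne; case: eqP => [e|_]; rewrite ?mul0r//; case: ne; apply/eqP/val_inj.
- exists (L + N) => [|x u v hx hu hv]; first exact: addr_gt0.
  rewrite (_ : _ - _ = (ev u a - ev v a - \sum_(i < m) ev x (der i a) * (u i - v i)) +
     (ev u b - ev v b - \sum_(i < m) ev x (der i b) * (u i - v i))); last first.
    rewrite (eq_bigr (fun i : 'I_m => ev x (der i a) * (u i - v i) + ev x (der i b) * (u i - v i))).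
      by rewrite big_split /=; ring.
    by move=> i _; ring.
  apply: le_trans (cmodD_le _ _) _; set D := coord_dist m u x + coord_dist m v x.
  have -> : (L + N) * D * coord_dist m u v = L * D * coord_dist m u v + N * D * coord_dist m u v by ring.
  by rewrite lerD ?hL ?hN.
- move=> /andP[oka okb]; have [L L0 hL] := iha oka; have [N N0 hN] := ihb okb.
  have [M M0 hM] := ev_bound _ _ B oka; have [K K0 hK] := ev_bound _ _ B okb.
  have [La La0 hLa] := ev_lip _ _ B oka; have [Lb Lb0 hLb] := ev_lip _ _ B okb.
  exists (M * N + K * L + La * Lb) => [|x u v hx hu hv].
    by rewrite !addr_gt0 ?mulr_gt0.
  set D := coord_dist m u x + coord_dist m v x.
  rewrite (_ : _ - _ = ev x a * (ev u b - ev v b - \sum_(i < m) ev x (der i b) * (u i - v i)) +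
     ev x b * (ev u a - ev v a - \sum_(i < m) ev x (der i a) * (u i - v i)) +
     ((ev u a - ev x a) * (ev u b - ev v b) + (ev v b - ev x b) * (ev u a - ev v a)));
    last first.
    rewrite (eq_bigr (fun i : 'I_m => ev x b * (ev x (der i a) * (u i - v i)) +
       ev x a * (ev x (der i b) * (u i - v i)))).
      by rewrite big_split /= -!mulr_sumr; ring.
    by move=> i _; ring.
  have hA : cmod (ev x a) <= M by exact: hM.
  have hB : cmod (ev x b) <= K by exact: hK.
  have -> : (M * N + K * L + La * Lb) * D * coord_dist m u v =
    M * (N * D * coord_dist m u v) + K * (L * D * coord_dist m u v) +
    La * Lb * D * coord_dist m u v by ring.
  apply: le_trans (cmodD_le _ _) _; apply: lerD.
    apply: le_trans (cmodD_le _ _) _; rewrite !cmodM; apply: lerD.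
      by rewrite ler_pM ?cmod_ge0 ?hN.
    by rewrite ler_pM ?cmod_ge0 ?hL.
  apply: le_trans (cmodD_le _ _) _; rewrite !cmodM /D.
  have h1 := hLa u x hu hx; have h2 := hLb v x hv hx.
  have h3 := hLb u v hu hv; have h4 := hLa u v hu hv.
  have -> : La * Lb * (coord_dist m u x + coord_dist m v x) * coord_dist m u v =
    (La * coord_dist m u x) * (Lb * coord_dist m u v) + (Lb * coord_dist m v x) * (La * coord_dist m u v) by ring.
  by apply: lerD; apply: ler_pM; rewrite ?cmod_ge0.
Qed.

End Expressions.
Arguments pexp : clear implicits.

(** * Differentials on the levels of the tower *)

Section Tower.
Context {R : realType}.
Local Notation C := R[i].
Local Notation pexp := (pexp R).
Local Notation pt := (nat -> C).
Implicit Types (rs : seq pexp) (f g : pt -> C) (u : pt).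

(** Numbering of the variables: 0 is the base coordinate z0, the tower coordinate
    z_j is variable j + 3, and variables 1 and 2 are kept for the second and third
    coordinates of a point of C^3. *)
Definition tower_var k : pred nat := fun i => (i == 0)%N || (2 < i < k + 3)%N.

Lemma tower_var_S k i : tower_var k i -> tower_var k.+1 i.
Proof.
by move=> /orP[h|/andP[h1 h2]]; rewrite /tower_var ?h// h1 (ltn_trans h2) ?orbT// ltn_add2r.
Qed.

Lemma tower_var_lt k i : tower_var k i -> (i < k.+3)%N.
Proof. by move=> /orP[/eqP ->//|/andP[_]]; rewrite addnC. Qed.

Lemma tower_var_var k j : (j < k)%N -> tower_var k j.+3.
Proof. by move=> h; rewrite /tower_var /= addn3 !ltnS h. Qed.

Lemma tower_var_pred k i : tower_var k.+1 i -> i != k.+3 -> tower_var k i.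
Proof.
rewrite /tower_var => /orP[->//|/andP[h1 h2]] ne.
by rewrite h1 /= orbC ltn_neqAle -[(i <= _)%N]ltnS -addSn h2 andbT addn3 ne.
Qed.

Definition regular k f := exists2 e, vars_in (tower_var k) e & forall u, f u = ev u e.

Lemma regular_ev k e : vars_in (tower_var k) e -> regular k (fun u => ev u e).
Proof. by exists e. Qed.

Lemma regular_ex k f g : regular k f -> (forall u, g u = f u) -> regular k g.
Proof. by move=> [e oe he] h; exists e => // u; rewrite h he. Qed.

Lemma regular_cst k c : regular k (fun=> c).
Proof. by exists (Cst c). Qed.

Lemma regular_var k j : (j < k)%N -> regular k (fun u => u j.+3).
Proof. by move=> h; exists (Var j.+3) => //=; exact: tower_var_var. Qed.

Lemma regular_var0 k : regular k (fun u => u 0%N).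
Proof. by exists (Var 0). Qed.

Lemma regular_add k f g : regular k f -> regular k g -> regular k (fun u => f u + g u).
Proof.
move=> [a oa ha] [b ob hb]; exists (Add a b) => [|u] /=; first by rewrite oa ob.
by rewrite ha hb.
Qed.

Lemma regular_mul k f g : regular k f -> regular k g -> regular k (fun u => f u * g u).
Proof.
move=> [a oa ha] [b ob hb]; exists (Mul a b) => [|u] /=; first by rewrite oa ob.
by rewrite ha hb.
Qed.

Lemma regular_opp k f : regular k f -> regular k (fun u => - f u).
Proof.
move=> h; apply: (regular_ex _ _ _ (regular_mul _ _ _ (regular_cst k (-1)) h)) => u.
by rewrite mulN1r.
Qed.

Lemma regular_sub k f g : regular k f -> regular k g -> regular k (fun u => f u - g u).
Proof. by move=> hf hg; apply: regular_add => //; exact: regular_opp. Qed.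

Lemma regular_exp k f n : regular k f -> regular k (fun u => f u ^+ n).
Proof.
move=> hf; elim: n => [|n ih].
  by apply: (regular_ex _ _ _ (regular_cst k 1)) => u; rewrite expr0.
by apply: (regular_ex _ _ _ (regular_mul _ _ _ hf ih)) => u; rewrite exprS.
Qed.

Lemma regular_horner k (p : {poly C}) : regular k (fun u => p.[u 0%N]).
Proof.
elim/poly_ind: p => [|p c ih].
  by apply: (regular_ex _ _ _ (regular_cst _ 0)) => u; rewrite horner0.
apply: (regular_ex _ _ _ (regular_add _ _ _ (regular_mul _ _ _ ih (regular_var0 _)) (regular_cst _ c))) => u.
by rewrite hornerMXaddC.
Qed.

Lemma regular_sum k n (F : nat -> pt -> C) : (forall i, (i < n)%N -> regular k (F i)) ->
  regular k (fun u => \sum_(i < n) F i u).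
Proof.
elim: n => [|n ih] h.
  by apply: (regular_ex _ _ _ (regular_cst k 0)) => u; rewrite big_ord0.
have hn : regular k (fun u => \sum_(i < n) F i u).
  by apply: ih => i hi; apply: h; exact: ltnW.
apply: (regular_ex _ _ _ (regular_add _ _ _ hn (h n (ltnSn n)))) => u.
by rewrite big_ord_recr.
Qed.

Lemma regular_S k f : regular k f -> regular k.+1 f.
Proof. by move=> [e oe he]; exists e => //; apply: vars_in_sub oe => i; exact: tower_var_S. Qed.

Definition curve rs : set pt := [set u | cmod (u 0%N) <= 1 /\
  forall l, (l < size rs)%N -> ev u (nth (Cst 0) rs l) = 0].

Definition vars_in_rels rs := forall l, (l < size rs)%N -> vars_in (tower_var l.+1) (nth (Cst 0) rs l).

(** A family xi stands for the differential sum_j xi_j dz_j relative to the base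
    coordinate, and null_form collects the differentials that vanish because of the
    relations.  So families modulo null_form form the module of Kaehler differentials of
    the curve over its base; it is supported on the ramification. *)
Definition null_form rs (xi : nat -> pt -> C) := exists2 mu : nat -> pt -> C,
  (forall l, regular (size rs) (mu l)) &
  forall u, curve rs u -> forall j, (j < size rs)%N ->
    xi j u = \sum_(l < size rs) mu l u * ev u (der j.+3 (nth (Cst 0) rs l)).

Lemma null_form_ext rs xi zeta : null_form rs xi ->
  (forall u, curve rs u -> forall j, (j < size rs)%N -> zeta j u = xi j u) -> null_form rs zeta.
Proof. by move=> [mu pmu hmu] h; exists mu => // u Yu j hj; rewrite h// hmu. Qed.

Lemma null_form_add rs xi zeta : null_form rs xi -> null_form rs zeta -> null_form rs (fun j u => xi j u + zeta j u).
Proof.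
move=> [mu pmu hmu] [nu pnu hnu]; exists (fun l u => mu l u + nu l u) => [l|u Yu j hj].
  exact: regular_add.
by rewrite hmu// hnu// -big_split; apply: eq_bigr => l _; rewrite mulrDl.
Qed.

Lemma null_form_scale rs xi f : regular (size rs) f -> null_form rs xi -> null_form rs (fun j u => f u * xi j u).
Proof.
move=> pf [mu pmu hmu]; exists (fun l u => f u * mu l u) => [l|u Yu j hj].
  exact: regular_mul.
by rewrite hmu// mulr_sumr; apply: eq_bigr => l _; rewrite mulrA.
Qed.

Lemma null_form0 rs : null_form rs (fun _ _ => 0).
Proof.
exists (fun _ _ => 0) => [l|u Yu j hj]; first exact: regular_cst.
by rewrite big1// => i _; rewrite mul0r.
Qed.

Lemma null_form_sum rs n (xi : nat -> nat -> pt -> C) : (forall i, (i < n)%N -> null_form rs (xi i)) ->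
  null_form rs (fun j u => \sum_(i < n) xi i j u).
Proof.
elim: n => [|n ih] h.
  by apply: null_form_ext (null_form0 rs) _ => u _ j _; rewrite big_ord0.
have hn : null_form rs (fun j u => \sum_(i < n) xi i j u).
  by apply: ih => i hi; apply: h; exact: ltnW.
apply: null_form_ext (null_form_add _ _ _ hn (h n (ltnSn n))) _ => u _ j _.
by rewrite big_ord_recr.
Qed.

Lemma null_form_rel rs l : (l < size rs)%N ->
  null_form rs (fun j u => ev u (der j.+3 (nth (Cst 0) rs l))).
Proof.
move=> hl; exists (fun i _ => (i == l)%:R) => [i|u Yu j hj]; first exact: regular_cst.
rewrite (bigD1 (Ordinal hl))//= eqxx mul1r big1 ?addr0// => i /negP ne.
by case: eqP => [e|_]; rewrite ?mul0r//; case: ne; apply/eqP/val_inj.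
Qed.

Definition dgen w v (th : C) j u : C := ev u (der j.+3 v) - th * ev u (der j.+3 w).

(** The module of differentials is cyclic, with generator d(v - th w).  This is an
    algebraic way to say that (z0, w, v) immerses the curve and that no tangent is
    parallel to (0, 1, th). *)
Definition cyclicD rs w v th := forall i, (i < size rs)%N ->
  exists2 kap, regular (size rs) kap &
    null_form rs (fun j u => (j == i)%:R - kap u * dgen w v th j u).

(** D kills the differentials, hence its zeros contain the ramification. *)
Definition annD rs D := forall i, (i < size rs)%N ->
  null_form rs (fun j u => (j == i)%:R * ev u D).

Definition unitmod rs D f := exists x y, [/\ regular (size rs) x, regular (size rs) y &
  forall u, curve rs u -> x u * f u + y u * ev u D = 1].

Lemma sum_delta n (F : nat -> C) j : (j < n)%N ->
  \sum_(i < n) F i * (j == i)%:R = F j.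
Proof.
move=> hj; rewrite (bigD1 (Ordinal hj))//= eqxx mulr1 big1 ?addr0// => i /negP ne.
by case: eqP => [e|_]; rewrite ?mulr0//; case: ne; apply/eqP/val_inj.
Qed.

Lemma cyclicD_diff rs w v th e : cyclicD rs w v th -> vars_in (tower_var (size rs)) e ->
  exists2 kap, regular (size rs) kap &
    null_form rs (fun j u => ev u (der j.+3 e) - kap u * dgen w v th j u).
Proof.
move=> hK oe; have pd i : regular (size rs) (fun u => ev u (der i.+3 e)).
  by apply: regular_ev; exact: vars_in_der.
have /choice[kap hkap] : forall i, exists kap, (i < size rs)%N -> regular (size rs) kap /\
    null_form rs (fun j u => (j == i)%:R - kap u * dgen w v th j u).
  move=> i; have [hi|_] := boolP (i < size rs)%N; last by exists (fun=> 0).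
  by have [kap p1 p2] := hK _ hi; exists kap.
exists (fun u => \sum_(i < size rs) ev u (der i.+3 e) * kap i u).
  by apply: (regular_sum _ _ (fun i u => ev u (der i.+3 e) * kap i u)) => i /hkap[p _]; exact: regular_mul.
have : null_form rs (fun j u => \sum_(i < size rs) ev u (der i.+3 e) *
    ((j == i)%:R - kap i u * dgen w v th j u)).
  apply: (null_form_sum _ _ (fun i j u => ev u (der i.+3 e) *
    ((j == i)%:R - kap i u * dgen w v th j u))) => i /hkap[_ p].
  exact: null_form_scale.
move=> hI; apply: (null_form_ext _ _ _ hI) => u Yu j hj.
rewrite mulr_suml -(sum_delta _ (fun i => ev u (der i.+3 e)) _ hj) -sumrB.
by apply: eq_bigr => i _; ring.
Qed.

Lemma annD_diff rs D (xi : nat -> pt -> C) : annD rs D ->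
  (forall j, regular (size rs) (xi j)) -> null_form rs (fun j u => ev u D * xi j u).
Proof.
move=> hD px.
have : null_form rs (fun j u => \sum_(i < size rs) xi i u * ((j == i)%:R * ev u D)).
  apply: (null_form_sum _ _ (fun i j u => xi i u * ((j == i)%:R * ev u D))) => i /hD p.
  exact: null_form_scale.
move=> hI; apply: (null_form_ext _ _ _ hI) => u Yu j hj.
rewrite -(sum_delta _ (fun i => xi i u) _ hj) mulr_sumr.
by apply: eq_bigr => i _; ring.
Qed.

Section Extension.
Context (rs : seq pexp) (w v D q : pexp) (th c : C).
Context (ors : vars_in_rels rs) (ow : vars_in (tower_var (size rs)) w) (ov : vars_in (tower_var (size rs)) v)
        (oD : vars_in (tower_var (size rs)) D) (oq : vars_in (tower_var (size rs)) q).
Local Notation k := (size rs).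

Definition newR : pexp := Add (Mul (Var k.+3) (Var k.+3)) (Mul (Cst (-1)) q).
Definition newrs := rcons rs newR.
Definition neww : pexp := Add w (Mul (Cst c) (Var k.+3)).
Definition newv : pexp := Add v (Mul (Cst (c * th)) (Var k.+3)).
Definition newD : pexp := Mul (Mul (Cst 2) (Var k.+3)) D.

Lemma size_newrs : size newrs = k.+1.
Proof. by rewrite size_rcons. Qed.

Lemma nth_newrs l : (l < k)%N -> nth (Cst 0) newrs l = nth (Cst 0) rs l.
Proof. by move=> h; rewrite nth_rcons h. Qed.

Lemma nth_newrs_last : nth (Cst 0) newrs k = newR.
Proof. by rewrite nth_rcons ltnn eqxx. Qed.

Lemma tower_var_fresh : ~~ tower_var k k.+3.
Proof. by rewrite /tower_var /= addn3 ltnn. Qed.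

Lemma curve_newrs u : curve newrs u <-> curve rs u /\ u k.+3 ^+ 2 = ev u q.
Proof.
split=> [[u0 h]|[[u0 h] hq]].
  split.
    split=> // l hl; rewrite -nth_newrs//; apply: h.
    by rewrite size_newrs ltnS ltnW.
  have := h k; rewrite size_newrs ltnSn nth_newrs_last => /(_ isT) /=.
  by rewrite mulN1r expr2 => /eqP; rewrite subr_eq0 => /eqP.
split=> // l; rewrite size_newrs ltnS leq_eqVlt => /orP[/eqP ->|hl].
  by rewrite nth_newrs_last /= mulN1r -expr2 hq subrr.
by rewrite nth_newrs// h.
Qed.

Lemma vars_in_newrs : vars_in_rels newrs.
Proof.
move=> l; rewrite size_newrs ltnS leq_eqVlt => /orP[/eqP ->|hl].
  rewrite nth_newrs_last /= tower_var_var//=.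
  by apply: vars_in_sub oq => i; exact: tower_var_S.
by rewrite nth_newrs// ors.
Qed.

Lemma vars_in_neww : vars_in (tower_var k.+1) neww.
Proof. by rewrite /= tower_var_var// andbT; apply: vars_in_sub ow => i; exact: tower_var_S. Qed.

Lemma vars_in_newv : vars_in (tower_var k.+1) newv.
Proof. by rewrite /= tower_var_var// andbT; apply: vars_in_sub ov => i; exact: tower_var_S. Qed.

Lemma vars_in_newD : vars_in (tower_var k.+1) newD.
Proof. by rewrite /= tower_var_var//=; apply: vars_in_sub oD => i; exact: tower_var_S. Qed.

Lemma vars_in_nth_rs l : (l < k)%N -> vars_in (tower_var k) (nth (Cst 0) rs l).
Proof.
move=> h; apply: vars_in_sub (ors _ h) => i /orP[hi|/andP[h1 h2]]; rewrite /tower_var ?hi//.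
by rewrite h1 orbC /= (leq_trans h2)// leq_add2r.
Qed.

Lemma der_fresh e u : vars_in (tower_var k) e -> ev u (der k.+3 e) = 0.
Proof. by move=> oe; apply: ev_der_notin oe _; exact: tower_var_fresh. Qed.

Lemma null_form_widen xi : null_form rs xi -> (forall u, curve newrs u -> xi k u = 0) -> null_form newrs xi.
Proof.
move=> [mu pmu hmu] h0; exists (fun l u => (l < k)%:R * mu l u).
  move=> l; rewrite size_newrs; apply: regular_mul; first exact: regular_cst.
  by apply: regular_S; exact: pmu.
move=> u Yu j; rewrite size_newrs big_ord_recr /= ltnn !mul0r addr0.
rewrite (eq_bigr (fun l : 'I_k => mu l u * ev u (der j.+3 (nth (Cst 0) rs l)))); last first.
  by move=> l _; rewrite ltn_ord mul1r nth_newrs.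
rewrite ltnS leq_eqVlt => /orP[/eqP ->|hj].
  rewrite h0// big1// => l _; rewrite der_fresh ?mulr0//.
  exact: vars_in_nth_rs.
by rewrite hmu//; exact: ((curve_newrs u).1 Yu).1.
Qed.

(** From 2 s ds = dq and D dq = 0 one gets 2 s D ds = 0. *)
Lemma annD_step : annD rs D -> annD newrs newD.
Proof.
move=> hD.
have pX : regular (size newrs) (fun u => 2 * u k.+3).
  rewrite size_newrs; apply: regular_mul; first exact: regular_cst.
  exact: regular_var.
have oldI i : (i < k)%N -> null_form newrs (fun j u => (j == i)%:R * ev u D).
  move=> hi; apply: null_form_widen; first exact: hD.
  by move=> u _; rewrite (gtn_eqF hi) mul0r.
move=> i; rewrite size_newrs ltnS leq_eqVlt => /orP[/eqP ->|hi]; last first.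
  apply: null_form_ext (null_form_scale _ _ _ pX (oldI _ hi)) _ => u _ j _ /=; ring.
have pD : regular (size newrs) (fun u => ev u D).
  by rewrite size_newrs; apply: regular_S; exact: regular_ev.
have hr : null_form newrs (fun j u => ev u D * ev u (der j.+3 (nth (Cst 0) newrs k))).
  by apply: null_form_scale => //; apply: null_form_rel; rewrite size_newrs.
have hq : null_form newrs (fun j u => ev u D * ev u (der j.+3 q)).
  apply: null_form_widen; last by move=> u _; rewrite der_fresh ?mulr0.
  by apply: (annD_diff _ _ (fun j u => ev u (der j.+3 q))) => // j; apply: regular_ev; exact: vars_in_der.
apply: null_form_ext (null_form_add _ _ _ hr hq) _ => u _ j _.
rewrite nth_newrs_last /= (eq_sym k.+3) eqSS; ring.
Qed.

(** Let eta and eta' be the old and the new generator, dw = om eta, dq = kap eta.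
    Then eta' = eta + tau dw + c tau ds and 2 s ds = dq give 2 s eta' = E eta with
    E = 2 s (1 + tau om) + c tau kap.  If E is invertible modulo the annihilator D
    of eta, then eta, and with it ds, is a multiple of eta'. *)
Lemma cyclicD_step (tau : C) om kap sg t : c != 0 -> tau != 0 ->
  cyclicD rs w v th -> annD rs D ->
  regular k om -> null_form rs (fun j u => ev u (der j.+3 w) - om u * dgen w v th j u) ->
  regular k kap -> null_form rs (fun j u => ev u (der j.+3 q) - kap u * dgen w v th j u) ->
  regular k.+1 sg -> regular k.+1 t ->
  (forall u, curve newrs u -> sg u * (2 * u k.+3 * (1 + tau * om u) + c * tau * kap u) +
                          t u * ev u D = 1) ->
  cyclicD newrs neww newv (th - tau).
Proof.
move=> c0 tau0 hK hD pom hom pkap hkap psg pt' hb.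
have k1 := size_newrs.
have eta_k u : dgen w v th k u = 0 by rewrite /dgen !der_fresh// mulr0 subrr.
pose e' := dgen neww newv (th - tau).
have eta'E j u : e' j u = dgen w v th j u + tau * ev u (der j.+3 w) +
    c * tau * (j == k)%:R.
  by rewrite /e' /dgen /= (eq_sym k.+3) eqSS; ring.
have hom' : null_form newrs (fun j u => ev u (der j.+3 w) - om u * dgen w v th j u).
  by apply: null_form_widen => // u _; rewrite eta_k der_fresh// mulr0 subrr.
have hkap' : null_form newrs (fun j u => ev u (der j.+3 q) - kap u * dgen w v th j u).
  by apply: null_form_widen => // u _; rewrite eta_k der_fresh// mulr0 subrr.
have hr : null_form newrs (fun j u => 2 * u k.+3 * (j == k)%:R - ev u (der j.+3 q)).
  apply: null_form_ext (null_form_rel newrs k _) _ => [|u _ j _]; first by rewrite k1.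
  by rewrite nth_newrs_last /= (eq_sym k.+3) eqSS; ring.
have hDe : null_form newrs (fun j u => ev u D * dgen w v th j u).
  apply: null_form_widen => [|u _]; last by rewrite eta_k mulr0.
  apply: (annD_diff _ _ (dgen w v th)) => // j.
  apply: regular_sub; first by apply: regular_ev; exact: vars_in_der.
  by apply: regular_mul; [exact: regular_cst|apply: regular_ev; exact: vars_in_der].
have ps : regular k.+1 (fun u => u k.+3) by exact: regular_var.
have pom' := regular_S _ _ pom; have pkap' := regular_S _ _ pkap.
have pc a : regular k.+1 (fun=> a) := regular_cst k.+1 a.
have I1 : null_form newrs (fun j u => dgen w v th j u - 2 * u k.+3 * sg u * e' j u).
  have p1 : regular (size newrs) (fun u => - sg u * (2 * u k.+3 * tau)).
    rewrite k1; apply: regular_mul; first exact: regular_opp.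
    by apply: regular_mul => //; apply: regular_mul.
  have p2 : regular (size newrs) (fun u => - sg u * (c * tau)).
    by rewrite k1; apply: regular_mul => //; exact: regular_opp.
  have p3 : regular (size newrs) t by rewrite k1.
  apply: null_form_ext (null_form_add _ _ _ (null_form_scale _ _ _ p1 hom') (null_form_add _ _ _
    (null_form_scale _ _ _ p2 (null_form_add _ _ _ hr hkap')) (null_form_scale _ _ _ p3 hDe))) _.
  move=> u Yu j _; apply/eqP; rewrite -subr_eq0; apply/eqP.
  transitivity ((1 - (sg u * (2 * u k.+3 * (1 + tau * om u) + c * tau * kap u) +
    t u * ev u D)) * dgen w v th j u); first by rewrite eta'E; ring.
  by rewrite hb// subrr mul0r.
move=> i; rewrite k1 ltnS leq_eqVlt => /orP[/eqP ->|hi]; last first.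
  have [ki pki hki] := hK _ hi.
  exists (fun u => ki u * (2 * u k.+3 * sg u)).
    by apply: regular_mul; [exact: regular_S|apply: regular_mul => //; apply: regular_mul].
  have hki' : null_form newrs (fun j u => (j == i)%:R - ki u * dgen w v th j u).
    by apply: null_form_widen => // u _; rewrite eta_k mulr0 (gtn_eqF hi) subrr.
  have pki' : regular (size newrs) ki by rewrite k1; exact: regular_S.
  apply: null_form_ext (null_form_add _ _ _ hki' (null_form_scale _ _ _ pki' I1)) _ => u _ j _.
  by rewrite -/e'; ring.
exists (fun u => (1 - (1 + tau * om u) * (2 * u k.+3 * sg u)) * (c * tau)^-1).
  apply: regular_mul => //; apply: regular_sub => //; apply: regular_mul.
    by apply: regular_add => //; exact: regular_mul.
  by apply: regular_mul => //; apply: regular_mul.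
have p1 : regular (size newrs) (fun u => - (1 + tau * om u) * (c * tau)^-1).
  rewrite k1; apply: regular_mul => //; apply: regular_opp; apply: regular_add => //.
  exact: regular_mul.
have p2 : regular (size newrs) (fun=> - tau * (c * tau)^-1) by exact: regular_cst.
apply: null_form_ext (null_form_add _ _ _ (null_form_scale _ _ _ p1 I1) (null_form_scale _ _ _ p2 hom')) _.
move=> u Yu j _; rewrite -/e'.
have -> : (j == k)%:R = (c * tau)^-1 * (e' j u - dgen w v th j u - tau * ev u (der j.+3 w)).
  rewrite eta'E; field; by rewrite c0 tau0.
ring.
Qed.

End Extension.
End Tower.

(** * Generic constants *)

Section Generic.
Context {R : realType}.
Local Notation C := R[i].
Local Notation pexp := (pexp R).
Local Notation pt := (nat -> C).
Implicit Types (rs : seq pexp) (f g : pt -> C) (u : pt).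

Definition at0 N (M : 'M[{poly C}]_N) u := map_mx (horner_eval (u 0%N)) M.

(** The polynomial functions on a level form a finite module over C[z0].  In
    matrix form this makes determinants play the role of norms to C[z0]. *)
Definition finrep rs := exists N (b : pt -> 'cV[C]_N) (i0 : 'I_N),
  [/\ forall i, regular (size rs) (fun u => b u i 0),
      forall u, curve rs u -> b u i0 0 = 1 &
      forall f, regular (size rs) f -> exists M : 'M[{poly C}]_N,
        forall u, curve rs u -> f u *: b u = at0 N M u *m b u].

Definition finD rs g := exists2 D : {poly C}, D != 0 &
  exists2 h, regular (size rs) h & forall u, curve rs u -> D.[u 0%N] = g u * h u.

Lemma at0D N (M M' : 'M[{poly C}]_N) u : at0 N (M + M') u = at0 N M u + at0 N M' u.
Proof. by rewrite /at0 raddfD. Qed.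

Lemma at0M N (M M' : 'M[{poly C}]_N) u : at0 N (M *m M') u = at0 N M u *m at0 N M' u.
Proof. by rewrite /at0 map_mxM. Qed.

Lemma at0_scalar N (p : {poly C}) u : at0 N p%:M u = (p.[u 0%N])%:M.
Proof. by rewrite /at0 map_scalar_mx. Qed.

(** Matrices add and multiply with the functions that they represent, so only the
    variables need a matrix. *)
Lemma rep_ex N rs (b : pt -> 'cV[C]_N) (P : pred nat) :
  (forall i, P i -> exists M : 'M[{poly C}]_N,
     forall u, curve rs u -> u i *: b u = at0 N M u *m b u) ->
  forall e, vars_in P e -> exists M : 'M[{poly C}]_N,
     forall u, curve rs u -> ev u e *: b u = at0 N M u *m b u.
Proof.
move=> hv; elim => [c _|i /hv//|a iha a' ihb /= /andP[/iha[M hM] /ihb[M' hM']]|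
   a iha a' ihb /= /andP[/iha[M hM] /ihb[M' hM']]].
- by exists (c%:P)%:M => u _; rewrite at0_scalar hornerC mul_scalar_mx.
- exists (M + M') => u Yu.
  by rewrite at0D mulmxDl -hM// -hM'// -scalerDl.
- exists (M *m M') => u Yu.
  by rewrite at0M -mulmxA -hM'// -scalemxAr -hM// scalerA mulrC.
Qed.

Lemma finrep0 : finrep [::].
Proof.
exists 1%N, (fun=> 1%:M), ord0; split => [i|u _|f [e oe he]].
- apply: (regular_ex _ _ _ (regular_cst 0 (i == 0)%:R)) => u.
  by rewrite mxE.
- by rewrite mxE.
have [|M hM] := rep_ex 1 [::] (fun=> 1%:M) (tower_var 0) _ e oe.
  case=> [_|[|[|i]]] //.
  by exists ('X)%:M => u _; rewrite at0_scalar hornerX mul_scalar_mx.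
by exists M => u Yu; rewrite he hM.
Qed.

(** If b spans the old level then b and s b span the new one, and s acts by the
    companion matrix of s^2 = q. *)
Lemma finrep_step rs (q : pexp) : finrep rs -> vars_in (tower_var (size rs)) q ->
  finrep (newrs rs q).
Proof.
move=> [N [b [i0 [pb b1 hM]]]] oq; set k := size rs.
have k1 := size_newrs rs q.
pose b' u : 'cV[C]_(N + N) := col_mx (b u) (u k.+3 *: b u).
exists (N + N)%N, b', (lshift N i0); split.
- move=> i; rewrite k1.
  have ps : regular k.+1 (fun u => u k.+3) by exact: regular_var.
  case: (splitP i) => j ij.
    rewrite (_ : i = lshift N j); last exact: val_inj.
    by apply: (regular_ex _ _ _ (regular_S _ _ (pb j))) => u; rewrite /b' col_mxEu.
  rewrite (_ : i = rshift N j); last exact: val_inj.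
  apply: (regular_ex _ _ _ (regular_mul _ _ _ ps (regular_S _ _ (pb j)))) => u.
  by rewrite /b' col_mxEd mxE.
- by move=> u Yu; rewrite /b' col_mxEu b1//; exact: ((curve_newrs rs q u).1 Yu).1.
move=> f; rewrite k1 => -[e oe he].
suff [M hM'] : exists M : 'M[{poly C}]_(N + N), forall u, curve (newrs rs q) u ->
    ev u e *: b' u = at0 _ M u *m b' u.
  by exists M => u Yu; rewrite he hM'.
have old g : regular k g -> exists M : 'M[{poly C}]_(N + N), forall u, curve (newrs rs q) u ->
    g u *: b' u = at0 _ M u *m b' u.
  move=> /hM[M h]; exists (block_mx M 0 0 M) => u Yu.
  have Yu' := ((curve_newrs rs q u).1 Yu).1.
  rewrite /at0 /b' map_block_mx mul_block_col !raddf0 !mul0mx addr0 add0r.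
  rewrite -[map_mx _ M]/(at0 N M u) -scalemxAr -h// scale_col_mx.
  by rewrite !scalerA mulrC.
apply: rep_ex oe => i.
case: (eqVneq i k.+3) => [-> _|ne hi]; last first.
  apply: old; apply: (regular_ev k (Var i)); exact: tower_var_pred.
have [Mq hq] := hM _ (regular_ev _ _ oq).
exists (block_mx 0 1%:M Mq 0) => u Yu.
have [Yu' s2] := (curve_newrs rs q u).1 Yu.
rewrite /at0 /b' map_block_mx mul_block_col !raddf0 !mul0mx addr0 add0r.
rewrite map_scalar_mx /= /horner_eval hornerC mul1mx.
rewrite -[map_mx _ Mq]/(at0 N Mq u) -hq// scale_col_mx scalerA -expr2.
by rewrite s2.
Qed.

Lemma horner_char_poly N (A : 'M[C]_N) a : (char_poly A).[a] = \det (a%:M - A).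
Proof.
rewrite -[_.[a]]/(horner_eval a _) -det_map_mx; congr (\det _).
apply/matrixP => i j.
by rewrite !mxE /= /horner_eval hornerD hornerN hornerC hornerMn hornerX.
Qed.

(** F lam is the determinant of the matrix of f + lam: by Cramer's rule it is a
    multiple of f + lam, and at a fixed base point it is a characteristic
    polynomial in lam, hence nonzero for all but finitely many lam. *)
Lemma det_multiple rs : finrep rs -> forall f, regular (size rs) f ->
  exists F : C -> {poly C},
    (forall z, exists2 p : {poly C}, p != 0 & forall lam, (F lam).[z] = p.[lam]) /\
    forall lam, exists2 h, regular (size rs) h &
      forall u, curve rs u -> (F lam).[u 0%N] = (f u + lam) * h u.
Proof.
move=> [N [b [i0 [pb b1 hM]]]] f pf; have [M hf] := hM f pf.
exists (fun lam => \det (M + (lam%:P)%:M)); split.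
  move=> z; pose A := - map_mx (horner_eval z) M.
  exists (char_poly A); first exact: (monic_neq0 (char_poly_monic A)).
  move=> lam; rewrite horner_char_poly /A opprK.
  rewrite -[_.[z]]/(horner_eval z _) -det_map_mx raddfD /= map_scalar_mx /=.
  by rewrite /horner_eval hornerC addrC.
move=> lam; set M' := M + _.
exists (fun u => \sum_(j < N) (\adj M' i0 j).[u 0%N] * b u j 0).
  have hF (j : 'I_N) : regular (size rs) (fun u => (\adj M' i0 j).[u 0%N] * b u j 0).
    by apply: regular_mul => //; exact: regular_horner.
  elim: (index_enum 'I_N) => [|j s ih].
    by apply: (regular_ex _ _ _ (regular_cst _ 0)) => u; rewrite big_nil.
  by apply: (regular_ex _ _ _ (regular_add _ _ _ (hF j) ih)) => u; rewrite big_cons.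
move=> u Yu.
have e1 : (f u + lam) *: b u = at0 N M' u *m b u.
  by rewrite at0D at0_scalar hornerC mulmxDl -hf// mul_scalar_mx scalerDl.
have : at0 N (\adj M' *m M') u *m b u = ((\det M').[u 0%N]) *: b u.
  by rewrite mul_adj_mx at0_scalar mul_scalar_mx.
rewrite at0M -mulmxA -e1 -scalemxAr => /(congr1 (fun A : 'cV_N => A i0 0)).
rewrite !mxE b1// mulr1 => <-; congr (_ * _).
by apply: eq_bigr => j _; rewrite mxE.
Qed.

Lemma generic_fin rs f : finrep rs -> regular (size rs) f ->
  exists2 p : {poly C}, p != 0 & forall lam, p.[lam] != 0 ->
    finD rs (fun u => f u + lam).
Proof.
move=> hr /(det_multiple _ hr)[F [hF hm]]; have [p p0 hp] := hF 0.
exists p => // lam; rewrite -hp => h.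
exists (F lam); first by apply: contraNneq h => ->; rewrite horner0.
exact: hm.
Qed.

(** The determinant of the matrix of f + lam and a multiple of D in C[z0] have
    no common root for generic lam, so a Bezout relation exists in C[z0]. *)
Lemma generic_unit rs (D : pexp) f : finrep rs -> finD rs (fun u => ev u D) ->
  regular (size rs) f -> exists2 p : {poly C}, p != 0 &
    forall lam, p.[lam] != 0 -> unitmod rs D (fun u => f u + lam).
Proof.
move=> hr [d d0 [g pg hg]] /(det_multiple _ hr)[F [hF hm]].
have [s ds] := closed_field_poly_normal d.
have /choice[P hP] : forall z, exists p : {poly C}, p != 0 /\
    forall lam, (F lam).[z] = p.[lam] by move=> z; have [p] := hF z; exists p.
exists (\prod_(z <- s) P z) => [|lam].
  elim: (s) => [|z t ih]; first by rewrite big_nil oner_eq0.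
  by rewrite big_cons mulf_neq0// (hP z).1.
move=> hlam; have [h ph hh] := hm lam.
have cop : coprimep (F lam) d.
  rewrite ds coprimepZr ?lead_coef_eq0//.
  elim: (s) hlam => [|z t ih]; first by rewrite !big_nil coprimep1.
  rewrite !big_cons hornerM mulf_eq0 negb_or => /andP[h1 /ih h2].
  by rewrite coprimepMr h2 andbT coprimep_XsubC /root (hP z).2.
have /Bezout_coprimepP[[x y] /= hxy] := cop.
have [c c0 hc] : exists2 c : C, c != 0 & x * F lam + y * d = c%:P.
  move: hxy; rewrite -size_poly_eq1 => /size_poly1P[c c0 e]; by exists c.
exists (fun u => c^-1 * (x.[u 0%N] * h u)), (fun u => c^-1 * (y.[u 0%N] * g u)); split.
- by apply: regular_mul; [exact: regular_cst|apply: regular_mul => //; exact: regular_horner].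
- by apply: regular_mul; [exact: regular_cst|apply: regular_mul => //; exact: regular_horner].
move=> u Yu; have := congr1 (fun p : {poly C} => p.[u 0%N]) hc.
rewrite /= hornerD !hornerM hornerC hh// hg// => e.
apply: (mulfI c0); rewrite mulr1 -[RHS]e; field; exact: c0.
Qed.

(** A sequence tending to 0 or to infinity makes the generic constant small or large. *)
Lemma nonroot_seq (p : {poly C}) (a : nat -> C) n0 : injective a -> p != 0 ->
  exists2 n, (n0 <= n)%N & p.[a n] != 0.
Proof.
move=> inj p0; apply: contrapT => hn.
pose s := [seq a i | i <- iota n0 (size p)].
have us : uniq s by rewrite map_inj_uniq// iota_uniq.
have rt : all (root p) s.
  rewrite all_map; apply/allP => i; rewrite mem_iota => /andP[hi _] /=.
  by apply: contrapT => /negP h; apply: hn; exists i.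
have := max_poly_roots p0 rt us.
by rewrite size_map size_iota ltnn.
Qed.

End Generic.

(** * Recovering the tower coordinates from three functions *)

Section Decode.
Context {R : realType}.
Local Notation C := R[i].
Local Notation pexp := (pexp R).
Local Notation pt := (nat -> C).
Implicit Types (rs : seq pexp) (u : pt).

Definition triple (a b c : C) : pt := fun i =>
  match i with 0 => a | 1 => b | _ => c end%N.

Definition space_var : pred nat := fun i => (i < 3)%N.

Definition near_curve w v u (r : R) (p1 p2 : C) :=
  cmod (p1 - ev u w) <= r /\ cmod (p2 - ev u v) <= r.

Definition dist2 (p1 p2 q1 q2 : C) : R := cmod (p1 - q1) + cmod (p2 - q2).

Lemma dist2_ge0 p1 p2 q1 q2 : 0 <= dist2 p1 p2 q1 q2.
Proof. by rewrite addr_ge0 ?cmod_ge0. Qed.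

(** To survive a small change of w and v, the approximation of the z_j by
    polynomials in (z0, w, v) has to hold with a Lipschitz constant K and on a tube
    of radius r that do not depend on the precision e. *)
Definition decodable rs w v := exists K r : R, [/\ 0 < K, 0 < r &
  forall e : R, 0 < e -> exists Z : nat -> pexp, (forall j, vars_in space_var (Z j)) /\
    forall u, curve rs u ->
      (forall j, (j < size rs)%N ->
         cmod (ev (triple (u 0%N) (ev u w) (ev u v)) (Z j) - u j.+3) <= e) /\
      (forall p1 p2 q1 q2, near_curve w v u r p1 p2 -> near_curve w v u r q1 q2 ->
         forall j, (j < size rs)%N ->
         cmod (ev (triple (u 0%N) p1 p2) (Z j) - ev (triple (u 0%N) q1 q2) (Z j))
           <= K * dist2 p1 p2 q1 q2)].

Definition bounded_curve rs := exists B : R, forall u, curve rs u ->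
  forall i, tower_var (size rs) i -> cmod (u i) <= B.

(** A quantitative form of transversality to the direction (0, 1, th): the
    functions G are approximate equations of the curve with slope close to 1 in
    this direction, on a tube that does not depend on the precision e. *)
Definition transversal rs w v th := exists r L : R, [/\ 0 < r, 0 < L &
  forall e : R, 0 < e -> exists2 G : pexp, vars_in space_var G & forall u, curve rs u ->
    [/\ cmod (ev (triple (u 0%N) (ev u w) (ev u v)) G) <= e,
     forall p1 p2 q1 q2, near_curve w v u r p1 p2 -> near_curve w v u r q1 q2 ->
       cmod (ev (triple (u 0%N) p1 p2) G - ev (triple (u 0%N) q1 q2) G) <=
       L * dist2 p1 p2 q1 q2 &
     forall p1 p2 q1 q2 zeta, near_curve w v u r p1 p2 -> near_curve w v u r q1 q2 ->
       p1 - q1 = zeta -> p2 - q2 = zeta * th ->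
       cmod (ev (triple (u 0%N) p1 p2) G - ev (triple (u 0%N) q1 q2) G - zeta) <=
       cmod zeta / 2]].

Lemma sum3 k (V : nmodType) (F : nat -> V) :
  \sum_(i < k.+3) F i = F 0%N + (F 1%N + (F 2%N + \sum_(j < k) F j.+3)).
Proof. by rewrite !big_ord_recl. Qed.

Lemma cmodN (z : C) : cmod (- z) = cmod z.
Proof. by rewrite -[- z]sub0r cmod_distC subr0. Qed.

Lemma cmod_real (r : R) : 0 <= r -> cmod (r%:C : C) = r.
Proof. by move=> r0; apply: (@complexI R); rewrite -cmodE ger0_norm// ler0c. Qed.

Lemma cmod_nat n : cmod (n%:R : C) = n%:R.
Proof. by rewrite -(rmorph_nat (real_complex R)) cmod_real. Qed.

Lemma cmod_near (a b : C) (r : R) : cmod (a - b) <= r -> cmod a <= cmod b + r.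
Proof.
move=> h; have := cmodD_le (a - b) b; rewrite subrK; lra.
Qed.

Definition sume (s : seq pexp) : pexp := foldr Add (Cst 0) s.

Lemma ev_sume u s : ev u (sume s) = \sum_(e <- s) ev u e.
Proof. by elim: s => [|e s ih] /=; rewrite ?big_nil// big_cons ih. Qed.

Lemma vars_in_sume P (s : seq pexp) : all (vars_in P) s -> vars_in P (sume s).
Proof. by elim: s => //= e s ih /andP[-> /ih ->]. Qed.

Lemma ev_der_sume u i s : ev u (der i (sume s)) = \sum_(e <- s) ev u (der i e).
Proof. by elim: s => [|e s ih] /=; rewrite ?big_nil// big_cons ih. Qed.

Section Normal.
Context (rs : seq pexp) (w v om : pexp) (mu : nat -> pexp) (th : C).
Context (ors : vars_in_rels rs) (ow : vars_in (tower_var (size rs)) w) (ov : vars_in (tower_var (size rs)) v)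
  (oom : vars_in (tower_var (size rs)) om) (omu : forall l, vars_in (tower_var (size rs)) (mu l)).
Local Notation k := (size rs).
Local Notation rel l := (nth (Cst 0) rs l).

(** With dw = om d(v - th w) + sum_l mu_l dR_l, the differential of
    (1 + th om)(p1 - w) - om (p2 - v) + sum_l mu_l R_l along the curve has no
    component in the dz_j, and its components in dp1, dp2 pair with (1, th) to 1.
    So Phi does not feel first-order errors in the z_j. *)
Definition Phi : pexp :=
  Add (Add (Mul (Add (Cst 1) (Mul (Cst th) om)) (Add (Var 1) (Mul (Cst (-1)) w)))
           (Mul (Mul (Cst (-1)) om) (Add (Var 2) (Mul (Cst (-1)) v))))
      (sume [seq Mul (mu l) (rel l) | l <- iota 0 k]).

Lemma tower_var_lt3 (e : pexp) : vars_in (tower_var k) e -> vars_in (fun i => (i < k.+3)%N) e.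
Proof. by apply: vars_in_sub => i; exact: tower_var_lt. Qed.

Lemma vars_in_Phi : vars_in (R:=R) (fun i => (i < k.+3)%N) Phi.
Proof.
rewrite /= !tower_var_lt3//= vars_in_sume// all_map; apply/allP => l.
rewrite mem_iota add0n => hl /=; rewrite omu; exact: vars_in_nth_rs.
Qed.

Definition lift_pt u : pt := fun i =>
  match i with 0 => u 0 | 1 => ev u w | 2 => ev u v | j => u j end%N.

Lemma ev_lift_pt u (e : pexp) : vars_in (tower_var k) e -> ev (lift_pt u) e = ev u e.
Proof. by move=> oe; apply: ev_ext oe _ => -[|[|[|i]]]. Qed.

Lemma ev_Phi_sum x : ev x Phi = (1 + th * ev x om) * (x 1%N - ev x w)
  - ev x om * (x 2%N - ev x v) + \sum_(l < k) ev x (mu l) * ev x (rel l).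
Proof.
rewrite /= ev_sume big_map -(big_mkord xpredT (fun l => ev x (mu l) * ev x (rel l))).
by rewrite /index_iota subn0; ring.
Qed.

Lemma der_Phi x i : ev x (der i Phi) =
  th * ev x (der i om) * (x 1%N - ev x w) +
  (1 + th * ev x om) * ((1%N == i)%:R - ev x (der i w))
  - ev x (der i om) * (x 2%N - ev x v) - ev x om * ((2%N == i)%:R - ev x (der i v))
  + \sum_(l < k) (ev x (der i (mu l)) * ev x (rel l) + ev x (mu l) * ev x (der i (rel l))).
Proof.
rewrite [Phi]lock /= -lock /Phi [der i (Add _ _)]/=.
cbn [ev]; rewrite ev_der_sume big_map.
rewrite -(big_mkord xpredT (fun l => ev x (der i (mu l)) * ev x (rel l) +
  ev x (mu l) * ev x (der i (rel l)))) /index_iota subn0 /=.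
ring.
Qed.

Lemma Phi_lift_pt u : curve rs u -> ev (lift_pt u) Phi = 0.
Proof.
move=> [_ hY]; rewrite ev_Phi_sum !ev_lift_pt//= !subrr !mulr0 subrr add0r.
rewrite big1// => l _; rewrite (ev_lift_pt _ (rel l)); last exact: vars_in_nth_rs.
by rewrite hY// mulr0.
Qed.

Hypothesis hmu : forall u, curve rs u -> forall j, (j < k)%N ->
  ev u (der j.+3 w) - ev u om * dgen w v th j u =
  \sum_(l < k) ev u (mu l) * ev u (der j.+3 (rel l)).

Lemma dPhi_lift_pt u j : curve rs u -> (j < k)%N -> ev (lift_pt u) (der j.+3 Phi) = 0.
Proof.
move=> Yu hj; have [_ hY] := Yu.
rewrite der_Phi !ev_lift_pt ?vars_in_der//= !subrr !mulr0 subr0 add0r.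
rewrite (eq_bigr (fun l : 'I_k => ev u (mu l) * ev u (der j.+3 (rel l)))); last first.
  move=> l _; rewrite (ev_lift_pt _ (rel l)) ?hY ?mulr0 ?add0r//; last exact: vars_in_nth_rs.
  by rewrite !ev_lift_pt ?vars_in_der//; exact: vars_in_nth_rs.
by rewrite -hmu// /dgen; ring.
Qed.

Lemma dPhi12_lift_pt u : curve rs u ->
  ev (lift_pt u) (der 1 Phi) = 1 + th * ev u om /\ ev (lift_pt u) (der 2 Phi) = - ev u om.
Proof.
move=> [_ hY].
have z i e : (0 < i < 3)%N -> vars_in (tower_var k) e -> ev (lift_pt u) (der i e) = 0.
  move=> hi oe; apply: ev_der_notin oe _.
  by case: i hi => [|[|[|i]]].
have s0 i : (0 < i < 3)%N -> \sum_(l < k) (ev (lift_pt u) (der i (mu l)) * ev (lift_pt u) (rel l) +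
   ev (lift_pt u) (mu l) * ev (lift_pt u) (der i (rel l))) = 0.
  move=> hi; rewrite big1// => l _; rewrite !z//; last exact: vars_in_nth_rs.
  by rewrite mul0r mulr0 addr0.
by split; rewrite der_Phi s0// !z// !ev_lift_pt//=; ring.
Qed.

(** Substituting the approximations of the z_j into Phi gives a polynomial G in
    (z0, p1, p2).  Since Phi is stationary in the z_j along the curve, the errors
    enter only to second order, and on a thin enough tube the slope of G in the
    direction (1, th) stays within 1/2 of 1. *)
Lemma transversal_normal : bounded_curve rs -> decodable rs w v -> transversal rs w v th.
Proof.
move=> [B hB] [K [r0 [K0 r00 hZ]]].
have [Mw Mw0 hMw] := ev_bound _ _ B ow; have [Mv Mv0 hMv] := ev_bound _ _ B ov.
have [Mo Mo0 hMo] := ev_bound _ _ B oom.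
pose B' : R := `|B| + Mw + Mv + 1.
have [L L0 hL] := ev_taylor _ _ B' vars_in_Phi.
have [L1 L10 hL1] := ev_lip _ _ B' vars_in_Phi.
set kk : R := k%:R; have kk0 : 0 <= kk by rewrite ler0n.
pose A : R := 2 + 2 * kk * K + kk.
have kKge : 0 <= kk * K by rewrite mulr_ge0// ltW.
have A0 : 0 < A by rewrite /A; lra.
pose T := 1 + cmod th; have T0 : 0 < T by rewrite ltr_pwDl ?cmod_ge0.
have kK0 : 0 < 1 + kk * K by lra.
pose Q := (2 * K + 2) + 4 * L * A * (1 + kk * K) * T.
have Q2 : 0 < 4 * L * A * (1 + kk * K) * T by rewrite !mulr_gt0.
have Q0 : 0 < Q by rewrite /Q; lra.
pose r := Num.min r0 (1 / Q).
have rpos : 0 < r by rewrite lt_min r00 divr_gt0.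
have rr0 : r <= r0 by rewrite ge_min lexx.
have rQ : r * Q <= 1 by rewrite -ler_pdivlMr// ge_min lexx orbT.
have rA : (2 * K + 1) * r <= 1.
  apply: le_trans rQ; rewrite mulrC ler_pM2l// /Q; lra.
have rB : 4 * L * A * (1 + kk * K) * T * r <= 1.
  apply: le_trans rQ; rewrite (mulrC r) ler_pM2r// /Q; lra.
have r1 : r <= 1.
  by apply: le_trans rA; rewrite ler_peMl ?ltW//; lra.
exists r, (1 + cmod th * Mo + Mo + L * (2 * A) * (1 + kk * K)).
have cth := cmod_ge0 th.
have L20 : 0 <= L * (2 * A) * (1 + kk * K) by rewrite !mulr_ge0// ltW.
split=> //.
  have := mulr_ge0 cth (ltW Mo0); lra.
move=> e e0; pose e' := Num.min r (e / (L1 * (kk + 1))).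
have e'0 : 0 < e' by rewrite lt_min rpos divr_gt0// mulr_gt0// ltr_wpDl.
have e'r : e' <= r by rewrite ge_min lexx.
have e'e : L1 * (kk * e') <= e.
  apply: (@le_trans _ _ (L1 * (kk + 1) * e')).
    by rewrite -mulrA ler_pM2l// ler_pM2r// lerDl.
  by rewrite mulrC -ler_pdivlMr ?ge_min ?lexx ?orbT// mulr_gt0// ltr_wpDl.
have [Z [oZ hZ']] := hZ _ e'0.
pose sg i : pexp := match i with j.+3 => Z j | _ => Var i end.
exists (psubst sg Phi).
  by apply: vars_in_psubst vars_in_Phi _ => -[|[|[|j]]] _ //; exact: oZ.
move=> u Yu; have [hZ1 hZ2] := hZ' u Yu.
pose fp p1 p2 : pt := fun i => ev (triple (u 0%N) p1 p2) (sg i).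
have evG p1 p2 : ev (triple (u 0%N) p1 p2) (psubst sg Phi) = ev (fp p1 p2) Phi.
  by rewrite ev_psubst.
have nearC : near_curve w v u r (ev u w) (ev u v) by rewrite /near_curve !subrr !Normc.normc0 ltW.
have near0 p1 p2 : near_curve w v u r p1 p2 -> near_curve w v u r0 p1 p2.
  by move=> [h1 h2]; split; apply: le_trans rr0.
have Zn p1 p2 j : near_curve w v u r p1 p2 -> (j < k)%N ->
    cmod (fp p1 p2 j.+3 - u j.+3) <= 2 * K * r + e'.
  move=> hp hj.
  have h1 := hZ2 _ _ _ _ (near0 _ _ hp) (near0 _ _ nearC) _ hj.
  have h2 := hZ1 _ hj; have [h3 h4] := hp.
  rewrite -[fp _ _ _](subrK (ev (triple (u 0%N) (ev u w) (ev u v)) (Z j))) -addrA.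
  apply: le_trans (cmodD_le _ _) _; apply: lerD => //.
  apply: le_trans h1 _; rewrite /dist2 (mulrC 2) -mulrA ler_pM2l//; lra.
(* all points in sight have coordinates bounded by B' *)
have uB i : tower_var k i -> cmod (u i) <= B by exact: hB.
have wB : cmod (ev u w) <= Mw by apply: hMw.
have vB : cmod (ev u v) <= Mv by apply: hMv.
have oB : cmod (ev u om) <= Mo by apply: hMo.
have BB : B <= `|B| by exact: ler_norm.
have BB0 : 0 <= `|B| by [].
have bl : coords_le k.+3 B' (lift_pt u).
  move=> [|[|[|i]]] hi /=; rewrite /B'.
  - by have := uB 0%N isT; lra.
  - by lra.
  - by lra.
  - have hi' : tower_var k i.+3 by apply: tower_var_var.
    by have := uB _ hi'; lra.
have bf p1 p2 : near_curve w v u r p1 p2 -> coords_le k.+3 B' (fp p1 p2).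
  move=> hp [|[|[|i]]] hi; rewrite /B'.
  - by rewrite /fp /=; have := uB 0%N isT; lra.
  - by rewrite /fp /=; have := cmod_near _ _ _ hp.1; lra.
  - by rewrite /fp /=; have := cmod_near _ _ _ hp.2; lra.
  - have hi' : tower_var k i.+3 by apply: tower_var_var.
    have := uB _ hi'; have := cmod_near _ _ _ (Zn _ _ _ hp hi); lra.
have dl p1 p2 : near_curve w v u r p1 p2 -> coord_dist k.+3 (fp p1 p2) (lift_pt u) <= A * r.
  move=> hp; rewrite /coord_dist (sum3 k _ (fun i => cmod (fp p1 p2 i - lift_pt u i))).
  rewrite {1 2 3}/fp /= subrr Normc.normc0 add0r.
  have : \sum_(j < k) cmod (fp p1 p2 j.+3 - u j.+3) <= \sum_(j < k) (2 * K * r + e').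
    by apply: ler_sum => j _; exact: Zn.
  rewrite sumr_const card_ord -mulr_natl -/kk; have [h1 h2] := hp.
  have : kk * (2 * K * r + e') <= kk * (2 * K * r + r) by rewrite ler_wpM2l// lerD2l.
  by rewrite /A; lra.
have dd p1 p2 q1 q2 : near_curve w v u r p1 p2 -> near_curve w v u r q1 q2 ->
    coord_dist k.+3 (fp p1 p2) (fp q1 q2) <= (1 + kk * K) * dist2 p1 p2 q1 q2.
  move=> hp hq; rewrite /coord_dist (sum3 k _ (fun i => cmod (fp p1 p2 i - fp q1 q2 i))).
  rewrite {1 2 3 4 5 6}/fp /= subrr Normc.normc0 add0r.
  have : \sum_(j < k) cmod (fp p1 p2 j.+3 - fp q1 q2 j.+3) <=
         \sum_(j < k) (K * dist2 p1 p2 q1 q2).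
    by apply: ler_sum => j _; apply: hZ2 => //; exact: near0.
  rewrite sumr_const card_ord -mulr_natl -/kk /dist2; lra.
have main p1 p2 q1 q2 : near_curve w v u r p1 p2 -> near_curve w v u r q1 q2 ->
    cmod (ev (fp p1 p2) Phi - ev (fp q1 q2) Phi -
      ((1 + th * ev u om) * (p1 - q1) - ev u om * (p2 - q2))) <=
    L * (2 * A) * (1 + kk * K) * r * dist2 p1 p2 q1 q2.
  move=> hp hq; have := hL _ _ _ bl (bf _ _ hp) (bf _ _ hq).
  rewrite (sum3 k _ (fun i => ev (lift_pt u) (der i Phi) * (fp p1 p2 i - fp q1 q2 i))).
  have [-> ->] := dPhi12_lift_pt u Yu.
  rewrite (big1 _ _ (fun j : 'I_k => ev (lift_pt u) (der j.+3 Phi) * _)); last first.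
    by move=> j _; rewrite dPhi_lift_pt ?mul0r.
  have [fp0 fp1 fp2] : [/\ forall a b, fp a b 0%N = u 0%N,
    forall a b, fp a b 1%N = a & forall a b, fp a b 2%N = b] by [].
  rewrite !fp0 !fp1 !fp2 subrr mulr0 add0r addr0 mulNr => h.
  apply: (le_trans h).
  have h1 := dl _ _ hp; have h2 := dl _ _ hq; have h3 := dd _ _ _ _ hp hq.
  have -> : L * (2 * A) * (1 + kk * K) * r * dist2 p1 p2 q1 q2 =
    L * (A * r + A * r) * ((1 + kk * K) * dist2 p1 p2 q1 q2) by ring.
  apply: ler_pM => //; rewrite ?dst_ge0//.
    by rewrite mulr_ge0 ?addr_ge0 ?dst_ge0// ltW.
  by rewrite ler_pM2l// lerD.
split.
- rewrite evG -[ev _ _]subr0 -(Phi_lift_pt u Yu).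
  apply: le_trans (hL1 _ _ (bf _ _ nearC) bl) _; apply: le_trans e'e.
  rewrite ler_pM2l// /coord_dist (sum3 k _ (fun i => cmod (fp (ev u w) (ev u v) i - lift_pt u i))).
  rewrite {1 2 3}/fp /= !subrr Normc.normc0 !add0r.
  apply: (@le_trans _ _ (\sum_(j < k) e')); last by rewrite sumr_const card_ord -mulr_natl.
  by apply: ler_sum => j _; exact: hZ1.
- move=> p1 p2 q1 q2 hp hq; rewrite !evG; have := main _ _ _ _ hp hq.
  set lin := (X in _ - X) => h; rewrite -[X in cmod X](subrK lin).
  apply: le_trans (cmodD_le _ _) _.
  have hl : cmod lin <= (1 + cmod th * Mo + Mo) * dist2 p1 p2 q1 q2.
    rewrite /lin; apply: le_trans (cmodB_le _ _) _; rewrite !cmodM.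
    have h1 : cmod (1 + th * ev u om) <= 1 + cmod th * Mo.
      apply: le_trans (cmodD_le _ _) _; rewrite Normc.normc1 cmodM lerD2l.
      by rewrite ler_wpM2l.
    have h2 : cmod (1 + th * ev u om) * cmod (p1 - q1) <= (1 + cmod th * Mo) * cmod (p1 - q1).
      by rewrite ler_wpM2r ?cmod_ge0.
    have h3 : cmod (ev u om) * cmod (p2 - q2) <= Mo * cmod (p2 - q2).
      by rewrite ler_wpM2r ?cmod_ge0.
    have h4 : 0 <= Mo * cmod (p1 - q1) by rewrite mulr_ge0 ?cmod_ge0 ?ltW.
    have h5 : 0 <= (1 + cmod th * Mo) * cmod (p2 - q2).
      by rewrite mulr_ge0 ?cmod_ge0// addr_ge0// mulr_ge0// ltW.
    rewrite /dist2 mulrDl !mulrDr; lra.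
  rewrite [X in _ <= X]mulrDl addrC; apply: lerD => //; apply: le_trans h _.
  rewrite ler_wpM2r ?dist2_ge0// ler_piMr//.
- move=> p1 p2 q1 q2 z hp hq e1 e2; rewrite !evG; have := main _ _ _ _ hp hq.
  have -> : (1 + th * ev u om) * (p1 - q1) - ev u om * (p2 - q2) = z.
    by rewrite e1 e2; ring.
  move=> h; apply: le_trans h _.
  have -> : dist2 p1 p2 q1 q2 = T * cmod z by rewrite /dist2 e1 e2 cmodM /T; ring.
  have -> : L * (2 * A) * (1 + kk * K) * r * (T * cmod z) =
    (4 * L * A * (1 + kk * K) * T * r) * (cmod z / 2) by field.
  by rewrite ler_piMl// divr_ge0 ?cmod_ge0.
Qed.

End Normal.

End Decode.

Section DecodeStep.
Context {R : realType}.
Local Notation C := R[i].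
Local Notation pexp := (pexp R).
Local Notation pt := (nat -> C).

Lemma halves_small (M d : R) : 0 < d -> exists n : nat, M * (1 / 2) ^+ n <= d.
Proof.
move=> d0; have [M0|M0] := leP M 0.
  by exists 0%N; rewrite expr0 mulr1 (le_trans M0)// ltW.
have /cvgrPdist_lt/(_ _ (divr_gt0 d0 M0)) :
    (1 / 2 : R) ^+ n @[n --> \oo] --> (0 : R).
  by apply: cvg_expr; rewrite ger0_norm; lra.
move=> [n _ /(_ n (leqnn n))] /=; rewrite sub0r normrN ger0_norm ?exprn_ge0//.
by move=> h; exists n; rewrite mulrC -ler_pdivlMr// ltW.
Qed.

(** If g is an approximate equation of the point (w, v) with slope close to 1 in
    the direction (1, th), the number s0 can be found from (w', v') by Newton's
    method with the constant slope c: the step is a contraction of ratio 1/2, and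
    its fixed point is s0 up to the size of g (w, v) divided by c. *)
Section Newton.
Context (g : C -> C -> C) (w v w' v' c th s0 : C) (M r r' L eps b : R).

Definition tube (a b : C) (t : R) (p1 p2 : C) :=
  cmod (p1 - a) <= t /\ cmod (p2 - b) <= t.

Definition newton (p1 p2 s : C) := s + c^-1 * g (p1 - c * s) (p2 - c * th * s).

Context (cn0 : c != 0) (bE : cmod c = b) (w'E : w' = w + c * s0)
  (v'E : v' = v + c * th * s0) (M0 : 0 < M) (L0 : 0 < L) (s0M : cmod s0 <= M)
  (bMT : b * M * (1 + cmod th) <= r / 2) (r'0 : 0 < r') (r'r : r' <= r / 2)
  (r'L : L * (2 * r') <= b * M / 4) (eM : eps <= b * M / 4)
  (g_small : cmod (g w v) <= eps)
  (g_lip : forall p1 p2 q1 q2 : C, tube w v r p1 p2 -> tube w v r q1 q2 ->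
     cmod (g p1 p2 - g q1 q2) <= L * dist2 p1 p2 q1 q2)
  (g_slope : forall p1 p2 q1 q2 zeta : C, tube w v r p1 p2 -> tube w v r q1 q2 ->
     p1 - q1 = zeta -> p2 - q2 = zeta * th ->
     cmod (g p1 p2 - g q1 q2 - zeta) <= cmod zeta / 2).

Let b0 : 0 < b.
Proof.
rewrite -bE lt_neqAle cmod_ge0 andbT eq_sym.
by apply: contra cn0 => /eqP/Normc.eq0_normc ->.
Qed.

Let bi (x : R) : b^-1 * (b * x) = x. Proof. by rewrite mulKf// gt_eqF. Qed.

Let ci (x : C) : cmod (c^-1 * x) = b^-1 * cmod x.
Proof. by rewrite cmodM Normc.normcV bE. Qed.

Let s00 : cmod (s0 - s0) <= M. Proof. by rewrite subrr Normc.normc0 ltW. Qed.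

Let center : tube w' v' r' w' v'. Proof. by rewrite /tube !subrr !Normc.normc0 ltW. Qed.

Lemma newton_tube (p1 p2 s : C) : tube w' v' r' p1 p2 -> cmod (s - s0) <= M ->
  tube w v r (p1 - c * s) (p2 - c * th * s).
Proof.
move=> [h1 h2] hs; have bM0 : 0 <= b * M by rewrite mulr_ge0// ltW.
have thM0 : 0 <= b * M * cmod th by rewrite mulr_ge0 ?cmod_ge0.
have := bMT; have hr := r'r => hT.
have bM : b * M <= r / 2 by lra.
have bthM : b * cmod th * M <= r / 2 by lra.
split.
  rewrite (_ : _ - _ = (p1 - w') - c * (s - s0)); last by rewrite w'E; ring.
  apply: le_trans (cmodB_le _ _) _; rewrite cmodM bE.
  have h3 : b * cmod (s - s0) <= r / 2 by apply: le_trans bM; rewrite ler_pM2l.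
  by apply: le_trans (lerD h1 h3) _; lra.
rewrite (_ : _ - _ = (p2 - v') - c * th * (s - s0)); last by rewrite v'E; ring.
apply: le_trans (cmodB_le _ _) _; rewrite !cmodM bE.
have h3 : b * cmod th * cmod (s - s0) <= r / 2.
  by apply: le_trans bthM; rewrite ler_wpM2l// mulr_ge0 ?cmod_ge0// ltW.
by apply: le_trans (lerD h2 h3) _; lra.
Qed.

Lemma newton_contract (p1 p2 s t : C) : tube w' v' r' p1 p2 ->
  cmod (s - s0) <= M -> cmod (t - s0) <= M ->
  cmod (newton p1 p2 s - newton p1 p2 t) <= cmod (s - t) / 2.
Proof.
move=> hp hs ht; have ns := newton_tube _ _ _ hp hs; have nt := newton_tube _ _ _ hp ht.
have h := g_slope _ _ _ _ (- c * (s - t)) ns nt.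
rewrite (_ : _ - _ = c^-1 * (g (p1 - c * s) (p2 - c * th * s) -
  g (p1 - c * t) (p2 - c * th * t) - - c * (s - t))); last first.
  by rewrite /newton; field; exact: cn0.
rewrite ci -[X in _ <= X]bi ler_pM2l ?invr_gt0//.
apply: le_trans (h _ _) _; [ring|ring|].
by rewrite cmodM cmodN bE mulrA.
Qed.

Lemma newton_residual (p1 p2 : C) : tube w' v' r' p1 p2 ->
  cmod (newton p1 p2 s0 - s0) <= b^-1 * (eps + L * dist2 p1 p2 w' v').
Proof.
move=> hp; rewrite /newton (_ : _ - _ = c^-1 * g (p1 - c * s0) (p2 - c * th * s0)); last by ring.
rewrite ci ler_pM2l ?invr_gt0//.
have hc : tube w v r w v.
  by rewrite /tube !subrr Normc.normc0; have := r'0; have := r'r; split; lra.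
have := g_lip _ _ _ _ (newton_tube _ _ _ hp s00) hc.
rewrite (_ : dist2 (p1 - c * s0) _ _ _ = dist2 p1 p2 w' v'); last first.
  by rewrite /dist2 w'E v'E !opprD !addrA; congr (cmod _ + cmod _); ring.
move=> h2; rewrite -[g (p1 - _) _](subrK (g w v)).
by apply: le_trans (cmodD_le _ _) _; rewrite addrC lerD.
Qed.

Lemma newton_stable m (p1 p2 : C) : tube w' v' r' p1 p2 ->
  cmod (iter m (newton p1 p2) 0 - s0) <= M.
Proof.
move=> hp; elim: m => [|m ih]; first by rewrite sub0r cmodN.
rewrite iterS; set s := iter m _ _ in ih *.
rewrite -[newton _ _ _](subrK (newton p1 p2 s0)) -addrA.
apply: le_trans (cmodD_le _ _) _.
have h1 := newton_contract _ _ _ _ hp ih s00; have h2 := newton_residual _ _ hp.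
have hL := r'L; have he := eM; have hM := M0.
suff : b^-1 * (eps + L * dist2 p1 p2 w' v') <= M / 2 by lra.
rewrite -(bi (M / 2)) ler_pM2l ?invr_gt0//; have [h3 h4] := hp.
have : L * dist2 p1 p2 w' v' <= L * (2 * r') by rewrite ler_pM2l// /dist2; lra.
lra.
Qed.

Lemma newton_lip m (p1 p2 q1 q2 : C) : tube w' v' r' p1 p2 -> tube w' v' r' q1 q2 ->
  cmod (iter m (newton p1 p2) 0 - iter m (newton q1 q2) 0) <=
  2 * L / b * dist2 p1 p2 q1 q2.
Proof.
move=> hp hq; elim: m => [|m ih].
  by rewrite subrr Normc.normc0 mulr_ge0 ?dist2_ge0// divr_ge0 ?(ltW b0)// mulr_ge0 ?(ltW L0).
rewrite !iterS; have ip := newton_stable m _ _ hp; have iq := newton_stable m _ _ hq.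
set s := iter m _ _ in ih ip *; set t := iter m _ _ in ih iq *.
rewrite -[newton p1 p2 s](subrK (newton p1 p2 t)) -addrA.
apply: le_trans (cmodD_le _ _) _.
have h1 := newton_contract _ _ _ _ hp ip iq.
have h2 : cmod (newton p1 p2 t - newton q1 q2 t) <= L / b * dist2 p1 p2 q1 q2.
  rewrite (_ : _ - _ = c^-1 * (g (p1 - c * t) (p2 - c * th * t) -
    g (q1 - c * t) (q2 - c * th * t))); last by rewrite /newton; ring.
  have -> : L / b * dist2 p1 p2 q1 q2 = b^-1 * (L * dist2 p1 p2 q1 q2) by ring.
  rewrite ci ler_pM2l ?invr_gt0//.
  apply: le_trans (g_lip _ _ _ _ (newton_tube _ _ _ hp iq) (newton_tube _ _ _ hq iq)) _.
  rewrite ler_pM2l// /dist2 le_eqVlt; apply/orP; left; apply/eqP.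
  by congr (cmod _ + cmod _); ring.
lra.
Qed.

Lemma newton_conv m :
  cmod (iter m (newton w' v') 0 - s0) <= M * (1 / 2) ^+ m + 2 * (b^-1 * eps).
Proof.
have e0 : 0 <= b^-1 * eps.
  by rewrite mulr_ge0 ?invr_ge0 ?(ltW b0)//; apply: le_trans g_small; exact: cmod_ge0.
have hs0 := s0M.
elim: m => [|m ih]; first by rewrite sub0r cmodN expr0 mulr1; lra.
rewrite iterS; have im := newton_stable m _ _ center; set s := iter m _ _ in ih im *.
rewrite -[newton _ _ _](subrK (newton w' v' s0)) -addrA.
apply: le_trans (cmodD_le _ _) _.
have h1 := newton_contract _ _ _ _ center im s00; have := newton_residual _ _ center.
rewrite /dist2 !subrr Normc.normc0 addr0 mulr0 addr0 => h2.
rewrite exprS; lra.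
Qed.

End Newton.

Context (rs : seq pexp) (w v q : pexp) (th : C).
Context (oq : vars_in (tower_var (size rs)) q).
Local Notation k := (size rs).

Lemma bounded_step : bounded_curve rs -> bounded_curve (newrs rs q).
Proof.
move=> [B hB]; have [M M0 hM] := ev_bound _ _ B oq.
exists (`|B| + (M + 1)) => u /curve_newrs[Yu s2] i; rewrite size_newrs => hi.
have BB := ler_norm B.
have [->|ne] := eqVneq i k.+3.
  have : cmod (u k.+3) ^+ 2 <= M.
    by rewrite expr2 -cmodM -expr2 s2 hM// => j; exact: hB.
  have [h|h] := leP (cmod (u k.+3)) 1.
    by have : 0 <= `|B| by []; lra.
  move=> h2; have : cmod (u k.+3) <= M.
    by apply: le_trans h2; rewrite expr2 ler_peMl ?cmod_ge0 ?(ltW h).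
  by have : 0 <= `|B| by []; lra.
have hi' : tower_var k i by exact: tower_var_pred.
have := hB _ Yu _ hi'; lra.
Qed.

(** The new coordinate s is recovered by Newton iterates S, which are polynomials
    in (z0, p1, p2); the old ones are then read off at the corrected point
    p - c S (1, th), which is close to the old curve. *)
Lemma decodable_step : bounded_curve rs -> decodable rs w v -> transversal rs w v th ->
  exists2 c0 : R, 0 < c0 & forall c : C, c != 0 -> cmod c <= c0 ->
    decodable (newrs rs q) (neww rs w c) (newv rs v th c).
Proof.
move=> hB [K [rZ [K0 rZ0 hZ]]] [rG [L [rG0 L0 hG]]].
have [B' hB'] := bounded_step hB.
pose M := `|B'| + 1; have M0 : 0 < M by rewrite ltr_wpDl.
have sM u : curve (newrs rs q) u -> cmod (u k.+3) <= M.
  move=> /hB' /(_ k.+3); rewrite size_newrs => /(_ (tower_var_var _ _ (ltnSn _))) h.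
  by rewrite /M; have := ler_norm B'; lra.
pose r := Num.min rZ rG; have r0 : 0 < r by rewrite lt_min rZ0.
have rrZ : r <= rZ by rewrite ge_min lexx.
have rrG : r <= rG by rewrite ge_min lexx orbT.
pose T := 1 + cmod th; have T0 : 0 < T by rewrite ltr_pwDl ?cmod_ge0.
exists (r / (2 * M * T)) => [|c cn0]; first by rewrite divr_gt0// !mulr_gt0.
set b := cmod c => cb.
have b0 : 0 < b.
  rewrite lt_neqAle cmod_ge0 andbT eq_sym.
  by apply: contra cn0 => /eqP/Normc.eq0_normc ->.
have bMT : b * M * T <= r / 2.
  have h2 : 0 < 2 * M * T by rewrite !mulr_gt0.
  by move: cb; rewrite ler_pdivlMr//; clear; lra.
pose r' := Num.min (r / 2) (b * M / (8 * L)).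
have L80 : 0 < 8 * L by rewrite mulr_gt0.
have r'0 : 0 < r' by rewrite lt_min !divr_gt0// mulr_gt0.
have r'r : r' <= r / 2 by rewrite ge_min lexx.
have r'L : L * (2 * r') <= b * M / 4.
  have : r' * (8 * L) <= b * M by rewrite -ler_pdivlMr// ge_min lexx orbT.
  by clear; lra.
exists (K * (1 + 2 * L * T) + 2 * L / b), r'; split => //.
  by rewrite addr_gt0 ?mulr_gt0 ?divr_gt0 ?invr_gt0 ?addr_gt0 ?mulr_gt0.
move=> e e0.
have KbT0 : 0 < 2 * K * b * T by rewrite !mulr_gt0.
pose d := Num.min e (e / (2 * K * b * T)).
have d0 : 0 < d by rewrite lt_min e0 divr_gt0.
have de : d <= e by rewrite ge_min lexx.
have dK : K * (b * T * d) <= e / 2.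
  have : d * (2 * K * b * T) <= e by rewrite -ler_pdivlMr// ge_min lexx orbT.
  by clear; lra.
pose eG := Num.min (b * M / 4) (b * d / 4).
have eG0 : 0 < eG by rewrite lt_min !divr_gt0// mulr_gt0.
have eGM : eG <= b * M / 4 by rewrite ge_min lexx.
have eGd : 2 * (b^-1 * eG) <= d / 2.
  have h : eG <= b * (d / 4) by rewrite mulrA ge_min lexx orbT.
  have : b^-1 * eG <= d / 4 by rewrite ler_pdivrMl.
  by clear; lra.
have [G oG hG'] := hG _ eG0.
have e20 : 0 < e / 2 by rewrite divr_gt0.
have [Z [oZ hZ']] := hZ _ e20.
have [n hn] : exists n : nat, M * (1 / 2) ^+ n <= d / 2.
  by apply: halves_small; rewrite divr_gt0.
pose sh (S : pexp) i : pexp := match i with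
  | 0 => Var 0 | 1 => Add (Var 1) (Mul (Cst (- c)) S)
  | _ => Add (Var 2) (Mul (Cst (- (c * th))) S) end%N.
have osh S E : vars_in space_var S -> vars_in space_var E -> vars_in space_var (psubst (sh S) E).
  by move=> oS oE; apply: vars_in_psubst oE _ => -[|[|i]] //=; rewrite oS.
have evsh S E u0 p1 p2 : vars_in space_var E -> ev (triple u0 p1 p2) (psubst (sh S) E) =
    ev (triple u0 (p1 - c * ev (triple u0 p1 p2) S) (p2 - c * th * ev (triple u0 p1 p2) S)) E.
  by move=> oE; rewrite ev_psubst; apply: ev_ext oE _ => -[|[|[|i]]] //= _; rewrite mulNr.
pose Sn := fix Sn n := if n is m.+1 then
  Add (Sn m) (Mul (Cst c^-1) (psubst (sh (Sn m)) G)) else Cst 0.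
have oSn m : vars_in space_var (Sn m) by elim: m => //= m ih; rewrite ih osh.
exists (fun j => if (j < k)%N then psubst (sh (Sn n)) (Z j) else Sn n); split.
  by move=> j; case: ifP => _ //; exact: osh.
move=> u Yu'; have [Yu s2] := (curve_newrs rs q u).1 Yu'.
have [hG1 hG2 hG3] := hG' u Yu; have [hZ1 hZ2] := hZ' u Yu.
set s0 := u k.+3; have s0M : cmod s0 <= M := sM _ Yu'.
pose g p1 p2 := ev (triple (u 0%N) p1 p2) G.
set w0 := ev u w in hG1 hG2 hG3 hZ1 hZ2; set v0 := ev u v in hG1 hG2 hG3 hZ1 hZ2.
have SnE m p1 p2 : ev (triple (u 0%N) p1 p2) (Sn m) = iter m (newton g c th p1 p2) 0.
  by elim: m => // m ih; rewrite iterS -ih /newton /g /= evsh.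
have gl p1 p2 q1 q2 : tube w0 v0 r p1 p2 -> tube w0 v0 r q1 q2 ->
    cmod (g p1 p2 - g q1 q2) <= L * dist2 p1 p2 q1 q2.
  by move=> [h1 h2] [h3 h4]; apply: hG2; split; apply: le_trans rrG.
have gs p1 p2 q1 q2 z : tube w0 v0 r p1 p2 -> tube w0 v0 r q1 q2 ->
    p1 - q1 = z -> p2 - q2 = z * th ->
    cmod (g p1 p2 - g q1 q2 - z) <= cmod z / 2.
  by move=> [h1 h2] [h3 h4]; apply: hG3; split; apply: le_trans rrG.
rewrite -[ev u (neww rs w c)]/(w0 + c * s0) -[ev u (newv rs v th c)]/(v0 + c * th * s0).
have [w' w'E] : exists w', w' = w0 + c * s0 by eexists.
have [v' v'E] : exists v', v' = v0 + c * th * s0 by eexists.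
rewrite -w'E -v'E.
have nr := newton_tube w0 v0 w' v' c th s0 M r r' b cn0 erefl w'E v'E M0 bMT r'r.
have inv := newton_stable g w0 v0 w' v' c th s0 M r r' L eG b cn0 erefl w'E v'E
  M0 L0 s0M bMT r'0 r'r r'L eGM hG1 gl gs.
have lip := newton_lip g w0 v0 w' v' c th s0 M r r' L eG b cn0 erefl w'E v'E
  M0 L0 s0M bMT r'0 r'r r'L eGM hG1 gl gs.
have conv := newton_conv g w0 v0 w' v' c th s0 M r r' L eG b cn0 erefl w'E v'E
  M0 L0 s0M bMT r'0 r'r r'L eGM hG1 gl gs n.
have nZ p1 p2 : tube w0 v0 r p1 p2 -> near_curve w v u rZ p1 p2.
  by move=> [h1 h2]; split; apply: le_trans rrZ.
have hp : tube w' v' r' w' v' by rewrite /tube !subrr !Normc.normc0 ltW.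
have {conv}Sd : cmod (ev (triple (u 0%N) w' v') (Sn n) - s0) <= d.
  by rewrite SnE; move: conv eGd hn; clear; lra.
split=> [j|p1 p2 q1 q2 np nq j]; rewrite size_newrs ltnS => hj.
  case: ifP => [jk|]; last first.
    move=> /negbT; rewrite -leqNgt => kj.
    have -> : j = k by apply/eqP; rewrite eqn_leq hj kj.
    exact: le_trans Sd de.
  rewrite evsh// SnE; have := inv n _ _ hp; rewrite SnE in Sd; set s := iter n _ _ in Sd *.
  move=> /(nr _ _ _ hp)/nZ ns.
  have nc : near_curve w v u rZ w0 v0 by rewrite /near_curve !subrr !Normc.normc0 ltW.
  have h1 := hZ2 _ _ _ _ ns nc _ jk; have h2 := hZ1 _ jk.
  have h3 : dist2 (w' - c * s) (v' - c * th * s) w0 v0 <= b * T * d.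
    rewrite /dist2.
    rewrite (_ : w' - _ - _ = - c * (s - s0)); last by rewrite w'E; ring.
    rewrite (_ : v' - _ - _ = - (c * th) * (s - s0)); last by rewrite v'E; ring.
    rewrite !cmodM !cmodN cmodM -/b.
    have : b * T * cmod (s - s0) <= b * T * d by rewrite ler_pM2l// mulr_gt0.
    by rewrite /T; clear; lra.
  have h4 : K * dist2 (w' - c * s) (v' - c * th * s) w0 v0 <= e / 2.
    by apply: le_trans dK; rewrite ler_pM2l.
  rewrite -[X in X - _](subrK (ev (triple (u 0%N) w0 v0) (Z j))) -addrA.
  by apply: le_trans (cmodD_le _ _) _; move: h1 h2 h4; clear; lra.
have nn a1 a2 : near_curve (neww rs w c) (newv rs v th c) u r' a1 a2 -> tube w' v' r' a1 a2.
  by rewrite /tube w'E v'E.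
have {}np := nn _ _ np; have {}nq := nn _ _ nq.
have D0 := dist2_ge0 p1 p2 q1 q2; have := lip n _ _ _ _ np nq; rewrite -!SnE => hl.
have Lb0 : 0 <= 2 * L / b by rewrite divr_ge0 ?mulr_ge0 ?(ltW L0) ?(ltW b0).
have KL0 : 0 <= K * (1 + 2 * L * T).
  by rewrite mulr_ge0 ?(ltW K0)// addr_ge0// !mulr_ge0 ?(ltW L0) ?(ltW T0).
case: ifP => [jk|_]; last first.
  by apply: le_trans hl _; rewrite ler_wpM2r// lerDr.
apply: (@le_trans _ _ (K * (1 + 2 * L * T) * dist2 p1 p2 q1 q2)); last first.
  by rewrite ler_wpM2r// lerDl.
rewrite !evsh//; have := inv n _ _ np; have := inv n _ _ nq; rewrite -!SnE.
set s := ev _ (Sn n) in hl *; set t := ev _ (Sn n) in hl *.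
move=> /(nr _ _ _ nq)/nZ nt /(nr _ _ _ np)/nZ ns.
apply: le_trans (hZ2 _ _ _ _ ns nt _ jk) _.
rewrite -(mulrA K) ler_pM2l// {1}/dist2.
have h1 : cmod (p1 - c * s - (q1 - c * t)) <= cmod (p1 - q1) + b * cmod (s - t).
  rewrite (_ : _ - _ = (p1 - q1) - c * (s - t)); last by ring.
  by apply: le_trans (cmodB_le _ _) _; rewrite cmodM.
have h2 : cmod (p2 - c * th * s - (q2 - c * th * t)) <=
    cmod (p2 - q2) + b * cmod th * cmod (s - t).
  rewrite (_ : _ - _ = (p2 - q2) - c * th * (s - t)); last by ring.
  by apply: le_trans (cmodB_le _ _) _; rewrite !cmodM.
have h3 : b * T * cmod (s - t) <= 2 * L * T * dist2 p1 p2 q1 q2.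
  have -> : 2 * L * T * dist2 p1 p2 q1 q2 = b * T * (2 * L / b * dist2 p1 p2 q1 q2).
    by field; rewrite gt_eqF.
  by rewrite ler_pM2l// mulr_gt0.
by move: h1 h2 h3; rewrite /T /dist2; clear; lra.
Qed.

End DecodeStep.

(** * The maximum principle on the tower *)

Section MaximumPrinciple.
Context {R : realType}.
Local Notation C := R[i].
Local Notation pexp := (pexp R).
Local Notation pt := (nat -> C).
Implicit Types (rs : seq pexp) (f : pt -> C) (u : pt).

Lemma ev_base (e : pexp) : vars_in (tower_var 0) e -> exists p : {poly C}, forall u, ev u e = p.[u 0%N].
Proof.
elim: e => [c _|[|[|[|i]]]//= _|a iha b ihb /= /andP[/iha[p hp] /ihb[r hr]]|
  a iha b ihb /= /andP[/iha[p hp] /ihb[r hr]]].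
- by exists c%:P => u; rewrite hornerC.
- by exists 'X => u; rewrite hornerX.
- by exists (p + r) => u; rewrite hornerD hp hr.
- by exists (p * r) => u; rewrite hornerM hp hr.
Qed.

(** The maximum principle at the centre of the disc, by induction on the degree:
    averaging p over z and -z leaves p(0) unchanged and gives a polynomial in z^2
    of half the degree. *)
Lemma poly_center_le (p : {poly C}) (M : R) :
  (forall z : C, cmod z = 1 -> cmod p.[z] <= M) -> cmod p.[0] <= M.
Proof.
have [n] := ubnP (size p); elim: n p => // n ih p; rewrite ltnS => hn hp.
have [s1|s1] := leqP (size p) 1.
  have := hp 1 (Normc.normc1 _); rewrite (size1_polyC s1) !hornerC //.
have e1 z : p.[z] = (even_poly p).[z ^+ 2] + (odd_poly p).[z ^+ 2] * z.
  by rewrite -{1}(poly_even_odd p) hornerD hornerMX !horner_comp !hornerXn.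
rewrite e1 mulr0 addr0 expr0n /=; apply: ih => [|w w1].
  apply: leq_ltn_trans (size_even_poly p) _; apply: leq_trans hn.
  case: (size p) s1 => [|[|m]] //= _.
  by rewrite !ltnS leq_uphalf_double -addnn leq_addr.
pose z := sqrtC w; have z2 : z ^+ 2 = w by rewrite sqrtCK.
have z1 : cmod z = 1.
  have : cmod z ^+ 2 = 1 by rewrite -cmodX z2.
  by move=> /eqP; rewrite sqrf_eq1 => /orP[/eqP//|/eqP h]; have := cmod_ge0 z; rewrite h; lra.
have h1 := hp z z1; have h2 : cmod p.[- z] <= M by apply: hp; rewrite cmodN.
have -> : (even_poly p).[w] = 2^-1 * (p.[z] + p.[- z]).
  by rewrite !e1 sqrrN z2; field.
rewrite cmodM Normc.normcV.
rewrite (cmod_nat 2).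
have := cmodD_le p.[z] p.[- z]; lra.
Qed.

(** If x were larger than M, then y would be at most M and the powers of x would
    dominate. *)
Lemma powers_bound (x y : C) (M : R) : 0 <= M ->
  (forall m, cmod (x ^+ m + y ^+ m) <= 2 * M ^+ m) -> cmod (x * y) <= M ^+ 2 ->
  cmod x <= M.
Proof.
move=> M0 h hxy; rewrite leNgt; apply/negP => lt.
have x0 : 0 < cmod x by apply: le_lt_trans lt.
have yM : cmod y <= M.
  rewrite leNgt; apply/negP => lty; move: hxy; rewrite leNgt => /negP; apply.
  by rewrite cmodM expr2 ltr_pM.
have hm m : cmod x ^+ m <= 3 * M ^+ m.
  rewrite -cmodX -(addrK (y ^+ m) (x ^+ m)); apply: le_trans (cmodB_le _ _) _.
  have := h m; rewrite [cmod (y ^+ m)]cmodX.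
  have : cmod y ^+ m <= M ^+ m by rewrite lerXn2r ?nnegrE ?cmod_ge0.
  lra.
have : (M / cmod x) ^+ n @[n --> \oo] --> (0 : R).
  by apply: cvg_expr; rewrite ger0_norm ?divr_ge0 ?(ltW x0)// ltr_pdivrMr// mul1r.
have e3 : (0 : R) < 1 / 3 by [].
move=> /cvgrPdist_lt/(_ _ e3)[n _ /(_ n (leqnn n))] /=.
rewrite sub0r normrN ger0_norm ?exprn_ge0 ?divr_ge0 ?(ltW x0)//.
rewrite expr_div_n ltr_pdivrMr ?exprn_gt0//; have := hm n; lra.
Qed.

Definition center_le rs := forall f, regular (size rs) f -> forall M : R, 0 <= M ->
  (forall u, curve rs u -> cmod (u 0%N) = 1 -> cmod (f u) <= M) ->
  forall u, curve rs u -> u 0%N = 0 -> cmod (f u) <= M.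

Lemma center_le0 : center_le [::].
Proof.
move=> f [e /ev_base[p hp] he] M M0 h u _ u0.
rewrite he hp u0; apply: poly_center_le => z z1.
rewrite -(hp (fun=> z)) -he; apply: h => //.
by split=> //=; rewrite z1.
Qed.

Lemma regular_decomp rs (q : pexp) f : vars_in (tower_var (size rs)) q -> regular (size rs).+1 f ->
  exists a b, [/\ regular (size rs) a, regular (size rs) b &
    forall u, u (size rs).+3 ^+ 2 = ev u q -> f u = a u + b u * u (size rs).+3].
Proof.
set k := size rs => oq [e oe he].
suff [a [b [pa pb h]]] : exists a b, [/\ regular k a, regular k b &
    forall u, u k.+3 ^+ 2 = ev u q -> ev u e = a u + b u * u k.+3].
  by exists a, b; split => // u hu; rewrite he h.
have pc c : regular k (fun=> c) := regular_cst k c.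
elim: e oe {f he} => [c _|i /= hi|a iha b ihb /= /andP[/iha[a1 [a2 [p1 p2 h]]]
   /ihb[b1 [b2 [p3 p4 h']]]]|a iha b ihb /= /andP[/iha[a1 [a2 [p1 p2 h]]]
   /ihb[b1 [b2 [p3 p4 h']]]]].
- by exists (fun=> c), (fun=> 0); split=> // u _; rewrite mul0r addr0.
- have [->|ne] := eqVneq i k.+3.
    by exists (fun=> 0), (fun=> 1); split => // u _; rewrite mul1r add0r.
  have hi' : tower_var k i by exact: tower_var_pred.
  exists (fun u => u i), (fun=> 0); split => //; first exact: (regular_ev k (Var i)).
  by move=> u _; rewrite mul0r addr0.
- exists (fun u => a1 u + b1 u), (fun u => a2 u + b2 u); split; [exact: regular_add|exact: regular_add|].
  by move=> u hu; rewrite h// h'//; ring.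
- exists (fun u => a1 u * b1 u + a2 u * b2 u * ev u q), (fun u => a1 u * b2 u + a2 u * b1 u).
  have pq := regular_ev _ _ oq.
  split; [apply: regular_add; [|apply: regular_mul => //]; exact: regular_mul|apply: regular_add; exact: regular_mul|].
  by move=> u hu; rewrite h// h'// -hu; ring.
Qed.

Definition set_coord u i z : pt := fun j => if j == i then z else u j.

Lemma ev_set_coord u i z P (e : pexp) : vars_in P e -> ~~ P i -> ev (set_coord u i z) e = ev u e.
Proof.
move=> oe nP; apply: ev_ext oe _ => j Pj; rewrite /set_coord; case: eqP => // e'.
by rewrite e' in Pj; rewrite Pj in nP.
Qed.

Lemma curve_extend rs (q : pexp) u z : vars_in_rels rs -> vars_in (tower_var (size rs)) q -> curve rs u ->
  z ^+ 2 = ev u q -> curve (newrs rs q) (set_coord u (size rs).+3 z).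
Proof.
move=> ors oq [u0 hY] hz; apply/curve_newrs; split.
  split=> // l hl; rewrite (ev_set_coord _ _ _ (tower_var (size rs))) ?hY ?tower_var_fresh//.
  exact: vars_in_nth_rs.
rewrite (ev_set_coord _ _ _ (tower_var (size rs))) ?tower_var_fresh//.
by rewrite /set_coord eqxx.
Qed.

Lemma regular_set_coord rs f u z : regular (size rs) f -> f (set_coord u (size rs).+3 z) = f u.
Proof.
by move=> [e oe he]; rewrite !he (ev_set_coord _ _ _ (tower_var (size rs)))// tower_var_fresh.
Qed.

(** Let f and f' be the values on the two sheets s and -s.  The functions
    f^m + f'^m and f f' are polynomials in a, b and s^2 = q, so they live on the
    lower level and the induction hypothesis bounds them. *)
Lemma center_le_step rs (q : pexp) : vars_in_rels rs -> vars_in (tower_var (size rs)) q -> center_le rs ->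
  center_le (newrs rs q).
Proof.
move=> ors oq ih f; rewrite size_newrs; set k := size rs => pf M M0 hb u Yu u0.
have [a [b [pa pb hab]]] := regular_decomp _ _ _ oq pf.
have pq := regular_ev _ _ oq.
have powers m : exists A B, [/\ regular k A, regular k B & forall (x : pt) (s : C),
    s ^+ 2 = ev x q -> (a x + b x * s) ^+ m = A x + B x * s].
  elim: m => [|m [A [B [pA pB h]]]].
    exists (fun=> 1), (fun=> 0); split => [||x s _]; [exact: regular_cst|exact: regular_cst|].
    by rewrite expr0 mul0r addr0.
  exists (fun x => a x * A x + b x * B x * ev x q), (fun x => a x * B x + b x * A x).
  split; [|apply: regular_add; exact: regular_mul|].
    by apply: regular_add; [|apply: regular_mul => //]; exact: regular_mul.
  by move=> x s hs; rewrite exprS (h _ s)// -hs; ring.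
have [Yu1 hs] := (curve_newrs rs q u).1 Yu.
have fE x s : curve rs x -> s ^+ 2 = ev x q ->
    curve (newrs rs q) (set_coord x k.+3 s) /\ f (set_coord x k.+3 s) = a x + b x * s.
  move=> Yx hxs; have Yn := curve_extend _ _ _ _ ors oq Yx hxs.
  split => //; have [_ h2] := (curve_newrs _ _ _).1 Yn.
  by rewrite hab// !regular_set_coord// /set_coord eqxx.
have bnd x s : curve rs x -> cmod (x 0%N) = 1 -> s ^+ 2 = ev x q -> cmod (a x + b x * s) <= M.
  by move=> Yx x1 hxs; have [Yn <-] := fE _ _ Yx hxs; apply: hb.
rewrite hab//; apply: (powers_bound _ (a u + b u * - u k.+3) _ M0) => [m|].
  have [A [B [pA pB hAB]]] := powers m.
  rewrite !hAB ?sqrrN//.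
  rewrite (_ : _ + _ = 2 * A u); last by ring.
  apply: (ih (fun x => 2 * A x)) => //; first by apply: regular_mul => //; exact: regular_cst.
    by rewrite mulr_ge0// exprn_ge0.
  move=> x Yx x1; pose s := sqrtC (ev x q); have s2 : s ^+ 2 = ev x q by rewrite sqrtCK.
  have -> : 2 * A x = (a x + b x * s) ^+ m + (a x + b x * - s) ^+ m.
    by rewrite !hAB ?sqrrN//; ring.
  apply: le_trans (cmodD_le _ _) _; rewrite !cmodX mulr_natl mulr2n.
  by apply: lerD; rewrite lerXn2r ?nnegrE ?cmod_ge0// bnd// sqrrN.
rewrite (_ : _ * _ = a u * a u - b u * b u * ev u q); last by rewrite -hs; ring.
apply: (ih (fun x => a x * a x - b x * b x * ev x q)) => //.
- by apply: regular_sub; [|apply: regular_mul => //]; exact: regular_mul.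
- by rewrite exprn_ge0.
move=> x Yx x1; pose s := sqrtC (ev x q); have s2 : s ^+ 2 = ev x q by rewrite sqrtCK.
rewrite (_ : _ - _ = (a x + b x * s) * (a x + b x * - s)); last by rewrite -s2; ring.
by rewrite cmodM expr2; apply: ler_pM; rewrite ?cmod_ge0// bnd// sqrrN.
Qed.

End MaximumPrinciple.

(** * A dense sequence of polynomial functions *)

Section Enumeration.
Context {R : realType}.
Local Notation C := R[i].
Local Notation pexp := (pexp R).
Local Notation tree := (GenTree.tree (rat * rat + nat)%type).

(** Trees are used because they form a countable type: the image consists of the
    expressions with coefficients in Q(i). *)
Fixpoint exp_of_tree (t : tree) : pexp :=
  match t with
  | GenTree.Leaf (inl ab) => Cst (ratr ab.1 +i* ratr ab.2)
  | GenTree.Leaf (inr i) => Var i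
  | GenTree.Node 0 [:: a; b] => Add (exp_of_tree a) (exp_of_tree b)
  | GenTree.Node _ [:: a; b] => Mul (exp_of_tree a) (exp_of_tree b)
  | _ => Cst 0
  end.

Lemma cmod_ReIm (a b : R) : cmod (a +i* b) <= `|a| + `|b|.
Proof.
have -> : a +i* b = a%:C + (0 +i* b).
  by apply/eqP; rewrite eq_complex /= addr0 add0r !eqxx.
apply: le_trans (cmodD_le _ _) _.
by rewrite /= expr0n /= addr0 add0r !sqrtr_sqr.
Qed.

Lemma rat_near (x e : R) : 0 < e -> exists q : rat, `|x - ratr q| <= e.
Proof.
move=> e0; have [|q] := @rat_in_itvoo R (x - e) (x + e); first by lra.
by rewrite in_itv /= => /andP[h1 h2]; exists q; rewrite ler_norml; apply/andP; split; lra.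
Qed.

Lemma exp_of_tree_dense (P : pred nat) (B : R) (e : pexp) : vars_in P e -> forall d : R, 0 < d ->
  exists2 t, vars_in P (exp_of_tree t) & forall u, (forall i, P i -> cmod (u i) <= B) ->
    cmod (ev u e - ev u (exp_of_tree t)) <= d.
Proof.
elim: e => [[a b] _|i Pi|a iha b ihb /= /andP[/iha ha /ihb hb]|
    a iha b ihb /= /andP[oa ob]] d d0.
- have d20 : 0 < d / 2 by rewrite divr_gt0.
  have [x hx] := rat_near a _ d20; have [y hy] := rat_near b _ d20.
  exists (GenTree.Leaf (inl (x, y))) => //= u _.
  by apply: le_trans (cmod_ReIm (a - ratr x) (b - ratr y)) _; lra.
- exists (GenTree.Leaf (inr i)) => //= u _.
  by rewrite subrr Normc.normc0 ltW.
- have d20 : 0 < d / 2 by rewrite divr_gt0.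
  have [t ot ht] := ha _ d20; have [s os hs] := hb _ d20.
  exists (GenTree.Node 0 [:: t; s]) => /= [|u hu]; first by rewrite ot.
  rewrite opprD addrACA; apply: le_trans (cmodD_le _ _) _.
  by have := ht u hu; have := hs u hu; lra.
have [M M0 hM] := ev_bound _ _ B oa; have [N N0 hN] := ev_bound _ _ B ob.
pose d' := Num.min 1 (d / (M + N + 1)).
have S0 : 0 < M + N + 1 by rewrite !addr_gt0.
have d'0 : 0 < d' by rewrite lt_min ltr01 divr_gt0.
have d'1 : d' <= 1 by rewrite ge_min lexx.
have d'd : d' * (M + N + 1) <= d by rewrite -ler_pdivlMr// ge_min lexx orbT.
have [t ot ht] := iha oa _ d'0; have [s os hs] := ihb ob _ d'0.
exists (GenTree.Node 1 [:: t; s]) => /= [|u hu]; first by rewrite ot.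
apply: le_trans (cmod_subM _ _ _ _) _.
have h1 := ht u hu; have h2 := hs u hu.
have h3 : cmod (ev u (exp_of_tree s)) <= N + 1.
  by rewrite cmod_distC in h2; have := cmod_near _ _ _ h2; have := hN u hu; lra.
have h4 : cmod (ev u a) * cmod (ev u b - ev u (exp_of_tree s)) <= M * d'.
  by apply: ler_pM; rewrite ?cmod_ge0// hM.
have h5 : cmod (ev u a - ev u (exp_of_tree t)) * cmod (ev u (exp_of_tree s)) <= d' * (N + 1).
  by apply: ler_pM; rewrite ?cmod_ge0.
lra.
Qed.

Definition enum_pexp (n : nat) : pexp :=
  if (unpickle n : option (nat * tree)) is Some (_, t) then exp_of_tree t else Cst 0.

Lemma inj_unbounded (g : nat -> nat) N : injective g -> exists m, (N <= g m)%N.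
Proof.
move=> inj; apply: contrapT => h.
have us : uniq [seq g i | i <- iota 0 N.+1] by rewrite map_inj_uniq// iota_uniq.
have : {subset [seq g i | i <- iota 0 N.+1] <= iota 0 N}.
  move=> x hx; rewrite mem_iota add0n /= ltnNge; apply/negP => Nx; apply: h.
  by have [i _ e] := seq.mapP hx; exists i; rewrite -e.
by move=> /(uniq_leq_size us); rewrite size_map !size_iota ltnn.
Qed.

(** Recurrence matters: an expression can only be used at a stage where all its
    variables are already available, and with an arbitrarily small error term. *)
Lemma enum_pexp_often t N : exists2 n, (N <= n)%N & enum_pexp n = exp_of_tree t.
Proof.
have [|m hm] := inj_unbounded (fun m => pickle (m, t)) N.
  by move=> a b /(pcan_inj pickleK) [].
by exists (pickle (m, t)) => //; rewrite /enum_pexp pickleK.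
Qed.

End Enumeration.

(** * One stage of the construction *)

Section Stages.
Context {R : realType}.
Local Notation C := R[i].
Local Notation pexp := (pexp R).
Local Notation pt := (nat -> C).
Implicit Types (rs : seq pexp) (f : pt -> C) (u : pt).

Lemma unitmod_mul rs D f g : vars_in (tower_var (size rs)) D -> unitmod rs D f -> unitmod rs D g ->
  regular (size rs) f -> regular (size rs) g -> unitmod rs D (fun u => f u * g u).
Proof.
move=> oD [x [y [px py h]]] [x' [y' [px' py' h']]] pf pg; have pD := regular_ev _ _ oD.
exists (fun u => x u * x' u).
exists (fun u => x u * f u * y' u + y u * (x' u * g u) + y u * y' u * ev u D); split.
- exact: regular_mul.
- by do ![exact: px|exact: py|exact: pf|exact: pg|exact: px'|exact: py'|exact: pD|
    apply: regular_add|apply: regular_mul].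
move=> u Yu; transitivity ((x u * f u + y u * ev u D) * (x' u * g u + y' u * ev u D)); first ring.
by rewrite h// h'// mulr1.
Qed.

Lemma unitmod_scale rs D f (a : C) : a != 0 -> unitmod rs D f ->
  unitmod rs D (fun u => a * f u).
Proof.
move=> a0 [x [y [px py h]]]; exists (fun u => a^-1 * x u), y; split => //.
  by apply: regular_mul => //; exact: regular_cst.
by move=> u Yu; rewrite mulrACA mulVf// mul1r h.
Qed.

Lemma unitmod_ext rs D f g : unitmod rs D f -> (forall u, g u = f u) -> unitmod rs D g.
Proof. by move=> [x [y [px py h]]] e; exists x, y; split => // u Yu; rewrite e h. Qed.

(** rels are the equations z_j^2 = q_j, (wmap, vmap) the two functions that complete
    z0 to a map to C^3, dir the direction th in which the next tower coordinate will
    be added, and ram a function that kills the differentials. *)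
Record stage := Stage { rels : seq pexp; wmap : pexp; vmap : pexp; dir : C; ram : pexp; budget : R }.

Notation lev s := (size (rels s)).

(** budget bounds the total displacement of (w, v) at all later stages; what is
    recovered at this stage therefore remains recovered in the limit. *)
Definition recoverable (s : stage) := exists2 Z : nat -> pexp, (forall j, vars_in space_var (Z j)) &
  forall u, curve (rels s) u -> forall p1 p2, near_curve (wmap s) (vmap s) u (2 * budget s) p1 p2 ->
    forall j, (j < lev s)%N ->
      cmod (ev (triple (u 0%N) p1 p2) (Z j) - u j.+3) <= (1 / 2) ^+ lev s.

Record stage_inv (s : stage) : Prop := StageInv {
  inv_ok : vars_in_rels (rels s);
  inv_w : vars_in (tower_var (lev s)) (wmap s);
  inv_v : vars_in (tower_var (lev s)) (vmap s);
  inv_D : vars_in (tower_var (lev s)) (ram s);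
  inv_bd : bounded_curve (rels s);
  inv_cyc : cyclicD (rels s) (wmap s) (vmap s) (dir s);
  inv_ann : annD (rels s) (ram s);
  inv_fin : finD (rels s) (fun u => ev u (ram s));
  inv_rep : finrep (rels s);
  inv_dec : decodable (rels s) (wmap s) (vmap s);
  inv_cen : center_le (rels s);
  inv_bud : 0 < budget s;
  inv_rec : recoverable s }.

(** The function that receives an approximate square root at stage k. *)
Definition target k : pexp := if vars_in (tower_var k) (enum_pexp k : pexp) then enum_pexp k else Cst 0.

Lemma vars_in_target k : vars_in (tower_var k) (target k).
Proof. by rewrite /target; case: ifP. Qed.

Definition stage_next (s s' : stage) : Prop := exists q (lam c : C),
  [/\ q = Add (target (lev s)) (Cst lam) /\ cmod lam <= (1 / 2) ^+ lev s,
      rels s' = newrs (rels s) q, 0 < budget s' /\ budget s' <= budget s / 2,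
      wmap s' = neww (rels s) (wmap s) c /\ vmap s' = newv (rels s) (vmap s) (dir s) c &
      forall u, curve (rels s') u -> cmod (c * u (lev s).+3) <= budget s / 2 /\
        cmod (c * dir s * u (lev s).+3) <= budget s / 2].

Definition stage0 := Stage [::] (Cst 0) (Cst 0) 0 (Cst 1) 1.

Lemma stage_inv0 : stage_inv stage0.
Proof.
split => //=.
- exists 1 => u [u0 _] i /orP[/eqP -> //|/andP[]].
  by case: i => [|[|[|i]]].
- by exists 1; [exact: oner_neq0|exists (fun=> 1); [exact: regular_cst|
    move=> u _; rewrite hornerC /= mulr1]].
- exact: finrep0.
- exists 1, 1; split => // e e0; exists (fun=> Cst 0).
  by split => // u _; split => [j|a b c d _ _ j].
- exact: center_le0.
- by exists (fun=> Cst 0).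
Qed.

Lemma inv_nat_small (e : R) : 0 < e -> exists n0 : nat, forall n, (n0 <= n)%N ->
  cmod (n.+1%:R^-1 : C) <= e.
Proof.
move=> e0; exists (Num.bound e^-1) => n hn.
rewrite Normc.normcV cmod_nat invf_ple ?posrE//.
apply: le_trans (_ : (Num.bound e^-1)%:R <= _); last by rewrite ler_nat; exact: leqW.
by apply/ltW/archi_boundP; rewrite invr_ge0 ltW.
Qed.

Lemma recoverable_ex rs w v : decodable rs w v -> forall b0 : R, 0 < b0 ->
  exists2 b : R, 0 < b <= b0 & forall th D, recoverable (Stage rs w v th D b).
Proof.
move=> [K [r [K0 r0 hZ]]] b0 b00; set k := size rs.
have e0 : 0 < (1 / 2 : R) ^+ k / 2 by rewrite divr_gt0// exprn_gt0.
pose b := Num.min b0 (Num.min (r / 2) ((1 / 2) ^+ k / (8 * K))).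
have bp : 0 < b by rewrite !lt_min b00 !divr_gt0// ?exprn_gt0// mulr_gt0.
exists b; first by rewrite bp ge_min lexx.
move=> th D; have [Z [oZ h]] := hZ _ e0; exists Z => //= u Yu p1 p2 hp j hj.
have br : 2 * b <= r.
  have : b <= r / 2 by rewrite !ge_min lexx orbT.
  lra.
have bK : K * (4 * b) <= (1 / 2) ^+ k / 2.
  have : b * (8 * K) <= (1 / 2) ^+ k.
    by rewrite -ler_pdivlMr ?mulr_gt0// !ge_min lexx !orbT.
  lra.
have [h1 h2] := h u Yu; have [hp1 hp2] := hp.
have np : near_curve w v u r p1 p2 by split; apply: le_trans br.
have nc : near_curve w v u r (ev u w) (ev u v) by rewrite /near_curve !subrr Normc.normc0 ltW.
have h3 := h1 _ hj; have h4 := h2 _ _ _ _ np nc _ hj.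
have h5 : K * dist2 p1 p2 (ev u w) (ev u v) <= K * (4 * b).
  by rewrite ler_pM2l// /dist2; move: hp1 hp2 => /=; lra.
rewrite -[X in X - _](subrK (ev (triple (u 0%N) (ev u w) (ev u v)) (Z j))) -addrA.
by apply: le_trans (cmodD_le _ _) _; rewrite -/k; lra.
Qed.

(** Three generic choices.  The constant lam makes q invertible modulo ram, so that
    old and new ramification are disjoint.  The next direction th - tau makes
    1 + tau om invertible modulo ram, that is, transversal to the curve over the
    old ramification.  Then the constant term in c of the product of
    E = 2 s (1 + tau om) + c tau kap with its conjugate is invertible modulo ram, and
    so is E for a generic small c. *)
Lemma stage_step s : stage_inv s -> exists2 s', stage_inv s' & stage_next s s'.
Proof.
move=> [ors ow ov oD hbd hcyc hann hfin hrep hdec hcen hbud _].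
set rs := rels s in ors ow ov oD hbd hcyc hann hfin hrep hdec hcen *.
set w := wmap s in ow hcyc hdec *; set v := vmap s in ov hcyc hdec *.
set th := dir s in hcyc *; set D := ram s in oD hann hfin *; set k := size rs.
have pc c : regular k (fun=> c) := regular_cst k c.
have nz n : (n.+1%:R : C) != 0 by rewrite pnatr_eq0.
have ph : regular k (fun u => ev u (target k)) by apply: regular_ev; exact: vars_in_target.
have [p1 p10 hp1] := generic_unit _ _ _ hrep hfin ph.
have [p2 p20 hp2] := generic_fin _ _ hrep ph.
have [n0 hn0] := inv_nat_small _ (exprn_gt0 k (divr_gt0 ltr01 (ltr0Sn R 1))).
have [||n hn] := nonroot_seq (p1 * p2) (fun n => n.+1%:R^-1) n0.
- by move=> a b /invr_inj/eqP; rewrite eqr_nat eqSS => /eqP.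
- by rewrite mulf_neq0.
rewrite hornerM mulf_eq0 negb_or => /andP[hl1 hl2].
set lam : C := n.+1%:R^-1 in hl1 hl2.
pose q : pexp := Add (target k) (Cst lam).
have oq : vars_in (tower_var k) q by rewrite /= vars_in_target.
have pq := regular_ev _ _ oq; have pD := regular_ev _ _ oD.
have uq : unitmod rs D (fun u => ev u q) := hp1 _ hl1.
have fq : finD rs (fun u => ev u q) := hp2 _ hl2.
have [om [eom oom hom] Iom] := cyclicD_diff _ _ _ _ _ hcyc ow.
have pom : regular k om by exists eom.
have [p3 p30 hp3] := generic_unit _ _ _ hrep hfin pom.
have [||n3 _ hn3] := nonroot_seq p3 (fun n => n.+1%:R) 0%N => //.
  by move=> a b /eqP; rewrite eqr_nat eqSS => /eqP.
pose tau : C := n3.+1%:R^-1; have tau0 : tau != 0 by rewrite invr_neq0.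
have utau : unitmod rs D (fun u => om u + tau^-1) by rewrite /tau invrK; exact: hp3.
have ptau : regular k (fun u => om u + tau^-1) by apply: regular_add.
have [kap pkap Ikap] := cyclicD_diff _ _ _ _ _ hcyc oq.
have : unitmod rs D (fun u => 4 * ev u q * (1 + tau * om u) ^+ 2).
  have u4 : (4 : C) * tau ^+ 2 != 0.
    by rewrite mulf_neq0 ?expf_neq0// (nz 3%N).
  apply: unitmod_ext (unitmod_scale _ _ _ _ u4 (unitmod_mul _ _ _ _ oD uq
    (unitmod_mul _ _ _ _ oD utau utau ptau ptau) pq (regular_mul _ _ _ ptau ptau))) _.
  by move=> u; field; exact: tau0.
move=> [x [y [px py hxy]]].
have pf : regular k (fun u => tau ^+ 2 * kap u ^+ 2 * x u).
  by apply: regular_mul => //; apply: regular_mul => //; exact: regular_exp.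
have [p4 p40 hp4] := generic_unit _ _ _ hrep hfin pf.
have [mu pmu hmu] := Iom.
have /choice[emu hemu] : forall l, exists e, vars_in (tower_var k) e /\ forall u, mu l u = ev u e.
  by move=> l; have [e oe he] := pmu l; exists e.
have htr : transversal rs w v th.
  apply: (transversal_normal rs w v eom emu th) => //.
  - by move=> l; exact: (hemu l).1.
  - move=> u Yu j hj; rewrite -hom hmu//; apply: eq_bigr => l _.
    by rewrite (hemu l).2.
have [c0 c00 hc0] := decodable_step rs w v q th oq hbd hdec htr.
have [M [M0 hM]] : exists M : R, 0 < M /\ forall u, curve (newrs rs q) u -> cmod (u k.+3) <= M.
  have [B hB] := bounded_step rs q oq hbd; exists (`|B| + 1); split; first by rewrite ltr_wpDl.
  move=> u /hB /(_ k.+3); rewrite size_newrs => /(_ (tower_var_var _ _ (ltnSn _))).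
  by have := ler_norm B; lra.
pose e := Num.min c0 (budget s / (2 * M * (1 + cmod th))).
have T1 : 0 < 1 + cmod th by rewrite ltr_pwDl ?cmod_ge0.
have e0 : 0 < e by rewrite lt_min c00 divr_gt0// !mulr_gt0.
have [m0 hm0] := inv_nat_small _ e0.
have [||n4 hn4 hn4'] := nonroot_seq p4 (fun n => - (n.+1%:R ^+ 2)) m0 => //.
  move=> a b /oppr_inj/eqP; rewrite -!natrX eqr_nat eqn_exp2r// eqSS => /eqP //.
pose c : C := n4.+1%:R^-1; have cn0 : c != 0 by rewrite invr_neq0.
have ce : cmod c <= e := hm0 _ hn4.
have cc0 : cmod c <= c0 by apply: le_trans ce _; rewrite ge_min lexx.
have cb : cmod c * M * (1 + cmod th) <= budget s / 2.
  have : cmod c <= budget s / (2 * M * (1 + cmod th)).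
    by apply: le_trans ce _; rewrite ge_min lexx orbT.
  by rewrite ler_pdivlMr ?mulr_gt0//; lra.
have [x4 [y4 [px4 py4 hxy4]]] := hp4 _ hn4'.
pose rs' := newrs rs q; have k1 : size rs' = k.+1 := size_newrs rs q.
(* the inverse of E is its conjugate divided by their product *)
pose sg u := x4 u * c^-2 * x u * (c * tau * kap u - 2 * u k.+3 * (1 + tau * om u)).
pose t u := y4 u - x4 u * c^-2 * y u.
have ps : regular k.+1 (fun u => u k.+3) by exact: regular_var.
have psg : regular k.+1 sg.
  have pc' a : regular k.+1 (fun=> a) := regular_cst k.+1 a.
  have := regular_S _ _ px4; have := regular_S _ _ px; have := regular_S _ _ pkap.
  have := regular_S _ _ pom; rewrite /sg => h1 h2 h3 h4.
  by do ![exact: h1|exact: h2|exact: h3|exact: h4|exact: pc'|exact: ps|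
    apply: regular_sub|apply: regular_add|apply: regular_mul].
have pt' : regular k.+1 t.
  apply: regular_S; apply: regular_sub => //; apply: regular_mul => //; exact: regular_mul.
have hbez u : curve rs' u -> sg u * (2 * u k.+3 * (1 + tau * om u) + c * tau * kap u) +
    t u * ev u D = 1.
  move=> /curve_newrs[Yu s2]; have e1 := hxy _ Yu; have e2 := hxy4 _ Yu.
  have c3 : c ^+ 2 * c^-2 = 1 by rewrite mulfV// expf_neq0.
  have c2 : c^-2 = n4.+1%:R ^+ 2 by rewrite /c exprVn invrK.
  rewrite -s2 in e1; rewrite /sg /t.
  transitivity (x4 u * x u * tau ^+ 2 * kap u ^+ 2 * (c ^+ 2 * c^-2) - x4 u * c^-2 *
    (x u * (4 * u k.+3 ^+ 2 * (1 + tau * om u) ^+ 2) + y u * ev u D) + y4 u * ev u D).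
    ring.
  by rewrite e1 c3 c2 -[RHS]e2; ring.
have hcyc' : cyclicD rs' (neww rs w c) (newv rs v th c) (th - tau).
  by apply: (cyclicD_step _ _ _ D _ _ _ _ _ _ _ _ om kap sg t).
have hdec' := hc0 c cn0 cc0.
have b20 : 0 < budget s / 2 by rewrite divr_gt0.
have [b /andP[b0 bb] hrec] := recoverable_ex _ _ _ hdec' _ b20.
exists (Stage rs' (neww rs w c) (newv rs v th c) (th - tau) (newD rs D) b).
  split; rewrite /= ?k1 //.
  - exact: vars_in_newrs.
  - exact: vars_in_neww.
  - exact: vars_in_newv.
  - exact: vars_in_newD.
  - exact: bounded_step.
  - exact: annD_step.
  - have [D1 D10 [g1 pg1 hg1]] := fq; have [D2 D20 [g2 pg2 hg2]] := hfin.
    exists (D1 * D2); first by rewrite mulf_neq0.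
    exists (fun u => 2^-1 * u k.+3 * g1 u * g2 u).
      rewrite k1; apply: regular_mul; last exact: regular_S.
      apply: regular_mul; last exact: regular_S.
      by apply: regular_mul => //; exact: regular_cst.
    move=> u /curve_newrs[Yu s2]; rewrite hornerM hg1// hg2// -s2 /= -/k.
    by field.
  - exact: finrep_step.
  - exact: center_le_step.
exists q, lam, c; split => //=.
  by split => //; exact: hn0.
move=> u Yu; have sM := hM u Yu; rewrite !cmodM.
have h1 : cmod c * cmod (u k.+3) <= cmod c * M by rewrite ler_wpM2l ?cmod_ge0.
have cM0 : 0 <= cmod c * M by rewrite mulr_ge0 ?cmod_ge0 ?ltW.
have h2 : cmod c * cmod th * cmod (u k.+3) <= cmod c * cmod th * M.
  by rewrite ler_wpM2l ?mulr_ge0 ?cmod_ge0.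
have h3 : 0 <= cmod c * cmod th * M by rewrite !mulr_ge0 ?cmod_ge0 ?ltW.
by move: h1 h2 cb; split; lra.
Qed.

End Stages.

(** * The limit of the tower *)

Section Conversion.
Context {R : realType}.
Local Notation C := R[i].
Local Notation pexp := (pexp R).
Implicit Types (x : 'rV[C]_3).

Definition coords x : nat -> C := triple (x ord0 0) (x ord0 1) (x ord0 2%:R).

Lemma trxE x (i : 'I_3) : coords x i = x ord0 i.
Proof.
by case: i => -[|[|[|i]]] hi //=; congr (x ord0 _); exact: val_inj.
Qed.

Lemma pexp_mpoly (e : pexp) : vars_in space_var e ->
  exists p : mpoly.mpoly 3 C, forall x, peval p x = ev (coords x) e.
Proof.
elim: e => [c _|i hi|a iha b ihb /= /andP[/iha[p hp] /ihb[q hq]]|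
   a iha b ihb /= /andP[/iha[p hp] /ihb[q hq]]].
- by exists (mpoly.mpolyC 3 c) => x; rewrite /peval mpoly.mevalC.
- exists (mpoly.mpolyX _ (mpoly.mnm1 (Ordinal hi))) => x.
  by rewrite /peval mpoly.mevalXU -(trxE x (Ordinal hi)).
- by have [r hr] := peval_add p q; exists r => x; rewrite hr hp hq.
- by have [r hr] := peval_mul p q; exists r => x; rewrite hr hp hq.
Qed.

Lemma mpoly_pexp (p : mpoly.mpoly 3 C) :
  exists2 e : pexp, vars_in space_var e & forall x, peval p x = ev (coords x) e.
Proof.
have pw i n : (i < 3)%N -> exists2 e : pexp, vars_in space_var e & forall u, ev u e = u i ^+ n.
  move=> hi; elim: n => [|n [e oe he]]; first by exists (Cst 1).
  by exists (Mul (Var i) e) => [|u] /=; rewrite ?oe ?andbT// he exprS.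
elim/mpoly.mpolyind: p => [|c m p _ _ [e oe he]].
  by exists (Cst 0) => // x; rewrite /peval mpoly.meval0.
pose ms (i : 'I_3) := mpoly.fun_of_multinom m i.
have [e' oe' he'] : exists2 e' : pexp, vars_in space_var e' &
    forall x, ev (coords x) e' = \prod_(i < 3) x ord0 i ^+ ms i.
  elim: (index_enum 'I_3) => [|i s [e1 oe1 he1]].
    by exists (Cst 1) => // x; rewrite big_nil.
  have [e2 oe2 he2] := pw i (ms i) (ltn_ord i).
  by exists (Mul e2 e1) => [|x] /=; rewrite ?oe2// big_cons he1 he2 trxE.
exists (Add (Mul (Cst c) e') e) => [|x] /=; first by rewrite oe'.
by rewrite /peval mpoly.mevalD mpoly.mevalZ mpoly.mevalX he' -he.
Qed.

End Conversion.

Section Limit.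
Context {R : realType}.
Local Notation C := R[i].
Local Notation pexp := (pexp R).
Local Notation pt := (nat -> C).
Local Notation lev s := (size (rels s)).
Implicit Types (u : pt) (x : 'rV[C]_3).

Lemma stage_sequence : exists st : nat -> @stage R, st 0%N = stage0 /\
  forall n, stage_inv (st n) /\ stage_next (st n) (st n.+1).
Proof.
have stp (s : {s : @stage R | stage_inv s}) : {s' : {s : @stage R | stage_inv s} | stage_next (sval s) (sval s')}.
  apply: cid; case: s => s hs; have [s' hs' h] := stage_step _ hs.
  by exists (exist _ s' hs').
have [f [f0 hf]] := dependent_choice stp (exist _ _ (@stage_inv0 R)).
exists (fun n => sval (f n)); rewrite f0; split=> // n; split; last exact: hf.
exact: (svalP (f n)).
Qed.

(** The intervals [a n - b n, a n + b n] are nested. *)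
Lemma nested_limit (a b : nat -> R) : (forall n, 0 < b n) ->
  (forall n, b n.+1 <= b n / 2) -> (forall n, `|a n.+1 - a n| <= b n / 2) ->
  exists x : R, forall n, `|x - a n| <= b n.
Proof.
move=> b0 hb ha.
have lo m n : a m - b m <= a (m + n)%N - b (m + n)%N.
  elim: n => [|n ih]; first by rewrite addn0.
  rewrite addnS; apply: le_trans ih _.
  by have := ha (m + n)%N; have := hb (m + n)%N; rewrite ler_norml => ? /andP[]; lra.
have up m n : a (m + n)%N + b (m + n)%N <= a m + b m.
  elim: n => [|n ih]; first by rewrite addn0.
  rewrite addnS; apply: le_trans ih.
  by have := ha (m + n)%N; have := hb (m + n)%N; rewrite ler_norml => ? /andP[]; lra.
have lu m n : a m - b m <= a n + b n.
  have := lo m n; have := up n m; rewrite (addnC n); have := b0 (m + n)%N; lra.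
pose S := range (fun n => a n - b n).
exists (sup S) => n.
have h1 : a n - b n <= sup S.
  by apply: ub_le_sup; [exists (a 0%N + b 0%N) => _ [m _ <-]; exact: lu|exists n].
have h2 : sup S <= a n + b n.
  by apply: ge_sup; [exists (a n - b n); exists n|move=> _ [m _ <-]; exact: lu].
by rewrite ler_norml; apply/andP; split; lra.
Qed.

Lemma cmod_Re (z : C) : `|complex.Re z| <= cmod z.
Proof. by rewrite -lecR -cmodE; exact: normc_ge_Re. Qed.

Lemma cmod_Im (z : C) : `|complex.Im z| <= cmod z.
Proof.
have := cmod_Re (- 'i * z); rewrite cmodM (_ : cmod (- 'i) = 1) ?mul1r.
  case: z => a b; rewrite (_ : complex.Re (- 'i * (a +i* b)) = b)//.
  by rewrite /=; ring.
by rewrite /= oppr0 expr0n /= add0r sqrrN expr1n sqrtr1.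
Qed.

Lemma nested_limitC (a : nat -> C) (b : nat -> R) : (forall n, 0 < b n) ->
  (forall n, b n.+1 <= b n / 2) -> (forall n, cmod (a n.+1 - a n) <= b n / 2) ->
  exists z : C, forall n, cmod (z - a n) <= 2 * b n.
Proof.
move=> b0 hb ha.
have [|x hx] := nested_limit (fun n => complex.Re (a n)) b b0 hb.
  by move=> n; rewrite -raddfB; apply: le_trans (cmod_Re _) (ha n).
have [|y hy] := nested_limit (fun n => complex.Im (a n)) b b0 hb.
  by move=> n; rewrite -raddfB; apply: le_trans (cmod_Im _) (ha n).
exists (x +i* y) => n; have := hx n; have := hy n; case: (a n) => c d /= h1 h2.
apply: le_trans (cmod_ReIm (x - c) (y - d)) _; lra.
Qed.

Context (st : nat -> @stage R) (st0 : st 0%N = stage0).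
Context (ist : forall n, stage_inv (st n)) (nst : forall n, stage_next (st n) (st n.+1)).

Local Notation rs n := (rels (st n)).

Lemma lev_st n : lev (st n) = n.
Proof.
elim: n => [|n ih]; first by rewrite st0.
by have [q [lam [c [_ -> _ _ _]]]] := nst n; rewrite size_newrs ih.
Qed.

Lemma bud_pos n : 0 < budget (st n).
Proof. exact: (inv_bud _ (ist n)). Qed.

Lemma bud_half n : budget (st n.+1) <= budget (st n) / 2.
Proof. by have [q [lam [c [_ _ [_ ->] _ _]]]] := nst n. Qed.

Lemma bud_small n : budget (st n) <= (1 / 2) ^+ n.
Proof.
elim: n => [|n ih]; first by rewrite st0.
by have := bud_half n; rewrite exprS; lra.
Qed.

Definition tower_limit : set pt := [set u | forall n, curve (rs n) u].

(* x = (z0, w, v) evaluated at the point u of the inverse limit *)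
Definition over u x := x ord0 0 = u 0%N /\
  forall n, near_curve (wmap (st n)) (vmap (st n)) u (2 * budget (st n)) (x ord0 1) (x ord0 2%:R).

Lemma over_ex u : tower_limit u -> exists x, over u x.
Proof.
move=> hu.
have hw n : cmod (ev u (wmap (st n.+1)) - ev u (wmap (st n))) <= budget (st n) / 2 /\
    cmod (ev u (vmap (st n.+1)) - ev u (vmap (st n))) <= budget (st n) / 2.
  have [q [lam [c [_ e1 _ [-> ->] h]]]] := nst n; rewrite /=.
  by rewrite [X in cmod X]addrC addKr [X in _ /\ cmod X <= _]addrC addKr; exact: h.
have [a ha] := nested_limitC _ _ bud_pos bud_half (fun n => (hw n).1).
have [b hb] := nested_limitC _ _ bud_pos bud_half (fun n => (hw n).2).
exists (\row_j triple (u 0%N) a b j); split; first by rewrite mxE.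
by move=> n; rewrite /near_curve !mxE.
Qed.

Lemma over_bound u x (i : 'I_3) : tower_limit u -> over u x -> cmod (x ord0 i) <= 2.
Proof.
move=> hu [x0 hx]; have [h1 h2] := hx 0%N; have [u0 _] := hu 0%N.
rewrite -trxE /coords; case: i => -[|[|[|i]]] hi //=.
- by rewrite x0; lra.
- by move: h1; rewrite st0 /= subr0; lra.
- by move: h2; rewrite st0 /= subr0; lra.
Qed.

(** On level n replace the limit functions by w_n and v_n; the error is at most a
    multiple of the budget of that level. *)
Lemma level_approx (p : mpoly.mpoly 3 C) (d : R) : 0 < d -> exists n (e : pexp),
  vars_in (tower_var n) e /\ forall u x, tower_limit u -> over u x ->
    cmod (peval p x - ev u e) <= d.
Proof.
move=> d0; have [P oP hP] := mpoly_pexp p.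
have [L L0 hL] := ev_lip 3 P 4 oP.
have [n hn] := halves_small (4 * L) d d0.
pose sg i : pexp := match i with 0 => Var 0 | 1 => wmap (st n) | _ => vmap (st n) end%N.
exists n, (psubst sg P); split.
  apply: vars_in_psubst oP _ => -[|[|[|i]]] //= _.
    by have := inv_w _ (ist n); rewrite lev_st.
  by have := inv_v _ (ist n); rewrite lev_st.
move=> u x hu ov; rewrite hP ev_psubst.
have hb : forall i, (i < 3)%N -> cmod (coords x i) <= 2.
  by move=> i hi; have := over_bound _ _ (Ordinal hi) hu ov; rewrite -trxE.
have [x0 hx] := ov; have [h1 h2] := hx n.
have bn := bud_small n; have b1 : (1 / 2 : R) ^+ n <= 1 by rewrite exprn_ile1//; lra.
have b0 := bud_pos n.
have ws : cmod (ev u (wmap (st n))) <= 4.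
  by rewrite cmod_distC in h1; have := cmod_near _ _ _ h1; have := hb 1%N isT; rewrite /=; lra.
have vs : cmod (ev u (vmap (st n))) <= 4.
  by rewrite cmod_distC in h2; have := cmod_near _ _ _ h2; have := hb 2%N isT; rewrite /=; lra.
apply: le_trans (hL _ _ _ _) _.
- by move=> i /hb; lra.
- move=> [|[|[|i]]] //= _; by have [u0 _] := hu 0%N; lra.
rewrite /coord_dist (sum3 0 _ (fun i => cmod (coords x i - ev u (sg i)))) big_ord0 addr0 /=.
rewrite x0 subrr Normc.normc0 add0r.
have : L * (cmod (x ord0 1 - ev u (wmap (st n))) + cmod (x ord0 2%:R - ev u (vmap (st n)))) <=
    L * (4 * (1 / 2) ^+ n) by rewrite ler_pM2l//; lra.
lra.
Qed.

(** Approximate p by a function of some level, this one by an expression of the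
    dense sequence, and choose a stage m at which that expression recurs: there it
    equals z_m^2 up to 2^-m, and z_m is a limit of polynomials in (z0, w, v). *)
Lemma square_approx (p : mpoly.mpoly 3 C) (d : R) : 0 < d ->
  exists z : mpoly.mpoly 3 C, forall u x, tower_limit u -> over u x ->
    cmod (peval p x - peval z x ^+ 2) <= d.
Proof.
move=> d0; have d40 : 0 < d / 4 by rewrite divr_gt0.
have [n [e [oe he]]] := level_approx p _ d40.
have [B hB] := inv_bd _ (ist n); rewrite lev_st in hB.
have [t ot ht] := exp_of_tree_dense (tower_var n) B e oe _ d40.
have [P oP hP] := mpoly_pexp p; have [M M0 hM] := ev_bound space_var P 2 oP.
pose N := M + d + 1; have N1 : 1 <= N by rewrite /N; lra.
have [m0 hm0] := halves_small 1 _ d40.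
have d4N : 0 < d / 4 / (2 * N + 1) by rewrite divr_gt0//; lra.
have [m1 hm1] := halves_small 1 _ d4N.
have [m hm em] := @enum_pexp_often R t (maxn n (maxn m0 m1)).
move: hm; rewrite !geq_max => /and3P[nm m0m m1m].
have otm : vars_in (tower_var m) (exp_of_tree t : pexp).
  apply: vars_in_sub ot => i /orP[h|/andP[h1 h2]]; rewrite /tower_var ?h//.
  by rewrite h1 orbC /= (leq_trans h2)// leq_add2r.
have [Z oZ hZ] := inv_rec _ (ist m.+1).
have [z hz] := pexp_mpoly (Z m) (oZ m).
exists z => u x hu ov; rewrite hz.
have hpow k : (k <= m)%N -> (1 / 2 : R) ^+ m <= (1 / 2) ^+ k.
  by move=> hk; apply: ler_wiXn2l => //; lra.
have [q [lam [c [[qE hlam] rE _ _ _]]]] := nst m.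
rewrite lev_st in qE hlam.
have [Yum s2] : curve (rs m) u /\ u m.+3 ^+ 2 = ev u q.
  by have := hu m.+1; rewrite rE => /curve_newrs; rewrite lev_st.
have tE : target m = exp_of_tree t :> pexp by rewrite /target em otm.
have s2' : u m.+3 ^+ 2 = ev u (exp_of_tree t) + lam by rewrite s2 qE /= tE.
have hZu := hZ u (hu m.+1) _ _ (ov.2 m.+1) m; rewrite lev_st ltnSn in hZu.
have {}hZu := hZu isT; rewrite -ov.1 -[triple _ _ _]/(coords x) in hZu.
set a := ev (coords x) (Z m) in hZu *; set s := u m.+3 in hZu s2' *.
have h1 := he u x hu ov.
have h2 : cmod (ev u e - ev u (exp_of_tree t)) <= d / 4.
  by apply: ht => i hi; apply: hB => //; exact: hu.
have h3 : cmod lam <= d / 4.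
  by apply: le_trans hlam _; apply: le_trans (hpow _ m0m) _; rewrite mul1r in hm0.
have hp : cmod (peval p x) <= M.
  rewrite hP; apply: hM => i hi.
  by have := over_bound _ _ (Ordinal (hi : (i < 3)%N)) hu ov; rewrite -trxE.
have h4 : cmod (peval p x - s ^+ 2) <= 3 * (d / 4).
  rewrite s2' (_ : _ - _ = (peval p x - ev u e) + (ev u e - ev u (exp_of_tree t)) - lam); last by ring.
  apply: le_trans (cmodB_le _ _) _; have := cmodD_le (peval p x - ev u e) (ev u e - ev u (exp_of_tree t)).
  lra.
have sN : cmod s <= N.
  have : cmod s ^+ 2 <= N.
    rewrite -cmodX; rewrite cmod_distC in h4; have := cmod_near _ _ _ h4.
    by rewrite /N; lra.
  have [h|h] := leP (cmod s) 1; first by move=> _; exact: le_trans h N1.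
  by move=> h5; apply: le_trans h5; rewrite expr2 ler_peMl ?cmod_ge0 ?(ltW h).
have h5 : (1 / 2 : R) ^+ m.+1 <= (1 / 2) ^+ m by rewrite exprS ler_piMl ?exprn_ge0//; lra.
have h6 : (1 / 2 : R) ^+ m <= 1 by rewrite exprn_ile1//; lra.
have h7 : cmod (a - s) <= d / 4 / (2 * N + 1).
  apply: le_trans hZu _; apply: le_trans h5 _; apply: le_trans (hpow _ m1m) _.
  by rewrite mul1r in hm1.
have h8 : cmod (a + s) <= 2 * N + 1.
  rewrite (_ : a + s = (a - s) + (s + s)); last by ring.
  apply: le_trans (cmodD_le _ _) _; have := cmodD_le s s; lra.
have h9 : cmod (a ^+ 2 - s ^+ 2) <= d / 4.
  rewrite subr_sqr cmodM; apply: (@le_trans _ _ (d / 4 / (2 * N + 1) * (2 * N + 1))).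
    by rewrite ler_pM ?cmod_ge0.
  by rewrite divfK// gt_eqF//; lra.
rewrite (_ : _ - a ^+ 2 = (peval p x - s ^+ 2) - (a ^+ 2 - s ^+ 2)); last by ring.
by apply: le_trans (cmodB_le _ _) _; lra.
Qed.

Lemma curve_agree n u u' : curve (rs n) u -> (forall i, tower_var n i -> u i = u' i) -> curve (rs n) u'.
Proof.
move=> [u0 h] e; split=> [|l hl]; first by rewrite -e.
rewrite -(ev_ext (tower_var n) _ u) ?h//.
by have := vars_in_nth_rs _ (inv_ok _ (ist n)) _ hl; rewrite lev_st.
Qed.

Lemma tower_extend n u : curve (rs n) u -> exists2 u', tower_limit u' &
  forall i, tower_var n i -> u' i = u i.
Proof.
move=> Yu.
have /choice[q hq] : forall m, exists q, vars_in (tower_var m) q /\ rs m.+1 = newrs (rs m) q.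
  move=> m; have [q [lam [c [[qE _] rE _ _ _]]]] := nst m; exists q; split => //.
  by rewrite qE lev_st /= vars_in_target.
pose U := fix U m := if m is j.+1 then
  set_coord (U j) (n + j).+3 (sqrtC (ev (U j) (q (n + j)%N))) else u.
have YU m : curve (rs (n + m)%N) (U m).
  elim: m => [|m ih]; first by rewrite addn0.
  rewrite addnS (hq (n + m)%N).2 /=.
  have := curve_extend (rs (n + m)) (q (n + m)%N) (U m) (sqrtC (ev (U m) (q (n + m)%N))).
  rewrite lev_st; apply => //; last by rewrite sqrtCK.
    exact: (inv_ok _ (ist _)).
  exact: (hq _).1.
have stab m j i : tower_var (n + m) i -> U (m + j)%N i = U m i.
  move=> hi; elim: j => [|j ih]; first by rewrite addn0.
  rewrite addnS /= /set_coord; case: eqP => // e.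
  move: hi; rewrite e => /tower_var_lt; rewrite !ltnS addnA -[X in (_ < X)%N]addn0 ltn_add2l.
  by rewrite ltn0.
pose u' i := U i i.
have uE m i : tower_var (n + m) i -> u' i = U m i.
  move=> hi; rewrite /u'; have [mi|im] := leqP m i.
    by have := stab m (i - m)%N i hi; rewrite subnKC.
  have hi' : tower_var (n + i) i.
    move: hi; rewrite /tower_var; case: (i) => [|[|[|j]]] //= _.
    by rewrite addn3; do 2!apply: leqW; rewrite ltnS leq_addl.
  by have := stab i (m - i)%N i hi'; rewrite subnKC ?(ltnW im)// => ->.
exists u' => [m|i hi]; last by have := uE 0%N i; rewrite addn0 => ->.
have [nm|mn] := leqP n m.
  by rewrite -(subnKC nm); apply: curve_agree (YU _) _ => i hi; rewrite (uE (m - n)%N).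
have Yn : curve (rs n) u' by apply: curve_agree Yu _ => i hi; have := uE 0%N i; rewrite addn0 => ->.
have sub j : curve (rs (m + j)%N) u' -> curve (rs m) u'.
  elim: j => [|j ih]; first by rewrite addn0.
  by rewrite addnS (hq _).2 => /curve_newrs[/ih].
by apply: (sub (n - m)%N); rewrite subnKC// ltnW.
Qed.

Definition boundary0 : set 'rV[C]_3 := [set x | exists u,
  [/\ tower_limit u, cmod (u 0%N) = 1 & over u x]].

(** On a finite level the bound holds by the maximum principle, because every
    boundary point of that level extends to a boundary point of the limit. *)
Lemma center_bound (p : mpoly.mpoly 3 C) (M : R) u x : tower_limit u -> u 0%N = 0 ->
  over u x -> (forall y, boundary0 y -> cmod (peval p y) <= M) -> 0 <= M ->
  cmod (peval p x) <= M.
Proof.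
move=> hu u0 ov hM M0; apply/ler_addgt0Pr => d d0.
have d20 : 0 < d / 2 by rewrite divr_gt0.
have [n [e [oe he]]] := level_approx p _ d20.
have pe : regular (lev (st n)) (fun u => ev u e) by rewrite lev_st; exact: regular_ev.
have h1 : cmod (ev u e) <= M + d / 2.
  apply: (inv_cen _ (ist n) _ pe) => //; first by lra.
  move=> y Yy y1; have [y' hy' yE] := tower_extend _ _ Yy.
  have [z oz] := over_ex _ hy'.
  have -> : ev y e = ev y' e by apply: ev_ext oe _ => i /yE.
  have := he _ _ hy' oz; rewrite cmod_distC => /cmod_near h.
  apply: le_trans h _; rewrite lerD2r; apply: hM; exists y'; split => //.
  by rewrite yE.
have := cmod_near _ _ _ (he _ _ hu ov); lra.
Qed.

End Limit.

(** * Consequences of the density of squares *)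

Section DenseSquares.
Context {R : realType} {n : nat}.
Local Notation C := R[i].
Context (X : set 'rV[C]_n) (cX : compact X).
Implicit Types (p : mpoly.mpoly n C) (x y : 'rV[C]_n).

Definition dense_squares := forall p (d : R), 0 < d ->
  exists z, forall x, X x -> cmod (peval p x - peval z x ^+ 2) <= d.

Lemma hull_le p x (M : R) : polyhull X x -> 0 <= M ->
  (forall y, X y -> cmod (peval p y) <= M) -> cmod (peval p x) <= M.
Proof.
move=> hx M0 h; apply: le_trans (hx p) _; apply: supnorm_le => // u.
exact: (h _ (set_valP u)).
Qed.

Lemma peval_cst c : exists p, forall x, peval p x = c.
Proof. by exists (mpoly.mpolyC n c) => x; rewrite /peval mpoly.mevalC. Qed.

Lemma peval_poly (b : {poly C}) p : exists q, forall x, peval q x = b.[peval p x].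
Proof.
elim/poly_ind: b => [|b c [q hq]].
  by have [q hq] := peval_cst 0; exists q => x; rewrite hq horner0.
have [q1 h1] := peval_mul q p; have [q2 h2] := peval_cst c.
by have [r hr] := peval_add q1 q2; exists r => x; rewrite hr h1 h2 hq hornerMXaddC.
Qed.

Lemma peval_sub p q : exists r, forall x, peval r x = peval p x - peval q x.
Proof.
have [q' h'] := peval_opp q; have [r h] := peval_add p q'.
by exists r => x; rewrite h h'.
Qed.

Lemma sq_lt_cmod (a b : R) : 0 <= b -> a ^+ 2 <= b ^+ 2 -> 0 <= a -> a <= b.
Proof. by move=> b0 h a0; rewrite -(@ler_pXn2r _ 2). Qed.

Lemma small_le0 (t K : R) : 0 <= K -> (forall e : R, 0 < e -> e <= 1 -> t <= e * K) -> t <= 0.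
Proof.
move=> K0 h; rewrite leNgt; apply/negP => t0.
pose e := Num.min 1 (t / (K + 1) / 2).
have K1 : 0 < K + 1 by rewrite ltr_wpDl.
have e0 : 0 < e by rewrite lt_min ltr01 !divr_gt0.
have e1 : e <= 1 by rewrite ge_min lexx.
have h1 := h e e0 e1.
have h2 : e * (K + 1) <= t / 2.
  by rewrite -ler_pdivlMr// ge_min mulrAC lexx orbT.
lra.
Qed.

(** The error of an approximate square root is itself a polynomial, so it stays
    small on the hull. *)
Lemma sqrt_approx : dense_squares -> forall p (e : R), 0 < e ->
  exists z q, (forall y, peval q y = peval p y - peval z y ^+ 2) /\
    forall y, polyhull X y \/ X y -> cmod (peval q y) <= e.
Proof.
move=> sq p e e0; have [z hz] := sq p e e0.
have [z2 h2] := peval_mul z z; have [q hq] := peval_sub p z2.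
exists z, q; have qE y : peval q y = peval p y - peval z y ^+ 2 by rewrite hq h2 expr2.
split => // y [hy|Xy]; last by rewrite qE; exact: hz.
by apply: hull_le => //; [exact: ltW|move=> x Xx; rewrite qE; exact: hz].
Qed.

Section Derivations.
Let mk f (pf : polyalg X f) : polyalg X := SigSub (mem_set pf).
Let P p : polyalg X := mk _ (polyalg_polyfun X p).

(** If p(x) = 0 and p is close to z^2, then z(x) is small and psi(z^2), being
    2 z(x) psi(z), is small as well, since psi(z) stays bounded. *)
Lemma no_point_derivation x (psi : polyalg X -> C) : dense_squares -> polyhull X x ->
  point_derivation (point_functional X x) psi -> bounded_functional psi ->
  forall f, psi f = 0.
Proof.
move=> sq hx [lpsi dpsi] [B hB] f.
have [mphi ephi] := point_functionalP cX x hx.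
set phi := point_functional X x in dpsi mphi ephi.
have phiP p : phi (P p) = peval p x by exact: ephi.
have B0 : 0 <= `|B| by [].
have hBM (g : polyalg X) M : 0 <= M -> (forall u, cmod (\val g u) <= M) ->
    cmod (psi g) <= `|B| * M.
  move=> M0 h; apply: le_trans (hB g) _.
  apply: (@le_trans _ _ (`|B| * supnorm (\val g))).
    by rewrite ler_wpM2r ?supnorm_ge0// ler_norm.
  by rewrite ler_wpM2l// supnorm_le.
have psi_add (g h k : polyalg X) : (forall u, \val k u = \val g u + \val h u) ->
    psi k = psi g + psi h.
  move=> e; rewrite (lpsi 1 g h k) ?mul1r//; apply/funext => u.
  by rewrite e /GRing.add /= scale1r.
have psi_zero p : peval p x = 0 -> psi (P p) = 0.
  move=> px0; have [M hM] := polyfun_bounded X p cX.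
  pose N := `|M| + 2; have N1 : 1 <= N by have : 0 <= `|M| by []; rewrite /N; lra.
  apply: Normc.eq0_normc; apply/eqP; rewrite eq_le cmod_ge0 andbT.
  apply: (small_le0 _ (2 * (`|B| * N) + `|B|)) => [|e e0 e1].
    by rewrite addr_ge0// mulr_ge0// mulr_ge0//; lra.
  have e20 : 0 < e ^+ 2 by rewrite exprn_gt0.
  have [z [q [hq qe]]] := sqrt_approx sq p _ e20.
  have [z2 h2] := peval_mul z z.
  rewrite (psi_add (P z2) (P q)); last first.
    by move=> u; rewrite /= /polyfun h2 hq; ring.
  rewrite (dpsi (P z) (P z)); last by apply/funext => u; rewrite /= /polyfun h2.
  rewrite phiP; set zx := peval z x.
  have zx1 : cmod zx <= e.
    apply: sq_lt_cmod; rewrite ?cmod_ge0 ?(ltW e0)// -cmodX.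
    by have := qe x (or_introl hx); rewrite hq px0 sub0r cmodN.
  have zN : cmod (psi (P z)) <= `|B| * N.
    apply: hBM; first lra.
    move=> u; apply: sq_lt_cmod; rewrite ?cmod_ge0//; first lra.
    rewrite -cmodX; have := qe _ (or_intror (set_valP u)); rewrite hq cmod_distC.
    move=> /cmod_near h; apply: le_trans h _.
    have : cmod (peval p (\val u)) <= `|M| by apply: le_trans (ler_norm M); exact: hM.
    have : e ^+ 2 <= 1 by rewrite exprn_ile1// ltW.
    have : N <= N ^+ 2 by rewrite expr2 ler_peMl//; lra.
    by rewrite /N; lra.
  have qB : cmod (psi (P q)) <= `|B| * e ^+ 2.
    apply: hBM; first exact: ltW.
    by move=> u; exact: (qe _ (or_intror (set_valP u))).
  have e2e : e ^+ 2 <= e by rewrite expr2 ler_piMl// ltW.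
  apply: le_trans (cmodD_le _ _) _; rewrite (mulrC _ zx).
  have := cmodD_le (zx * psi (P z)) (zx * psi (P z)); rewrite !cmodM.
  have : cmod zx * cmod (psi (P z)) <= e * (`|B| * N) by rewrite ler_pM ?cmod_ge0.
  have : `|B| * e ^+ 2 <= `|B| * e by rewrite ler_wpM2l.
  lra.
have psi_poly p : psi (P p) = 0.
  have [one h1] := peval_cst 1; have [c hc] := peval_cst (peval p x).
  have [q hq] := peval_sub p c.
  have e1 : psi (P one) = 0.
    have := dpsi (P one) (P one) (P one); rewrite phiP h1 mulr1 mul1r => e.
    have /e : \val (P one) = \val (P one) * \val (P one).
      by apply/funext => u; rewrite /GRing.mul /= /polyfun h1 mulr1.
    by move=> /eqP; rewrite -[X in X == _]addr0 => /eqP/addrI ->.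
  rewrite (lpsi (peval p x) (P one) (P q)).
    by rewrite e1 mulr0 add0r psi_zero// hq hc subrr.
  apply/funext => u; rewrite /= /polyfun.
  rewrite -[peval p _](subrK (peval c (\val u))) -hq hc addrC.
  by rewrite -[RHS]/(peval p x * peval one (\val u) + peval q (\val u)) h1 mulr1.
apply: Normc.eq0_normc; apply/eqP; rewrite eq_le cmod_ge0 andbT.
apply: (small_le0 _ `|B|) => // e e0 _; rewrite mulrC.
have pf : polyalg X (\val f) := set_valP f.
have [p hp] := (polyalgP X _).1 pf _ e0.
have pd : polyalg X (fun u => \val f u + polyfun X (mpoly.mpolyC n (-1)) u * polyfun X p u).
  apply: polyalgD => //; apply: polyalgM => //; exact: polyalg_polyfun.
rewrite (psi_add (P p) (mk _ pd)); last first.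
  by move=> u; rewrite /= {2}/polyfun /peval mpoly.mevalC; ring.
rewrite psi_poly add0r; apply: hBM; first exact: ltW.
move=> u; rewrite /= {1}/polyfun /peval mpoly.mevalC mulN1r.
exact/ltW/hp.
Qed.

End Derivations.

Definition separates x y (r : R) := forall d : R, 0 < d -> exists g,
  [/\ forall u, X u -> cmod (peval g u) <= 1, cmod (peval g x) <= d &
      r <= cmod (peval g y)].

(** Replacing g by an approximate square root improves r to nearly sqrt r, so the
    supremum of the admissible r is at least its own square root, hence 1. *)
Lemma separates_one x y r0 : dense_squares -> polyhull X x -> polyhull X y ->
  0 < r0 -> separates x y r0 -> forall r, r < 1 -> separates x y r.
Proof.
move=> sq hx hy r00 h0.
pose T := [set r | separates x y r].
have ub1 : ubound T 1.
  move=> r hr; have [g [g1 _ gr]] := hr 1 ltr01.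
  by apply: le_trans gr _; apply: hull_le.
have hT : has_sup T by split; [exists r0|exists 1].
have s0 : 0 < sup T by apply: lt_le_trans r00 _; apply: ub_le_sup => //; exists 1.
have s1 : sup T <= 1 by apply: ge_sup => //; exists r0.
suff s1' : 1 <= sup T.
  move=> r r1 d d0; have r1' : 0 < sup T - r by lra.
  have [r' hr' rr'] := sup_adherent r1' hT.
  have [g [g1 g2 g3]] := hr' d d0; exists g; split => //.
  by apply: le_trans g3; lra.
rewrite leNgt; apply/negP => lt.
set s := sup T in s0 s1 lt.
(* a number above s whose square is below s *)
pose sg := s + s * (1 - s) / 4.
have a0 : 0 < s * (1 - s) by rewrite mulr_gt0//; lra.
have ssg : s < sg by rewrite /sg; lra.
have sg1 : sg <= 1 by rewrite /sg; nra.
have sgs : 0 < s - sg ^+ 2.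
  have -> : s - sg ^+ 2 = (s * (1 - s)) * (1 - s * 1 / 2 - s * (1 - s) / 16).
    by rewrite /sg; field.
  by rewrite mulr_gt0//; nra.
have [r hr rs] := sup_adherent sgs hT.
have rsg : 0 < r - sg ^+ 2 by rewrite -/s in rs; lra.
suff : T sg.
  move=> hsg; have : sg <= s by apply: ub_le_sup => //; exists 1.
  by rewrite leNgt ssg.
move=> d d0.
pose e := Num.min 1 (Num.min (d ^+ 2 / 2) ((r - sg ^+ 2) / 5)).
have e0 : 0 < e by rewrite !lt_min ltr01 !divr_gt0// exprn_gt0.
have e1 : e <= 1 by rewrite ge_min lexx.
have ed : 2 * e <= d ^+ 2.
  have : e <= d ^+ 2 / 2 by rewrite !ge_min lexx orbT.
  lra.
have er : 5 * e <= r - sg ^+ 2.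
  have : e <= (r - sg ^+ 2) / 5 by rewrite !ge_min lexx !orbT.
  lra.
have [g [g1 g2 g3]] := hr e e0.
have [z [q [hq qe]]] := sqrt_approx sq g _ e0.
have [c hc] := peval_cst ((1 + e)^-1%:C); have [g' hg'] := peval_mul c z.
have e10 : 0 < 1 + e by lra.
have cE u : cmod (peval g' u) = (1 + e)^-1 * cmod (peval z u).
  rewrite hg' hc cmodM; congr (_ * _).
  by rewrite cmod_real// invr_ge0 ltW.
have zz u : cmod (peval z u) ^+ 2 = cmod (peval z u ^+ 2) by rewrite cmodX.
exists g'; split => [u Xu||].
- rewrite cE mulrC ler_pdivrMr// mul1r; apply: sq_lt_cmod; rewrite ?cmod_ge0 ?(ltW e10)//.
  rewrite zz; have := qe u (or_intror Xu); rewrite hq cmod_distC => /cmod_near h.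
  by have := g1 u Xu; nra.
- rewrite cE mulrC ler_pdivrMr//; apply: (@le_trans _ _ d); last by rewrite ler_peMr ?(ltW d0)//; lra.
  apply: sq_lt_cmod; rewrite ?cmod_ge0 ?(ltW d0)//.
  rewrite zz; have := qe x (or_introl hx); rewrite hq cmod_distC => /cmod_near h.
  by lra.
rewrite cE mulrC ler_pdivlMr//; apply: sq_lt_cmod; rewrite ?cmod_ge0//; last first.
  by rewrite mulr_ge0//; lra.
rewrite zz; have := qe y (or_introl hy); rewrite hq => /cmod_near h.
rewrite exprMn.
have : sg ^+ 2 * (1 + e) ^+ 2 <= sg ^+ 2 + 3 * e.
  have h1 : sg ^+ 2 <= 1 by rewrite exprn_ile1//; lra.
  have h2 : (1 + e) ^+ 2 <= 1 + 3 * e by nra.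
  have h3 : 0 <= sg ^+ 2 by rewrite sqr_ge0.
  nra.
lra.
Qed.

Lemma poly_lip (b : {poly C}) : exists2 L : R, 0 < L &
  forall z w, cmod z <= 1 -> cmod w <= 1 -> cmod (b.[z] - b.[w]) <= L * cmod (z - w).
Proof.
suff [L [M [L0 _ hL _]]] : exists (L M : R), [/\ 0 < L, 0 < M,
  (forall z w, cmod z <= 1 -> cmod w <= 1 -> cmod (b.[z] - b.[w]) <= L * cmod (z - w)) &
  forall z, cmod z <= 1 -> cmod b.[z] <= M] by exists L.
elim/poly_ind: b => [|b c [L [M [L0 M0 hL hM]]]].
  exists 1, 1; split => // [z w _ _|z _]; rewrite !horner0 ?subrr Normc.normc0 //.
  by rewrite mul1r cmod_ge0.
exists (L + M), (M + cmod c); split.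
- exact: addr_gt0.
- by rewrite ltr_pwDl ?cmod_ge0.
- move=> z w z1 w1; rewrite !hornerMXaddC opprD addrACA subrr addr0.
  apply: le_trans (cmod_subM _ _ _ _) _; rewrite mulrDl addrC; apply: lerD.
    apply: le_trans (_ : L * cmod (z - w) * 1 <= _); last by rewrite mulr1.
    by rewrite ler_pM ?cmod_ge0// hL.
  by rewrite ler_wpM2r ?cmod_ge0// hM.
- move=> z z1; rewrite hornerMXaddC; apply: le_trans (cmodD_le _ _) _.
  rewrite lerD2r cmodM -[M]mulr1; apply: ler_pM; rewrite ?cmod_ge0//; exact: hM.
Qed.

Lemma moebius_le (t : R) (z : C) : 0 <= t -> t < 1 -> cmod z <= 1 ->
  cmod (z - t%:C) <= cmod (1 - t%:C * z).
Proof.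
case: z => a b t0 t1 z1.
have ab : a ^+ 2 + b ^+ 2 <= 1.
  by rewrite -ler_sqrt// sqrtr1; exact: z1.
have -> : (a +i* b) - t%:C = (a - t) +i* b.
  by apply/eqP; rewrite eq_complex /= subr0 !eqxx.
have -> : 1 - t%:C * (a +i* b) = (1 - t * a) +i* (- (t * b)).
  apply/eqP; rewrite eq_complex /= !mul0r subr0 addr0 sub0r !eqxx //.
rewrite /= ler_sqrt; last by rewrite addr_ge0 ?sqr_ge0.
have : 0 <= (1 - t ^+ 2) * (1 - (a ^+ 2 + b ^+ 2)).
  by rewrite mulr_ge0//; [rewrite subr_ge0 exprn_ile1// ltW|lra].
by lra.
Qed.

(** Partial sums of the disc automorphism (z - t) / (1 - t z), normalized to stay
    in the disc; as t tends to 1 their values at 0 and 1 approach -1 and 1. *)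
Lemma disc_poly (d : R) : 0 < d -> exists b : {poly C},
  (forall z, cmod z <= 1 -> cmod b.[z] <= 1) /\ 2 - d <= cmod (b.[0] - b.[1]).
Proof.
move=> d0; pose a := Num.min (1 / 2) (d / 4).
have a0 : 0 < a by rewrite lt_min !divr_gt0.
have a1 : a <= 1 / 2 by rewrite ge_min lexx.
have ad : 4 * a <= d.
  have : a <= d / 4 by rewrite ge_min lexx orbT.
  lra.
pose t := 1 - a; have t0 : 0 <= t by rewrite /t; lra.
have t1 : t < 1 by rewrite /t; lra.
have [N hN] : exists N : nat, t ^+ N.+1 <= a.
  have : t ^+ k @[k --> \oo] --> (0 : R) by apply: cvg_expr; rewrite ger0_norm.
  move=> /cvgrPdist_lt/(_ _ a0)[k _ /(_ k.+1 (leqnSn k))] /=.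
  by rewrite sub0r normrN ger0_norm ?exprn_ge0// => h; exists k; exact: ltW.
set T := t ^+ N.+1 in hN; have T0 : 0 <= T by rewrite exprn_ge0.
have T1 : 0 < 1 + T by rewrite ltr_wpDr.
pose b : {poly C} := ((1 + T)^-1%:C)%:P * (('X - (t%:C)%:P) *
  \sum_(k < N.+1) (t%:C *: 'X) ^+ k).
have bE z : (1 - t%:C * z) * b.[z] = (1 + T)^-1%:C * ((z - t%:C) * (1 - T%:C * z ^+ N.+1)).
  have -> : b.[z] = (1 + T)^-1%:C * ((z - t%:C) * \sum_(k < N.+1) (t%:C * z) ^+ k).
    rewrite /b hornerCM hornerM hornerXsubC horner_sum; congr (_ * (_ * _)).
    by apply: eq_bigr => k _; rewrite horner_exp hornerZ hornerX.
  have -> : T%:C * z ^+ N.+1 = (t%:C * z) ^+ N.+1 by rewrite exprMn -rmorphXn.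
  rewrite -[1 - (t%:C * z) ^+ _]opprB subrX1; ring.
have nt z : cmod z <= 1 -> 0 < cmod (1 - t%:C * z).
  move=> z1; have := cmodD_le (1 - t%:C * z) (t%:C * z); rewrite subrK Normc.normc1 cmodM cmod_real//.
  have : t * cmod z <= t by rewrite ler_piMr.
  lra.
exists b; split => [z z1|].
  rewrite -(ler_pM2l (nt z z1)) -cmodM bE mulr1 !cmodM cmod_real ?invr_ge0 ?(ltW T1)//.
  rewrite ler_pdivrMl// (mulrC (1 + T)); apply: ler_pM; rewrite ?cmod_ge0 ?moebius_le//.
  apply: le_trans (cmodB_le _ _) _; rewrite Normc.normc1 lerD2l cmodM cmod_real//.
  by rewrite cmodX ler_piMr// exprn_ile1 ?cmod_ge0.
have b0 : b.[0] = ((1 + T)^-1 * - t)%:C.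
  have := bE 0; rewrite mulr0 subr0 mul1r => ->.
  by rewrite sub0r expr0n /= mulr0 subr0 mulr1 rmorphM rmorphN.
have b1 : b.[1] = ((1 + T)^-1 * (1 - T))%:C.
  have n0 : 1 - t%:C * 1 != 0 :> C.
    by apply: contraTneq (nt 1 _) => [->|]; rewrite ?Normc.normc0 ?ltxx ?Normc.normc1.
  apply: (mulfI n0); rewrite bE expr1n !mulr1 rmorphM rmorphB /=; ring.
rewrite cmod_distC b0 b1 -rmorphB cmod_real -mulrBr.
  rewrite mulrC ler_pdivlMr// /t.
  have : 0 <= a * T by rewrite mulr_ge0// ltW.
  have : d * (1 + T) >= d by rewrite ler_peMr ?(ltW d0)//; lra.
  by lra.
by rewrite mulr_ge0 ?invr_ge0 ?(ltW T1)//; lra.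
Qed.

(** A function close to 0 at x and of modulus close to 1 at y is rotated to be
    positive at y and then composed with a polynomial of the disc whose values at
    0 and 1 are nearly opposite. *)
Lemma far_apart x y (d : R) : dense_squares -> polyhull X x -> polyhull X y -> x <> y ->
  0 < d -> exists f, (forall u, X u -> cmod (peval f u) <= 1) /\
    2 - d <= cmod (peval f x - peval f y).
Proof.
move=> sq hx hy xy d0.
have [i hi] : exists i, x ord0 i <> y ord0 i.
  apply: contrapT => /forallNP h; apply: xy; apply/matrixP => a i.
  by rewrite (ord1 a); exact: contrapT.
pose p0 := mpoly.mpolyX C (mpoly.mnm1 i).
have p0E u : peval p0 u = u ord0 i by rewrite /peval mpoly.mevalXU.
have [c hc] := peval_cst (x ord0 i); have [p hp] := peval_sub p0 c.
have [M hM] := polyfun_bounded X p cX.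
have M1 : 0 < `|M| + 1 by rewrite ltr_wpDl.
have [c' hc'] := peval_cst ((`|M| + 1)^-1%:C); have [g hg] := peval_mul c' p.
have gE u : cmod (peval g u) = (`|M| + 1)^-1 * cmod (peval p u).
  rewrite hg hc' cmodM; congr (_ * _).
  by rewrite cmod_real// invr_ge0 ltW.
have r00 : 0 < cmod (peval g y).
  rewrite gE mulr_gt0 ?invr_gt0// lt_neqAle cmod_ge0 andbT eq_sym.
  apply/eqP => /Normc.eq0_normc; rewrite hp hc p0E => /eqP; rewrite subr_eq0 => /eqP h.
  exact: hi.
have sep0 : separates x y (cmod (peval g y)).
  move=> e e0; exists g; split => // [u Xu|].
    rewrite gE mulrC ler_pdivrMr// mul1r.
    have := hM (SigSub (mem_set Xu)); rewrite /polyfun /= => h.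
    by apply: le_trans h _; have := ler_norm M; lra.
  by rewrite gE hp hc p0E subrr Normc.normc0 mulr0 ltW.
have d20 : 0 < d / 2 by rewrite divr_gt0.
have [b [b1 bd]] := disc_poly _ d20; have [L L0 hL] := poly_lip b.
pose e := Num.min (1 / 2) (d / (4 * L)).
have e0 : 0 < e by rewrite lt_min !divr_gt0// mulr_gt0.
have eL : L * e <= d / 4.
  have : e * (4 * L) <= d by rewrite -ler_pdivlMr ?mulr_gt0// ge_min lexx orbT.
  lra.
have e1 : 1 - e < 1 by lra.
have [g' [g1 g2 g3]] := separates_one _ _ _ sq hx hy r00 sep0 _ e1 _ e0.
have gy1 : cmod (peval g' y) <= 1 by apply: hull_le.
have gx1 : cmod (peval g' x) <= 1 by apply: hull_le.
have gy0 : 0 < cmod (peval g' y).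
  apply: lt_le_trans g3; have : e <= 1 / 2 by rewrite ge_min lexx.
  lra.
set w := peval g' y in g3 gy1 gy0.
have w0 : w != 0 by apply: contraTneq gy0 => ->; rewrite Normc.normc0 ltxx.
(* rotate so that the value at y is positive *)
have [r hr] := peval_cst ((cmod w)%:C / w); have [h hh] := peval_mul r g'.
have hE u : cmod (peval h u) = cmod (peval g' u).
  by rewrite hh hr !cmodM Normc.normcV cmod_real ?cmod_ge0// mulfV ?mul1r// gt_eqF.
have hy' : peval h y = (cmod w)%:C by rewrite hh hr mulfVK.
have [f hf] := peval_poly b h; exists f; split => [u Xu|].
  by rewrite hf b1// hE g1.
have h1 : cmod (b.[peval h x] - b.[0]) <= L * e.
  apply: le_trans (hL _ _ _ _) _; rewrite ?hE ?Normc.normc0//.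
  by rewrite subr0 hE ler_pM2l.
have h2 : cmod (b.[peval h y] - b.[1]) <= L * e.
  apply: le_trans (hL _ _ _ _) _; rewrite ?hE ?Normc.normc1//.
  rewrite ler_pM2l// hy' cmod_distC -[1](rmorph1 (real_complex R)) -rmorphB cmod_real; lra.
rewrite !hf; apply: le_trans (_ : 2 - d / 2 - d / 4 - d / 4 <= _); first lra.
have : cmod (b.[0] - b.[1]) <= cmod (b.[peval h x] - b.[peval h y]) + L * e + L * e.
  rewrite (_ : b.[0] - b.[1] = (b.[peval h x] - b.[peval h y]) - (b.[peval h x] - b.[0]) +
     (b.[peval h y] - b.[1])); last by ring.
  apply: le_trans (cmodD_le _ _) _; apply: lerD => //.
  by apply: le_trans (cmodB_le _ _) _; apply: lerD.
lra.
Qed.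

Lemma trivial_gleason_part x : dense_squares -> polyhull X x ->
  gleason_part (point_functional X x) = [set point_functional X x].
Proof.
move=> sq hx; have [mx evx] := point_functionalP cX x hx.
apply/seteqP; split => [psi [mpsi dn]|_ ->]; last first.
  split => //; apply: (@le_lt_trans _ _ 0%E); last by rewrite lte_fin.
  apply: ge_ereal_sup => _ [f _ <-]; rewrite subrr Normc.normc0 //.
have [_ _ sj] := maximal_ideal_space_polyalg cX.
have [y hy yE] := sj psi mpsi; rewrite -yE in dn *.
have [my evy] := point_functionalP cX y hy.
apply: contrapT => ne; have xy : x <> y by move=> e; apply: ne; rewrite e.
set dnorm := dual_norm _ in dn.
have big (d : R) : 0 < d -> ((2 - d)%:E <= dnorm)%E.
  move=> d0; have [f [f1 fd]] := far_apart _ _ _ sq hx hy xy d0.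
  apply: (@le_trans _ _ (cmod (peval f x - peval f y))%:E); first by rewrite lee_fin.
  apply: ereal_sup_ubound; pose F : polyalg X := SigSub (mem_set (polyalg_polyfun X f)).
  exists F; first by apply: supnorm_le => // u; exact: (f1 _ (set_valP u)).
  by rewrite (evx f F)// (evy f F).
have d1 := big 1 ltr01.
case: dnorm dn big d1 => [r| |] //; rewrite lte_fin => r2 big _.
have d0 : 0 < (2 - r) / 2 by lra.
by have := big _ d0; rewrite lee_fin; lra.
Qed.

End DenseSquares.

(** * Compactness of the closure of a bounded set of C^n *)

Section Compactness.
Context {R : realType}.
Local Notation C := R[i].

Lemma real_complex_continuous : continuous (fun r : R => r%:C : C).
Proof.
move=> r; apply/cvgrPdist_lt => e e0; have [r0 er] := posC_cmod _ e0.
near=> s; rewrite er cmodE ltcR -rmorphB.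
have -> : cmod ((r - s)%:C : C) = `|r - s|.
  by rewrite /= expr0n /= addr0 sqrtr_sqr.
by near: s; exact: cvgr_dist_lt.
Unshelve. all: by end_near. Qed.

Lemma square_compact (M : R) :
  compact [set z : C | `|complex.Re z| <= M /\ `|complex.Im z| <= M].
Proof.
have cs : compact (`[- M, M]%classic `*` `[- M, M]%classic : set (R * R)).
  by apply: compact_setX; exact: segment_compact.
pose g (ab : R * R) : C := ab.1%:C + 'i * ab.2%:C.
have gE a b : g (a, b) = a +i* b.
  by apply/eqP; rewrite eq_complex /g /=; apply/andP; split; apply/eqP; ring.
have cg : continuous g.
  move=> ab; apply: cvgD.
    by apply: (@cvg_comp _ _ _ fst (fun r : R => r%:C : C) _ _ _ cvg_fst);
      exact: real_complex_continuous.
  apply: cvgM; first exact: cvg_cst.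
  by apply: (@cvg_comp _ _ _ snd (fun r : R => r%:C : C) _ _ _ cvg_snd);
    exact: real_complex_continuous.
rewrite (_ : [set z | _] = g @` (`[- M, M]%classic `*` `[- M, M]%classic)).
  by apply: continuous_compact => //; exact: continuous_subspaceT.
apply/seteqP; split => [[a b] /= [ha hb]|z [[a b] [ha hb] <-]].
  by exists (a, b); [split; rewrite /= in_itv /= -ler_norml|exact: gE].
by rewrite gE /= !ler_norml; move: ha hb; rewrite /= !in_itv.
Qed.

Lemma closed_peval_le n (p : mpoly.mpoly n C) (M : R) :
  closed [set x | cmod (peval p x) <= M].
Proof.
rewrite (_ : [set x | _] = (fun x => cmod (peval p x)) @^-1` [set r | r <= M])//.
apply: closed_comp; last exact: closed_le.
move=> x _; apply: (@continuous_comp _ _ _ (peval p) (fun z => cmod z)).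
  exact: peval_continuous.
exact: cmod_continuous.
Qed.

Lemma closure_peval_le n (S : set 'rV[C]_n) (p : mpoly.mpoly n C) (M : R) :
  (forall x, S x -> cmod (peval p x) <= M) ->
  forall x, closure S x -> cmod (peval p x) <= M.
Proof.
move=> h x; rewrite closureE => /(_ [set x | cmod (peval p x) <= M]); apply.
by split; [exact: closed_peval_le|exact: h].
Qed.

Lemma closure_peval_ge n (S : set 'rV[C]_n) (p : mpoly.mpoly n C) (M : R) :
  (forall x, S x -> M <= cmod (peval p x)) ->
  forall x, closure S x -> M <= cmod (peval p x).
Proof.
move=> h x; rewrite closureE => /(_ [set x | M <= cmod (peval p x)]); apply.
split; last exact: h.
rewrite (_ : [set x | _] = (fun x => cmod (peval p x)) @^-1` [set r | M <= r])//.
apply: closed_comp; last exact: closed_ge.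
move=> y _; apply: (@continuous_comp _ _ _ (peval p) (fun z => cmod z)).
  exact: peval_continuous.
exact: cmod_continuous.
Qed.

Lemma bounded_closure_compact n (S : set 'rV[C]_n) (M : R) :
  (forall x i, S x -> cmod (x ord0 i) <= M) -> compact (closure S).
Proof.
move=> h; apply: (@subclosed_compact _ _ [set v : 'rV[C]_n |
    forall i, [set z : C | `|complex.Re z| <= M /\ `|complex.Im z| <= M] (v ord0 i)]).
- exact: closed_closure.
- apply: (@rV_compact C n (fun=> [set z : C | `|complex.Re z| <= M /\ `|complex.Im z| <= M])).
  by move=> i; exact: square_compact.
move=> x hx i /=.
have := closure_peval_le _ S (mpoly.mpolyX _ (mpoly.mnm1 i)) M.
rewrite /peval => h1; have := h1 _ x hx; rewrite mpoly.mevalXU => h2.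
have h3 : cmod (x ord0 i) <= M by apply: h2 => y Sy; rewrite mpoly.mevalXU; exact: h.
by split; apply: le_trans h3; [exact: cmod_Re|exact: cmod_Im].
Qed.

End Compactness.

(** * The example *)

Theorem theorem1p1 (R : realType) :
  exists X : set 'rV[R[i]]_3,
    [/\ compact X,
        polyhull X `\` X !=set0,
        forall x, polyhull X x ->
          gleason_part (point_functional X x) = [set point_functional X x] &
        forall x, polyhull X x ->
          forall psi : polyalg X -> R[i],
            point_derivation (point_functional X x) psi ->
            bounded_functional psi ->
            forall f, psi f = 0].
Proof.
have [st [st0 hst]] := @stage_sequence R.
have ist n := (hst n).1; have nst n := (hst n).2.
pose X := closure (boundary0 st).
have cX : compact X.
  apply: (bounded_closure_compact _ _ 2) => x i [u [hu _ ov]].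
  exact: (over_bound st st0 u x i hu ov).
have sq : dense_squares X.
  move=> p d d0; have [z hz] := square_approx st st0 ist nst p d d0; exists z.
  have [z2 h2] := peval_mul z z; have [q hq] := peval_sub p z2.
  have qE x : peval q x = peval p x - peval z x ^+ 2 by rewrite hq h2 expr2.
  move=> x Xx; rewrite -qE; apply: (closure_peval_le _ (boundary0 st)) Xx.
  by move=> y [u [hu _ ov]]; rewrite qE; exact: hz hu ov.
exists X; split => //.
- have Y0 : curve (rels (st 0%N)) (fun=> 0) by rewrite st0; split=> //; rewrite Normc.normc0.
  have [u hu uE] := tower_extend st st0 ist nst 0 _ Y0.
  have u0 : u 0%N = 0 by rewrite uE.
  have [x ov] := over_ex st ist nst u hu.
  exists x; split.
    move=> p; apply: (center_bound st st0 ist nst p _ u) => // [y by0|].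
      have Xy : X y by exact: subset_closure.
      exact: (polyalg_le_supnorm X (polyfun X p) (SigSub (mem_set Xy)) cX (polyalg_polyfun X p)).
    exact: supnorm_ge0.
  move=> Xx; have := closure_peval_ge _ _ (mpoly.mpolyX _ (mpoly.mnm1 0)) 1 _ x Xx.
  rewrite /peval mpoly.mevalXU ov.1 u0 Normc.normc0 => /(_ _); rewrite leNgt ltr01 => h.
  by apply: notF; apply: h => y [v [_ v1 ov']]; rewrite mpoly.mevalXU ov'.1 v1.
- by move=> x hx; exact: trivial_gleason_part.
- by move=> x hx psi dpsi bpsi; exact: (no_point_derivation X cX x).
Qed.
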